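(* Let $\bar\alpha,\bar\beta\in[0,\infty)$ be arbitrary but fixed, let $\gamma,\mu\in(0,\infty)$, and let $f\in L^2(\Omega)$. Let $R^{\gamma,\mu}_{\alpha,\beta}$ be either $\mathrm{TGV}^{2,\gamma,\mu}_{\alpha,\beta}$ or $\mathrm{ICTV}^{\gamma,\mu}_{\alpha,\beta}$, and let the cost functional $F$ be either $F_{L_2^2}$ (with $f_0\in L^2(\Omega)$) or $F_{L^1_\eta\nabla}$ (with $f_0\in L^2(\Omega)\cap BV(\Omega)$). Then the learning problem $$\min_{(\alpha,\beta)\in\mathbb{R}^2} F(u_{\alpha,\beta})\quad\text{subject to}\quad u_{\alpha,\beta}\in\operatorname*{arg\,min}_{u\in H^1(\Omega)}\Big\{\tfrac12\|u-f\|_{L^2(\Omega)}^2+R^{\gamma,\mu}_{\alpha,\beta}(u)\Big\},\quad 0\le\alpha\le\bar\alpha,\ 0\le\beta\le\bar\beta,$$ has an optimal solution $(\hat\alpha,\hat\beta)\in\mathbb{R}^2$.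
   Context: $\Omega\subset\mathbb{R}^n$ is an open bounded domain with Lipschitz boundary, and $\mathbb{H}^1(\Omega):=H^1(\Omega;\mathbb{R}^n)$. $Ew$ is the symmetrised gradient of a vector field $w$. Huber regularisation: for $\gamma\in(0,\infty]$ and $g\in\mathbb{R}^m$ (or a matrix, with the Frobenius norm), $|g|_\gamma=\|g\|_2-\frac1{2\gamma}$ if $\|g\|_2\ge 1/\gamma$ and $|g|_\gamma=\frac{\gamma}{2}\|g\|_2^2$ if $\|g\|_2<1/\gamma$. For $u\in H^1(\Omega)$ define $$\mathrm{TGV}^{2,\gamma,\mu}_{\alpha,\beta}(u):=\min_{w\in\mathbb{H}^1(\Omega)}\int_\Omega\alpha|Du-w|_\gamma\,dx+\int_\Omega\beta|Ew|_\gamma\,dx+\frac{\mu}{2}\big(\|u\|_{H^1(\Omega)}^2+\|w\|_{\mathbb{H}^1(\Omega)}^2\big),$$ $$\mathrm{ICTV}^{\gamma,\mu}_{\alpha,\beta}(u):=\min_{v\in W^{1,1}(\Omega),\ \nabla v\in BV(\Omega;\mathbb{R}^n)\cap\mathbb{H}^1(\Omega)}\int_\Omega\alpha|Du-\nabla v|_\gamma\,dx+\int_\Omega\beta|D\nabla v|_\gamma\,dx+\frac{\mu}{2}\big(\|u\|_{H^1(\Omega)}^2+\|\nabla v\|_{\mathbb{H}^1(\Omega)}^2\big).$$ Cost functionals: for $u\in H^1(\Omega)$, $$F_{L_2^2}(u):=\tfrac12\|f_0-u\|_{L^2(\Omega)}^2,\qquad F_{L^1_\eta\nabla}(u):=\int_\Omega|D(f_0-u)|_\gamma\,dx.$$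 In the second cost $D(f_0-u)$ is a finite Radon measure; the integral is understood in the usual sense for convex functions of measures: $\int_\Omega|\nabla^a(f_0-u)|_\gamma\,dx+|D^sf_0|(\Omega)$, where $\nabla^a$ is the density of the absolutely continuous part and $D^s$ the singular part. *)

(* Defs.v *)
From HB Require Import structures.
From mathcomp Require Import all_boot all_order all_algebra.
From mathcomp Require Import all_classical all_reals all_analysis.

Set Implicit Arguments.
Unset Strict Implicit.
Unset Printing Implicit Defensive.

Import Order.TTheory GRing.Theory Num.Theory.
Import numFieldNormedType.Exports.

Local Open Scope classical_set_scope.
Local Open Scope ring_scope.

Definition measure_matrix_display : measure_display -> measure_display.
Proof. exact. Qed.

(* The product sigma-algebra on matrices, generated by the entry maps; on
   ['rV[R]_n] it is the Borel sigma-algebra of R^n. *)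
Section measurable_matrix.
Context {d} {T : measurableType d} (m n : nat).

Definition measurable_entry : set (set 'M[T]_(m, n)) :=
  [set B | exists i j, exists2 A : set T, measurable A &
     B = [set M : 'M[T]_(m, n) | A (M i j)]].

Let mx_set0 : <<s measurable_entry >> set0.
Proof. exact: sigma_algebra0. Qed.

Let mx_setC A : <<s measurable_entry >> A -> <<s measurable_entry >> (~` A).
Proof. exact: sigma_algebraC. Qed.

Let mx_bigcup (F : (set 'M[T]_(m, n))^nat) :
  (forall k, <<s measurable_entry >> (F k)) ->
  <<s measurable_entry >> (\bigcup_k (F k)).
Proof. exact: sigma_algebra_bigcup. Qed.

HB.instance Definition _ := @isMeasurable.Build (measure_matrix_display d)
  'M[T]_(m, n) (<<s measurable_entry >>) mx_set0 mx_setC mx_bigcup.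

Lemma measurable_mx_fun d' (aT : measurableType d') (f : aT -> 'M[T]_(m, n)) :
  (forall i j, measurable_fun setT (fun t => f t i j)) ->
  measurable_fun setT f.
Proof.
move=> mf; apply: (@measurability _ _ _ _ setT f measurable_entry) => //.
move=> _ [_ [i [j [A mA ->]]] <-].
exact: (mf i j measurableT A mA).
Qed.

Lemma measurable_mx_entry (i : 'I_m) (j : 'I_n) :
  measurable_fun setT (fun M : 'M[T]_(m, n) => M i j).
Proof.
move=> _ A mA; rewrite setTI; apply: sub_sigma_algebra.
by exists i, j, A.
Qed.

End measurable_matrix.

Section lebesgue_rV.
Context {R : realType}.

Definition rV_cons n (p : R * 'rV[R]_n) : 'rV[R]_(1 + n) :=
  row_mx p.1%:M p.2.

Definition rV_uncons n (v : 'rV[R]_(1 + n)) : R * 'rV[R]_n :=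
  (v ord0 ord0, rsubmx v).

Lemma rV_consEl n (p : R * 'rV[R]_n) i (k : 'I_1) :
  rV_cons p i (lshift n k) = p.1.
Proof. by rewrite /rV_cons row_mxEl mxE !ord1 eqxx mulr1n. Qed.

Lemma rV_consEr n (p : R * 'rV[R]_n) i (k : 'I_n) :
  rV_cons p i (rshift 1 k) = p.2 i k.
Proof. by rewrite /rV_cons row_mxEr. Qed.

Lemma rV_consK n : cancel (@rV_cons n) (@rV_uncons n).
Proof.
case=> x v; rewrite /rV_uncons; congr pair; last by rewrite row_mxKr.
have -> : ord0 = lshift n (ord0 : 'I_1) by exact/val_inj.
by rewrite rV_consEl.
Qed.

Lemma measurable_rV_cons n : measurable_fun setT (@rV_cons n).
Proof.
apply: measurable_mx_fun => i j.
have [k ->|k ->] := split_ordP j.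
  by under eq_fun do rewrite rV_consEl; exact: measurable_fst.
under eq_fun do rewrite rV_consEr.
exact: (measurableT_comp (measurable_mx_entry i k) measurable_snd).
Qed.

Lemma measurable_rV_uncons n : measurable_fun setT (@rV_uncons n).
Proof.
apply: measurable_fun_pair; first exact: measurable_mx_entry.
apply: measurable_mx_fun => i j; under eq_fun do rewrite mxE.
exact: measurable_mx_entry.
Qed.

Section step.
Variables (n : nat) (mu : {sigma_finite_measure set 'rV[R]_n -> \bar R}).

Definition lebesgue_rV_step : set 'rV[R]_(1 + n) -> \bar R :=
  pushforward (@lebesgue_measure R \x mu)%E (@rV_cons n).

Let step0 : lebesgue_rV_step set0 = 0%E.
Proof. by rewrite /lebesgue_rV_step /pushforward preimage_set0 measure0. Qed.

Let step_ge0 A : (0 <= lebesgue_rV_step A)%E.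
Proof. by apply: integral_ge0 => x _; exact: measure_ge0. Qed.

Let step_sigma_additive : semi_sigma_additive lebesgue_rV_step.
Proof.
move=> F mF tF mUF; rewrite /lebesgue_rV_step /pushforward preimage_bigcup.
have mp A : measurable A -> measurable (@rV_cons n @^-1` A).
  by move=> mA; rewrite -[X in measurable X]setTI; exact: measurable_rV_cons.
apply: measure_semi_sigma_additive.
- by move=> k; exact: mp.
- apply/trivIsetP => /= i j _ _ ij; rewrite -preimage_setI.
  by move/trivIsetP : tF => /(_ _ _ _ _ ij) ->//; rewrite preimage_set0.
- by rewrite -preimage_bigcup; exact: mp.
Qed.

HB.instance Definition _ := isMeasure.Build _ _ _ lebesgue_rV_step
  step0 step_ge0 step_sigma_additive.

Let step_sigma_finite : sigma_finite setT lebesgue_rV_step.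
Proof.
have /sigma_finiteP[F [FT ndF Foo]] := sigma_finiteT (@lebesgue_measure R).
have /sigma_finiteP[G [GT ndG Goo]] := sigma_finiteT mu.
exists (fun k => @rV_uncons n @^-1` (F k `*` G k)).
  rewrite -preimage_bigcup (_ : \bigcup_k (F k `*` G k) = setT) //.
  rewrite -subTset => -[x y] _.
  have [k _ Fkx] : (\bigcup_k F k) x by rewrite -FT.
  have [l _ Gly] : (\bigcup_k G k) y by rewrite -GT.
  exists (maxn k l) => //; split => /=.
    by move: x Fkx; exact/subsetPset/ndF/leq_maxl.
  by move: y Gly; exact/subsetPset/ndG/leq_maxr.
move=> k; have [mF Fk] := Foo k; have [mG Gk] := Goo k; split.
  rewrite -[X in measurable X]setTI.
  by apply: measurable_rV_uncons => //; exact: measurableX.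
rewrite /lebesgue_rV_step /pushforward -comp_preimage.
rewrite (_ : _ \o _ = id) ?preimage_id; last first.
  by apply/funext => p /=; rewrite rV_consK.
by rewrite product_measure1E// lte_mul_pinfty// ge0_fin_numE.
Qed.

HB.instance Definition _ := Measure_isSigmaFinite.Build _ _ _ lebesgue_rV_step
  step_sigma_finite.

End step.

(* n-dimensional Lebesgue measure, as the n-fold product of the
   one-dimensional one; the Dirac mass on the one-point space ['rV[R]_0] is
   the empty product. *)
Fixpoint lebesgue_rV n : {sigma_finite_measure set 'rV[R]_n -> \bar R} :=
  if n is n'.+1 then lebesgue_rV_step (lebesgue_rV n')
  else \d_ (0 : 'rV[R]_0).

End lebesgue_rV.

Section euclidean.
Context {R : realType} {m n : nat}.

(* The canonical norm on matrices is the max-norm; this is the Euclidean norm of vectors and the Frobenius norm of matrices. *)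
Definition l2norm (A : 'M[R]_(m, n)) : R :=
  Num.sqrt (\sum_i \sum_j A i j ^+ 2).

Definition huber (gamma : R) (A : 'M[R]_(m, n)) : R :=
  if gamma^-1 <= l2norm A then l2norm A - (2 * gamma)^-1
  else gamma / 2 * l2norm A ^+ 2.

End euclidean.

Section domains.
Context {R : realType} {n : nat}.
Implicit Types Omega : set 'rV[R]_n.

(* Near each boundary point, and after an orthogonal change of coordinates
   [Q], the set is the strict epigraph over the [i]-th coordinate hyperplane
   of a Lipschitz function. *)
Definition lipschitz_boundary Omega :=
  forall x, (closure Omega `\` interior Omega) x ->
  exists (Q : 'M[R]_n) (i : 'I_n) (zeta : 'rV[R]_n.-1 -> R),
    [/\ Q *m Q^T = 1%:M,
        [lipschitz zeta y | y in [set: 'rV[R]_n.-1]] &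
        \forall y \near x,
          Omega y <-> zeta (col' i (y *m Q)) < (y *m Q) ord0 i].

Definition bounded_lipschitz_domain Omega :=
  [/\ open Omega, Omega !=set0, connected Omega, bounded_set Omega &
      lipschitz_boundary Omega].

End domains.

Section test_functions.
Context {R : realType} {n : nat}.

Definition partial (i : 'I_n) (phi : 'rV[R]_n -> R) : 'rV[R]_n -> R :=
  'D_(delta_mx 0 i) phi.

Definition partials (s : seq 'I_n) (phi : 'rV[R]_n -> R) : 'rV[R]_n -> R :=
  foldr partial phi s.

Definition smooth (phi : 'rV[R]_n -> R) :=
  forall s : seq 'I_n, continuous (partials s phi) /\
    forall (i : 'I_n) x, derivable (partials s phi) x (delta_mx 0 i).

Definition test_function (Omega : set 'rV[R]_n) : set ('rV[R]_n -> R) :=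
  [set phi | [/\ smooth phi, compact (closure [set x | phi x != 0]) &
                 closure [set x | phi x != 0] `<=` Omega]].

End test_functions.

(* Functions on [Omega] are represented by total functions on ['rV[R]_n] whose
   values outside [Omega] are irrelevant; functions that agree almost
   everywhere are not identified. *)
Section sobolev.
Context {R : realType} {n : nat} (Omega : set 'rV[R]_n).
Local Notation leb := (@lebesgue_rV R n).
Implicit Types (u v : 'rV[R]_n -> R) (w : 'rV[R]_n -> 'rV[R]_n).

Definition Lp (p : \bar R) u : Prop := u \_ Omega \in Lfun leb p.

Definition L1loc u :=
  measurable_fun Omega u /\
  forall K, compact K -> K `<=` Omega -> leb.-integrable K (EFin \o u).

Definition is_weak_grad u w :=
  [/\ L1loc u, (forall i, L1loc (fun x => w x ord0 i)) &
  forall i phi, test_function Omega phi ->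
    (\int[leb]_(x in Omega) (u x * partial i phi x)%:E =
     - \int[leb]_(x in Omega) (w x ord0 i * phi x)%:E)%E].

(* A representative of the weak gradient, which is unique up to null sets. *)
Definition grad u : 'rV[R]_n -> 'rV[R]_n := xget (fun=> 0) (is_weak_grad u).

Definition W1 (p : \bar R) u :=
  Lp p u /\ exists2 w, is_weak_grad u w & forall i, Lp p (fun x => w x ord0 i).

Definition H1 : set ('rV[R]_n -> R) := [set u | W1 2%:E u].

Definition vH1 : set ('rV[R]_n -> 'rV[R]_n) :=
  [set w | forall i, H1 (fun x => w x ord0 i)].

Definition jac w (x : 'rV[R]_n) : 'M[R]_n :=
  \matrix_(i, j) grad (fun y => w y ord0 i) x ord0 j.

Definition sym_grad w (x : 'rV[R]_n) : 'M[R]_n :=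
  2^-1 *: (jac w x + (jac w x)^T).

Definition L2_sqnorm u : \bar R := (\int[leb]_(x in Omega) (u x ^+ 2)%:E)%E.

Definition H1_sqnorm u : \bar R :=
  (L2_sqnorm u + \int[leb]_(x in Omega) (l2norm (grad u x) ^+ 2)%:E)%E.

Definition vH1_sqnorm w : \bar R :=
  (\sum_(i < n) H1_sqnorm (fun x => w x ord0 i))%E.

End sobolev.

Section charges.
Context {d} {T : measurableType d} {R : realType}.
Implicit Type nu : {charge set T -> \bar R}.

Definition hahn_pos nu : set T := sval (cid (Hahn_decomposition nu)).

Definition hahn_neg nu : set T :=
  sval (cid (svalP (cid (Hahn_decomposition nu)))).

Lemma hahn_posnegP nu : hahn_decomposition nu (hahn_pos nu) (hahn_neg nu).
Proof. exact: (svalP (cid (svalP (cid (Hahn_decomposition nu))))). Qed.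

Definition charge_integral nu (f : T -> R) : \bar R :=
  (\int[jordan_pos (hahn_posnegP nu)]_x (f x)%:E -
   \int[jordan_neg (hahn_posnegP nu)]_x (f x)%:E)%E.

(* [g] is the density with respect to [mu] of the absolutely continuous part
   of [nu] in its Lebesgue decomposition. *)
Definition is_ac_density (mu : {measure set T -> \bar R}) nu (g : T -> R) :=
  mu.-integrable setT (EFin \o g) /\
  exists2 N, measurable N /\ mu N = 0%E &
    forall A, measurable A -> A `&` N = set0 ->
      nu A = (\int[mu]_(x in A) (g x)%:E)%E.

Definition ac_density (mu : {measure set T -> \bar R}) nu : T -> R :=
  xget (fun=> 0) (is_ac_density mu nu).

Definition sing_part (mu : {measure set T -> \bar R}) nu : set T -> \bar R :=
  fun A => (nu A - \int[mu]_(x in A) (ac_density mu nu x)%:E)%E.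

(* The total variation on [A] of the R^n-valued measure with components
   [nu i], for the Euclidean norm of R^n. *)
Definition vtotal_variation n (nu : 'I_n -> set T -> \bar R) (A : set T) :
    \bar R :=
  ereal_sup [set (\sum_(0 <= k <oo)
                   (l2norm (\row_(i < n) fine (nu i (B k))))%:E)%E |
             B in [set B : (set T)^nat |
                    [/\ forall k, measurable (B k), trivIset setT B &
                        \bigcup_k B k = A]]].

End charges.

Section bounded_variation.
Context {R : realType} {n : nat} (Omega : set 'rV[R]_n).
Local Notation leb := (@lebesgue_rV R n).
Implicit Types (f : 'rV[R]_n -> R).

(* Finite signed measures on [Omega] are represented by charges on R^n that
   are concentrated on [Omega]. *)
Definition is_bv_deriv f (D : 'I_n -> {charge set 'rV[R]_n -> \bar R}) :=
  (forall i A, measurable A -> D i A = D i (A `&` Omega)) /\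
  forall i phi, test_function Omega phi ->
    (\int[leb]_(x in Omega) (f x * partial i phi x)%:E =
     - charge_integral (D i) phi)%E.

Definition BV f := Lp Omega 1%E f /\ exists D, is_bv_deriv f D.

Definition bv_deriv f : 'I_n -> {charge set 'rV[R]_n -> \bar R} :=
  if pselect (exists D, is_bv_deriv f D) is left fD then sval (cid fD)
  else fun=> czero.

Definition ac_grad f (x : 'rV[R]_n) : 'rV[R]_n :=
  \row_(i < n) ac_density leb (bv_deriv f i) x.

Definition sing_deriv f : 'I_n -> set 'rV[R]_n -> \bar R :=
  fun i => sing_part leb (bv_deriv f i).

End bounded_variation.

Section learning.
Context {R : realType} {n : nat} (Omega : set 'rV[R]_n).
Local Notation leb := (@lebesgue_rV R n).
Implicit Types (alpha beta gamma mu : R) (f u v : 'rV[R]_n -> R)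
  (w : 'rV[R]_n -> 'rV[R]_n) (Reg F : ('rV[R]_n -> R) -> \bar R).
Local Open Scope ereal_scope.

(* The minima over [w] and [v] are taken as infima in [\bar R], so that the
   regularisers are total functions whether or not the minima are attained. *)
Definition TGV gamma mu alpha beta u : \bar R :=
  ereal_inf [set
    \int[leb]_(x in Omega) (alpha * huber gamma (grad Omega u x - w x))%:E +
    \int[leb]_(x in Omega) (beta * huber gamma (sym_grad Omega w x))%:E +
    (mu / 2)%:E * (H1_sqnorm Omega u + vH1_sqnorm Omega w)
  | w in vH1 Omega].

Definition ICTV_dom : set ('rV[R]_n -> R) :=
  [set v | [/\ W1 Omega 1 v,
               forall i, BV Omega (fun x => grad Omega v x ord0 i) &
               vH1 Omega (grad Omega v)]].

Definition ICTV gamma mu alpha beta u : \bar R :=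
  ereal_inf [set
    \int[leb]_(x in Omega)
      (alpha * huber gamma (grad Omega u x - grad Omega v x))%:E +
    \int[leb]_(x in Omega)
      (beta * huber gamma (jac Omega (grad Omega v) x))%:E +
    (mu / 2)%:E * (H1_sqnorm Omega u + vH1_sqnorm Omega (grad Omega v))
  | v in ICTV_dom].

Definition F_L2 (f0 u : 'rV[R]_n -> R) : \bar R :=
  (2^-1)%:E * L2_sqnorm Omega (fun x => f0 x - u x)%R.

(* Subtracting the weakly differentiable [u] does not change the singular part of
   the derivative, which is that of [f0]. *)
Definition F_L1grad gamma (f0 u : 'rV[R]_n -> R) : \bar R :=
  \int[leb]_(x in Omega)
    (huber gamma (ac_grad Omega (fun y => f0 y - u y)%R x))%:E +
  vtotal_variation (sing_deriv Omega f0) Omega.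

Definition denoising_energy Reg f u : \bar R :=
  (2^-1)%:E * L2_sqnorm Omega (fun x => u x - f x)%R + Reg u.

Definition denoising_argmin Reg f : set ('rV[R]_n -> R) :=
  [set u | H1 Omega u /\ forall v, H1 Omega v ->
    denoising_energy Reg f u <= denoising_energy Reg f v].

Definition learning_feasible (Reg : R -> R -> ('rV[R]_n -> R) -> \bar R) f
    (alphabar betabar alpha beta : R) u :=
  [/\ (0 <= alpha <= alphabar)%R, (0 <= beta <= betabar)%R &
      denoising_argmin (Reg alpha beta) f u].

Definition learning_optimal (Reg : R -> R -> ('rV[R]_n -> R) -> \bar R) F f
    (alphabar betabar alpha beta : R) :=
  exists2 u, learning_feasible Reg f alphabar betabar alpha beta u &
    forall alpha' beta' u',
      learning_feasible Reg f alphabar betabar alpha' beta' u' ->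
      F u <= F u'.

End learning.

(* Main.v *)
Require Import Defs.
From mathcomp Require Import all_boot all_order all_algebra.
From mathcomp Require Import all_classical all_reals all_analysis.
From mathcomp Require Import measurable_realfun lebesgue_Rintegral.
From mathcomp Require Import ring lra.
Set Implicit Arguments.
Unset Strict Implicit.
Unset Printing Implicit Defensive.
Import Order.TTheory GRing.Theory Num.Theory.
Import numFieldNormedType.Exports.
Local Open Scope classical_set_scope.
Local Open Scope ring_scope.

(** For fixed parameters p = (alpha, beta) the denoising energy is an infimum
    over an auxiliary field w of an energy E_p(u, w) that is jointly convex and
    contains (mu/2) times the squared H^1 norm of u. Hence the reduced energy
    J_p(u) = inf_w E_p(u, w) is strongly convex in u. A minimising sequence for
    J_p is therefore Cauchy in H^1, and since w enters only through an infimum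
    it does not matter whether the infimum over w is attained: J_p is lower
    semicontinuous because the modulus of E_p in u is uniform in w. This gives
    a minimiser u_p, unique up to null sets.

    The terms weighted by alpha and beta are bounded by a multiple of the
    quadratic terms, as the Huber function is at most gamma/2 times the square.
    So E_p' <= (1 + B |p' - p|) E_p, and the same holds for J. Together with
    strong convexity this makes p |-> u_p continuous into H^1. A lower
    semicontinuous cost on H^1 then attains its minimum along the u_p because
    the parameters range over a compact rectangle. [bilevel_min_exists] is this
    argument on abstract data. All semicontinuity is expressed by bounds of the
    form a <= b + C (t + q/t) for 0 < t <= 1, with q the squared distance,
    which come from 2 |a b| <= t a^2 + b^2 / t and need no square roots.

    To apply it, a function of H^1 is represented by a pair of a square
    integrable function and one of its weak gradients. Such pairs form a linear
    space on which the squared norm satisfies the parallelogram identity, and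
    the space is complete ([sobolev_pair_complete]): a fast Cauchy sequence of
    L^2 converges ([square_integrable_complete]), and the equations defining
    weak gradients pass to the limit ([weak_grad_lim]). Weak gradients, and the
    derivatives of functions of bounded variation, are unique
    ([weak_grad_uniq], [bv_deriv_uniq]) because products of translates of
    exp(-1/t) are test functions that converge to the indicators of boxes, and
    boxes generate the Borel sets. By uniqueness the energy of a pair depends on
    the function only, and equals the denoising energy ([denoising_energyE]).

    The L^2 cost is quadratic. For the gradient cost, [bv_deriv_sub] says that
    subtracting u from f_0 changes the derivative by an absolutely continuous
    charge, so u influences only the absolutely continuous part, in which the
    Huber integral is 1-Lipschitz for the L^1 norm of the gradient. *)

(** * Minimisation of a lower semicontinuous cost over the minimisers of strongly convex energies *)

Section variational.
Context {R : realType}.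

Lemma le_fast_null (a b D : R) :
  (forall k : nat, a <= b + D * 2^-1 ^+ k) -> a <= b.
Proof.
move=> h; rewrite leNgt; apply/negP => ba.
have e0 : 0 < a - b by rewrite subr_gt0.
have D0 : 0 < D by have := h 0%N; rewrite expr0 mulr1; lra.
have : (fun k : nat => D * 2^-1 ^+ k) @ \oo --> (D * 0 : R).
  apply: cvgM; first exact: cvg_cst.
  apply: cvg_expr; rewrite ger0_norm ?invr_ge0//; lra.
rewrite mulr0 => /cvgrPdist_lt/(_ _ e0)[N _ /(_ N (leqnn N))] /=.
rewrite sub0r normrN ger0_norm; last by rewrite mulr_ge0 ?(ltW D0)// exprn_ge0// invr_ge0.
by have := h N; lra.
Qed.

Context {X Y : lmodType R}.
Variables (H : set X) (W : set Y) (q : X -> R) (E : R * R -> X -> Y -> R).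
Variables (K : set (R * R)) (G : X -> R) (c B M : R) (x0 : X) (w0 : Y).

Let mid {V : lmodType R} (x y : V) : V := 2^-1 *: (x + y).

(* E p x w is the energy of x with auxiliary field w at the parameter p, q is a
   squared norm on X for which E is strongly convex in x, and G is the cost. *)
Hypothesis c_gt0 : 0 < c.
Hypothesis B_ge0 : 0 <= B.
Hypothesis Hx0 : H x0.
Hypothesis Ww0 : W w0.
Hypothesis Hmid : forall x y, H x -> H y -> H (mid x y).
Hypothesis Wmid : forall v w, W v -> W w -> W (mid v w).
Hypothesis E_ge0 : forall p x w, K p -> H x -> W w -> 0 <= E p x w.
Hypothesis E_convex : forall p x y v w, K p -> H x -> H y -> W v -> W w ->
  E p (mid x y) (mid v w) + c * q (x - y) <= (E p x v + E p y w) / 2.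
Hypothesis E_lsc : forall p x, K p -> H x -> exists2 C : R, 0 <= C &
  forall (t : R) y w, 0 < t <= 1 -> H y -> W w -> E p x w <= E p y w + C * (t + q (y - x) / t).
Hypothesis E_bound : forall p, K p -> E p x0 w0 <= M.
Hypothesis E_param : forall p p' x w, K p -> K p' -> H x -> W w ->
  E p' x w <= (1 + B * `|p' - p|) * E p x w.
Hypothesis H_complete : forall (x : nat -> X) (C : R), (forall k, H (x k)) ->
  (forall k l, (k <= l)%N -> q (x l - x k) <= C * 4^-1 ^+ k) ->
  exists2 y, H y &
    exists C' : R, forall k, q (x k - y) <= C' * 4^-1 ^+ k.

Definition reduced (p : R * R) (x : X) : R := inf [set E p x w | w in W].

Definition reduced_min (p : R * R) (x : X) :=
  H x /\ forall y, H y -> reduced p x <= reduced p y.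

Lemma reduced_le p x w : K p -> H x -> W w -> reduced p x <= E p x w.
Proof.
move=> Kp Hx Ww; apply: ge_inf; last by exists w.
by exists 0 => _ [v Wv <-]; exact: E_ge0.
Qed.

Lemma le_reduced p x m : (forall w, W w -> m <= E p x w) -> m <= reduced p x.
Proof.
move=> h; apply: lb_le_inf; first by exists (E p x w0), w0.
by move=> _ [v Wv <-]; exact: h.
Qed.

Lemma reduced_ge0 p x : K p -> H x -> 0 <= reduced p x.
Proof. by move=> Kp Hx; apply: le_reduced => w Ww; exact: E_ge0. Qed.

(** Joint convexity survives the infimum over the second variable. *)
Lemma reduced_convex p x y : K p -> H x -> H y ->
  reduced p (mid x y) + c * q (x - y) <= (reduced p x + reduced p y) / 2.
Proof.
move=> Kp Hx Hy.
suff h v : W v ->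
    2 * (reduced p (mid x y) + c * q (x - y)) - E p x v <= reduced p y.
  suff : 2 * (reduced p (mid x y) + c * q (x - y)) - reduced p y <= reduced p x.
    by lra.
  by apply: le_reduced => v /h; lra.
move=> Wv; apply: le_reduced => w Ww.
have := E_convex Kp Hx Hy Wv Ww.
have := reduced_le Kp (Hmid Hx Hy) (Wmid Wv Ww).
lra.
Qed.

Lemma reduced_lsc p x : K p -> H x -> exists2 C : R, 0 <= C &
  forall (t : R) y, 0 < t <= 1 -> H y -> reduced p x <= reduced p y + C * (t + q (y - x) / t).
Proof.
move=> Kp Hx; have [C C0 EC] := E_lsc Kp Hx; exists C => // t y t01 Hy.
rewrite -lerBlDr; apply: le_reduced => w Ww; rewrite lerBlDr.
exact: le_trans (reduced_le Kp Hx Ww) (EC _ _ _ t01 Hy Ww).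
Qed.

Lemma reduced_param p p' x : K p -> K p' -> H x ->
  reduced p' x <= (1 + B * `|p' - p|) * reduced p x.
Proof.
move=> Kp Kp' Hx.
have s0 : 0 < 1 + B * `|p' - p| by rewrite ltr_wpDr// mulr_ge0.
rewrite mulrC -ler_pdivrMr//; apply: le_reduced => w Ww.
rewrite ler_pdivrMr// mulrC.
exact: le_trans (reduced_le Kp' Hx Ww) (E_param Kp Kp' Hx Ww).
Qed.

(** Quadratic growth at a minimiser: compare it with the midpoint of the
    minimiser and the competitor. *)
Lemma reduced_min_gap p x y : K p -> reduced_min p x -> H y ->
  c * q (y - x) <= (reduced p y - reduced p x) / 2.
Proof.
move=> Kp [Hx xmin] Hy.
by have := reduced_convex Kp Hy Hx; have := xmin _ (Hmid Hy Hx); lra.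
Qed.

Lemma reduced_min_le p x : K p -> reduced_min p x -> reduced p x <= M.
Proof.
move=> Kp [Hx xmin]; apply: le_trans (xmin _ Hx0) _.
exact: le_trans (reduced_le Kp Hx0 Ww0) (E_bound Kp).
Qed.

(** The parameter t of the semicontinuity bound is taken to be 2^-k, the square
    root of the rate 4^-k at which the squared distances decay. *)
Lemma lsc_along (J : X -> R) (x : X) (C D b : R) (y : nat -> X) : 0 <= C ->
  (forall k, H (y k)) ->
  (forall (t : R) z, 0 < t <= 1 -> H z ->
    J x <= J z + C * (t + q (z - x) / t)) ->
  (forall k, q (y k - x) <= D * 4^-1 ^+ k) ->
  (forall k, J (y k) <= b + 2^-1 ^+ k) -> J x <= b.
Proof.
move=> C0 Hy lsc qy Jy; apply: (@le_fast_null _ _ (1 + C * (1 + D))) => k.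
have t0 : 0 < 2^-1 ^+ k :> R by rewrite exprn_gt0// invr_gt0.
have t1 : 2^-1 ^+ k <= 1 :> R by rewrite exprn_ile1// ?invr_ge0//; lra.
have t01 : 0 < (2^-1 ^+ k : R) <= 1 by rewrite t0 t1.
have qt : q (y k - x) / 2^-1 ^+ k <= D * 2^-1 ^+ k.
  rewrite ler_pdivrMr// -mulrA -exprMn (_ : 2^-1 * 2^-1 = 4^-1)//; lra.
have := ler_wpM2l C0 qt; have := lsc _ _ t01 (Hy k); have := Jy k; lra.
Qed.

(** A minimising sequence with error 4^-k is Cauchy, since the midpoint of two of
    its members cannot lie below the infimum. *)
Lemma reduced_min_exists p : K p -> exists x, reduced_min p x.
Proof.
move=> Kp; pose S := [set reduced p x | x in H]; pose m := inf S.
have Sinf : has_inf S.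
  split; first by exists (reduced p x0), x0.
  by exists 0 => _ [x Hx <-]; exact: reduced_ge0.
have mle x : H x -> m <= reduced p x.
  by move=> Hx; apply: ge_inf; [exact: Sinf.2 | exists x].
have /choice[x xP] k : exists x, H x /\ reduced p x <= m + 4^-1 ^+ k.
  have e0 : 0 < 4^-1 ^+ k :> R by rewrite exprn_gt0// invr_gt0.
  have [_ [x Hx <-] xm] := inf_adherent e0 Sinf.
  by exists x; split => //; exact: ltW.
have Hx k : H (x k) := (xP k).1.
have decr k l : (k <= l)%N -> 4^-1 ^+ l <= 4^-1 ^+ k :> R.
  by move=> kl; rewrite ler_wiXn2l ?invr_ge0//; lra.
have cauchy k l : (k <= l)%N -> q (x l - x k) <= c^-1 * 4^-1 ^+ k.
  move=> kl; rewrite mulrC ler_pdivlMr// mulrC.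
  have := reduced_convex Kp (Hx l) (Hx k); have := mle _ (Hmid (Hx l) (Hx k)).
  by have := (xP l).2; have := (xP k).2; have := decr _ _ kl; lra.
have [y Hy [C' yP]] := H_complete Hx cauchy.
have [C C0 lsc] := reduced_lsc Kp Hy.
exists y; split => // z Hz; apply: le_trans (mle _ Hz).
apply: (lsc_along C0 Hx lsc yP) => k; apply: le_trans (xP k).2 _.
by rewrite lerD2l lerXn2r ?nnegrE ?invr_ge0//; lra.
Qed.

Hypothesis K_compact : compact K.
Hypothesis K_nonempty : K !=set0.
Hypothesis G_ge0 : forall x, H x -> 0 <= G x.
Hypothesis G_lsc : forall x, H x -> exists2 C : R, 0 <= C &
  forall (t : R) y, 0 < t <= 1 -> H y -> G x <= G y + C * (t + q (y - x) / t).

(** Two multiplicative comparisons of [reduced p] and [reduced p'] show that x'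
    nearly minimises [reduced p]; then [reduced_min_gap] applies. *)
Lemma reduced_min_stable p p' x x' : K p -> K p' ->
  reduced_min p x -> reduced_min p' x' -> `|p' - p| <= 1 ->
  c * q (x' - x) <= B * (2 + B) * M * `|p' - p|.
Proof.
move=> Kp Kp' xmin x'min d1.
have [Hx _] := xmin; have [Hx' x'le] := x'min.
have M0 : 0 <= M := le_trans (E_ge0 Kp Hx0 Ww0) (E_bound Kp).
have s0 : 0 <= 1 + B * `|p' - p| by rewrite addr_ge0// mulr_ge0.
have h1 : reduced p x' <= (1 + B * `|p' - p|) * reduced p' x'.
  by rewrite distrC; exact: reduced_param.
have h2 : reduced p' x' <= (1 + B * `|p' - p|) * reduced p x.
  exact: le_trans (x'le _ Hx) (reduced_param Kp Kp' Hx).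
have h3 := reduced_min_le Kp xmin.
have h4 := reduced_min_gap Kp xmin Hx'.
have h5 := reduced_ge0 Kp Hx.
have h6 := le_trans h1 (ler_wpM2l s0 h2).
apply: le_trans h4 _.
set d := `|p' - p| in d1 s0 h1 h2 h6 *; set r := reduced p x in h2 h3 h5 h6 *.
have d0 : 0 <= d by exact: normr_ge0.
have : (1 + B * d) * ((1 + B * d) * r) - r <= 2 * (B * (2 + B) * M * d).
  have -> : (1 + B * d) * ((1 + B * d) * r) - r = (B * (2 + B * d) * d) * r.
    by ring.
  apply: (@le_trans _ _ ((B * (2 + B * d) * d) * M)).
    by rewrite ler_wpM2l// !mulr_ge0// addr_ge0// mulr_ge0.
  have -> : B * (2 + B * d) * d * M = B * M * d * (2 + B * d) by ring.
  have -> : 2 * (B * (2 + B) * M * d) = B * M * d * (2 * (2 + B)) by ring.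
  rewrite ler_wpM2l ?mulr_ge0//.
  have : B * d <= B * 1 by rewrite ler_wpM2l.
  lra.
lra.
Qed.

Theorem bilevel_min_exists : exists2 p, K p & exists2 x, reduced_min p x &
  forall p' x', K p' -> reduced_min p' x' -> G x <= G x'.
Proof.
pose S := [set r | exists p x, [/\ K p, reduced_min p x & r = G x]].
have [p0 Kp0] := K_nonempty; have [xp0 xp0min] := reduced_min_exists Kp0.
have Sinf : has_inf S.
  split; first by exists (G xp0), p0, xp0.
  by exists 0 => _ [p [x [_ [Hx _] ->]]]; exact: G_ge0.
have mle p x : K p -> reduced_min p x -> inf S <= G x.
  by move=> Kp xmin; apply: ge_inf; [exact: Sinf.2 | exists p, x].
have /choice[z zP] k : exists z : (R * R) * X,
    [/\ K z.1, reduced_min z.1 z.2 & G z.2 <= inf S + 2^-1 ^+ k].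
  have e0 : 0 < 2^-1 ^+ k :> R by rewrite exprn_gt0// invr_gt0.
  have [_ [p [x [Kp xmin ->]]] xm] := inf_adherent e0 Sinf.
  by exists (p, x); split => //; exact: ltW.
have [p [Kp pcluster]] : K `&` cluster ((fst \o z) @ \oo) !=set0.
  by apply: K_compact; exists 0%N => // k _ /=; have [] := zP k.
have [x xmin] := reduced_min_exists Kp; have [Hx _] := xmin.
have [C C0 lsc] := G_lsc Hx.
have /choice[i iP] k : exists i, (k <= i)%N /\ `|(z i).1 - p| <= 4^-1 ^+ k.
  have e0 : 0 < 4^-1 ^+ k :> R by rewrite exprn_gt0// invr_gt0.
  have [_ [[i /= ki <-] /= ip]] := pcluster [set (z j).1 | j in [set j | (k <= j)%N]]
    (ball p (4^-1 ^+ k)) (ex_intro2 _ _ k I (fun j kj => ex_intro2 _ _ j kj erefl))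
    (nbhsx_ballx _ _ e0).
  by exists i; split => //; rewrite distrC ltW//; move: ip; rewrite -ball_normE.
exists p => //; exists x => // p' x' Kp' x'min.
apply: le_trans (mle _ _ Kp' x'min).
apply: (@lsc_along G x C (c^-1 * (B * (2 + B) * M)) (inf S) (fun k => (z (i k)).2)) => //.
- by move=> k; have [_ [] ] := zP (i k).
- move=> k; have [Kz zmin _] := zP (i k).
  rewrite -(mulrA c^-1) [leRHS]mulrC ler_pdivlMr// mulrC.
  have ik := (iP k).2.
  apply: le_trans (reduced_min_stable Kp Kz xmin zmin _) _.
    by apply: le_trans ik _; rewrite exprn_ile1 ?invr_ge0//; lra.
  rewrite ler_wpM2l//; apply: mulr_ge0; first by rewrite mulr_ge0// addr_ge0.
  exact: le_trans (E_ge0 Kp Hx0 Ww0) (E_bound Kp).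
- move=> k; have [_ _ zk] := zP (i k); apply: le_trans zk _.
  by rewrite lerD2l ler_wiXn2l ?invr_ge0//; [lra | have [] := iP k].
Qed.

End variational.

(** * Square integrable functions on a set of finite measure *)

Section square_integrable.
Context d (T : measurableType d) {R : realType}.
Variables (mu : {measure set T -> \bar R}) (D : set T).
Implicit Types u v : T -> R.

Definition square_integrable u :=
  measurable_fun D u /\ mu.-integrable D (EFin \o (fun x => u x ^+ 2)).

Definition sqnorm u : R := \int[mu]_(x in D) (u x ^+ 2).

Hypothesis mD : measurable D.

Lemma sqnorm_ge0 u : 0 <= sqnorm u.
Proof. by apply: Rintegral_ge0 => x _; exact: sqr_ge0. Qed.

Lemma integrable_le_norm (f g : T -> R) : measurable_fun D f ->
  mu.-integrable D (EFin \o g) -> (forall x, D x -> `|f x| <= g x) ->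
  mu.-integrable D (EFin \o f).
Proof.
move=> mf ig fg; apply: le_integrable ig => //; first exact/measurable_EFinP.
by move=> x Dx /=; rewrite lee_fin (le_trans (fg x Dx))// ler_norm.
Qed.

Lemma square_integrable_dominated u (g : T -> R) : measurable_fun D u ->
  mu.-integrable D (EFin \o g) -> (forall x, D x -> u x ^+ 2 <= g x) ->
  square_integrable u.
Proof.
move=> mu_ ig ug; split => //; apply: integrable_le_norm ig _.
  exact: measurable_funX.
by move=> x Dx; rewrite ger0_norm ?sqr_ge0// ug.
Qed.

Lemma integrable_lincomb (a b : R) u v : mu.-integrable D (EFin \o u) ->
  mu.-integrable D (EFin \o v) ->
  mu.-integrable D (EFin \o (fun x => a * u x + b * v x)).
Proof.
move=> iu iv; rewrite (_ : _ \o _ = (fun x => a%:E * (u x)%:E) \+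
                                    (fun x => b%:E * (v x)%:E))%E//.
by apply: integrableD => //; exact: integrableZl.
Qed.

Lemma Rintegral_lincomb (a b : R) u v : mu.-integrable D (EFin \o u) ->
  mu.-integrable D (EFin \o v) ->
  \int[mu]_(x in D) (a * u x + b * v x) =
  a * (\int[mu]_(x in D) u x) + b * (\int[mu]_(x in D) v x).
Proof.
move=> iu iv; have iZ (r : R) w : mu.-integrable D (EFin \o w) ->
    mu.-integrable D (EFin \o (fun x => r * w x)).
  by move=> iw; rewrite (_ : _ \o _ = (fun x => r%:E * (w x)%:E)%E)//; exact: integrableZl.
by rewrite RintegralD ?RintegralZl//; exact: iZ.
Qed.

Lemma square_integrable_lincomb (a b : R) u v :
  square_integrable u -> square_integrable v ->
  square_integrable (fun x => a * u x + b * v x).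
Proof.
move=> [mu_ iu] [mv iv].
apply: (@square_integrable_dominated _
  (fun x => 2 * a ^+ 2 * u x ^+ 2 + 2 * b ^+ 2 * v x ^+ 2)).
- by apply: measurable_funD; apply: measurable_funM => //; exact: measurable_cst.
- exact: integrable_lincomb.
- move=> x _; have := sqr_ge0 (a * u x - b * v x); nra.
Qed.

Lemma square_integrableB u v : square_integrable u -> square_integrable v ->
  square_integrable (fun x => u x - v x).
Proof.
move=> su sv; have := square_integrable_lincomb 1 (-1) su sv.
by under eq_fun do rewrite mul1r mulN1r.
Qed.

Lemma square_integrableM u v : square_integrable u -> square_integrable v ->
  mu.-integrable D (EFin \o (fun x => u x * v x)).
Proof.
move=> [mu_ iu] [mv iv].
apply: (@integrable_le_norm _ (fun x => 1 * u x ^+ 2 + 1 * v x ^+ 2)).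
- exact: measurable_funM.
- exact: integrable_lincomb.
- move=> x _; rewrite normrM -(real_normK (num_real (u x))) -(real_normK (num_real (v x))).
  have := sqr_ge0 (`|u x| - `|v x|).
  have := sqr_ge0 (`|u x|); have := sqr_ge0 (`|v x|); nra.
Qed.

(** Parallelogram identity, in the form used for midpoint convexity. *)
Lemma sqnorm_midpoint u v : square_integrable u -> square_integrable v ->
  sqnorm (fun x => 2^-1 * (u x + v x)) + 4^-1 * sqnorm (fun x => u x - v x) =
  (sqnorm u + sqnorm v) / 2.
Proof.
move=> su sv; have iuv := square_integrableM su sv.
have [_ iu] := su; have [_ iv] := sv.
have i1 : mu.-integrable D (EFin \o (fun x => 1 * u x ^+ 2 + 1 * v x ^+ 2)).
  exact: integrable_lincomb.
have -> : sqnorm (fun x => 2^-1 * (u x + v x)) =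
    \int[mu]_(x in D) (4^-1 * (1 * u x ^+ 2 + 1 * v x ^+ 2) + 2^-1 * (u x * v x)).
  by apply: eq_Rintegral => x _; field.
have -> : sqnorm (fun x => u x - v x) =
    \int[mu]_(x in D) (1 * (1 * u x ^+ 2 + 1 * v x ^+ 2) + (- 2) * (u x * v x)).
  by apply: eq_Rintegral => x _; ring.
by rewrite !Rintegral_lincomb// /sqnorm; field.
Qed.

(** Lower semicontinuity with an explicit modulus, from the pointwise bound
    a^2 <= (a + d)^2 + t a^2 + d^2 / t. *)
Lemma sqnorm_lsc u v (t : R) : 0 < t -> square_integrable u ->
  square_integrable v ->
  sqnorm u <= sqnorm v + t * sqnorm u + sqnorm (fun x => v x - u x) / t.
Proof.
move=> t0 su sv; have sd := square_integrableB sv su.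
have [_ iu] := su; have [_ iv] := sv; have [_ id] := sd.
have i1 : mu.-integrable D (EFin \o (fun x => 1 * v x ^+ 2 + t * u x ^+ 2)).
  exact: integrable_lincomb.
have -> : sqnorm v + t * sqnorm u + sqnorm (fun x => v x - u x) / t =
    \int[mu]_(x in D) (1 * (1 * v x ^+ 2 + t * u x ^+ 2) +
                       t^-1 * (v x - u x) ^+ 2).
  by rewrite !Rintegral_lincomb// /sqnorm; field; rewrite gt_eqF.
apply: le_Rintegral => //; first exact: integrable_lincomb.
move=> x _; set a := u x; set b := v x.
have -> : 1 * (1 * b ^+ 2 + t * a ^+ 2) + t^-1 * (b - a) ^+ 2 =
    a ^+ 2 + ((b - a) ^+ 2 + (t * a + (b - a)) ^+ 2 / t).
  by field; rewrite gt_eqF.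
by rewrite lerDl addr_ge0 ?divr_ge0 ?sqr_ge0// ltW.
Qed.

Hypothesis finD : (mu D < +oo)%E.

Let integrable_cst (r : R) : mu.-integrable D (EFin \o cst r).
Proof.
apply/integrableP; split; first exact/measurable_EFinP/measurable_cst.
rewrite (_ : (\int[mu]_(x in D) _)%E = (`|r|%:E * mu D)%E); last first.
  by rewrite -integral_cst.
by rewrite lte_mul_pinfty// lee_fin.
Qed.

Lemma square_integrable_cst (r : R) : square_integrable (cst r).
Proof. by split; [exact: measurable_cst | exact: (integrable_cst (r ^+ 2))]. Qed.

Lemma square_integrable1 u : square_integrable u -> mu.-integrable D (EFin \o u).
Proof.
move=> su; have := square_integrableM su (square_integrable_cst 1).
by under eq_fun do rewrite mulr1.
Qed.

(** Integrate |a| <= t + a^2 / t. *)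
Lemma Rintegral_norm_le (t : R) u : 0 < t -> square_integrable u ->
  \int[mu]_(x in D) `|u x| <= t * fine (mu D) + sqnorm u / t.
Proof.
move=> t0 su; have [_ iu] := su.
have -> : t * fine (mu D) + sqnorm u / t =
    \int[mu]_(x in D) (t * cst 1 x + t^-1 * (u x ^+ 2)).
  rewrite Rintegral_lincomb//.
  by rewrite Rintegral_cst// mul1r [t^-1 * _]mulrC.
apply: le_Rintegral => //.
- by apply: integrable_norm; exact: square_integrable1.
- exact: (integrable_lincomb t t^-1 (integrable_cst 1)).
- move=> x _; rewrite /= mulr1 -(real_normK (num_real (u x))).
  rewrite -subr_ge0; set a := `|u x|.
  have -> : t + t^-1 * a ^+ 2 - a = ((t - a) ^+ 2 + t * a) / t.
    by field; rewrite gt_eqF.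
  apply: divr_ge0; last exact: ltW.
  by rewrite addr_ge0 ?sqr_ge0// mulr_ge0 ?normr_ge0// ltW.
Qed.


(** A fast Cauchy sequence for the square norm converges almost everywhere:
    by [Rintegral_norm_le] with t = 2^-k the increments are summable in L^1.
    Fatou's lemma then gives the rate of convergence in mean square. *)
Lemma square_integrable_complete (u : nat -> T -> R) (C : R) :
  (forall k, square_integrable (u k)) ->
  (forall k l, (k <= l)%N -> sqnorm (fun x => u l x - u k x) <= C * 4^-1 ^+ k) ->
  exists2 v, square_integrable v &
    forall k, sqnorm (fun x => u k x - v x) <= C * 4^-1 ^+ k.
Proof.
move=> su cu.
pose a k x := u k.+1 x - u k x.
have sa k : square_integrable (a k) by exact: square_integrableB.
have ma k : measurable_fun D (a k) := (sa k).1.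
have mna k : measurable_fun D (fun x => `|a k x|%:E).
  by apply/measurable_EFinP; exact: measurableT_comp.
have Ia k : (\int[mu]_(x in D) `|a k x|%:E <= ((fine (mu D) + C) * 2^-1 ^+ k)%:E)%E.
  have e0 : 0 < 2^-1 ^+ k :> R by rewrite exprn_gt0// invr_gt0.
  have /fineK <- : (\int[mu]_(x in D) `|a k x|%:E)%E \is a fin_num.
    apply: integrable_fin_num => //.
    by apply: integrable_norm; exact: square_integrable1.
  rewrite lee_fin; apply: le_trans (Rintegral_norm_le e0 (sa k)) _.
  rewrite mulrC mulrDl lerD2l ler_pdivrMr// -mulrA -exprMn.
  by rewrite (_ : 2^-1 * 2^-1 = 4^-1)//; [exact: cu | lra].
have C0 : 0 <= C.
  have := cu 0%N 0%N (leqnn _); rewrite expr0 mulr1.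
  exact/le_trans/sqnorm_ge0.
have Sa : (\int[mu]_(x in D) (\sum_(k <oo) `|a k x|%:E) < +oo)%E.
  rewrite integral_nneseries//.
  apply: (@le_lt_trans _ _
    (\sum_(k <oo) ((fine (mu D) + C) / 2 ^+ k)%:E)%E).
    apply: lee_nneseries => [k _ _|k _]; last by rewrite -exprVn.
    by apply: integral_ge0 => x _; rewrite lee_fin.
  set A := fine (mu D) + C.
  have A0 : 0 <= A by rewrite addr_ge0// fine_ge0.
  apply: (@le_lt_trans _ _ (2 * A)%:E); last exact: ltry.
  apply: lime_le.
    by apply: is_cvg_nneseries => k _ _; rewrite lee_fin divr_ge0.
  apply: nearW => m; rewrite sumEFin lee_fin.
  have -> : \sum_(0 <= k < m) A / 2 ^+ k = 2 * A - 2 * A / 2 ^+ m.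
    elim: m => [|m IH]; first by rewrite big_geq// expr0; field.
    rewrite big_nat_recr//= IH exprS; field.
    by rewrite expf_eq0 pnatr_eq0 andbF.
  by rewrite gerBl divr_ge0// ?mulr_ge0.
have mS : measurable_fun D (fun x => (\sum_(k <oo) `|a k x|%:E)%E).
  exact: ge0_emeasurable_sum.
have iS : mu.-integrable D (fun x => (\sum_(k <oo) `|a k x|%:E)%E).
  apply/integrableP; split => //.
  under eq_integral => x _ do rewrite gee0_abs ?nneseries_ge0//.
  exact: Sa.
pose v x := fine (limn_esup (fun k => (u k x)%:E)).
have mv : measurable_fun D v.
  apply: (measurableT_comp (fine_measurable _)) => //.
  by apply: measurable_fun_limn_esup => k; apply/measurable_EFinP; have [] := su k.
have uv : {ae mu, forall x, D x -> u ^~ x @ \oo --> v x}.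
  have := integrable_ae mD iS; apply: filterS => x fx Dx; have {}fx := fx Dx.
  have cs : cvgn (series (fun k => a k x)).
    apply: normed_cvg; apply: nondecreasing_is_cvgn.
      exact: (@nondecreasing_series _ (fun k => `|a k x|) xpredT 0%N).
    exists (fine (\sum_(k <oo) `|a k x|%:E)%E) => _ [m _ <-].
    rewrite -lee_fin fineK// /normed_series_of/= /series/= -sumEFin.
    by apply: nneseries_lim_ge => k _ _; rewrite lee_fin.
  have cu' : cvgn (u ^~ x).
    have -> : u ^~ x = (fun k => u 0%N x + series (fun k => a k x) k).
      apply/funext => k; rewrite /series /a /=.
      by rewrite telescope_sumr// addrC subrK.
    by apply: is_cvgD => //; exact: is_cvg_cst.
  rewrite /v.
  have ce : (fun k => (u k x)%:E) @ \oo --> (limn (u ^~ x))%:E.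
    by apply: cvg_EFin => //; exact: nearW.
  by rewrite (cvg_limn_einf_sup ce).2.
have bound k : (\int[mu]_(x in D) ((u k x - v x) ^+ 2)%:E <= (C * 4^-1 ^+ k)%:E)%E.
  pose f l x := ((u l x - u k x) ^+ 2)%:E.
  have sf l : square_integrable (fun x => u l x - u k x) by exact: square_integrableB.
  have mf l : measurable_fun D (f l).
    by apply/measurable_EFinP/measurable_funX; have [] := sf l.
  have f0 l x : D x -> (0 <= f l x)%E by rewrite lee_fin sqr_ge0.
  have mfe : measurable_fun D (fun x => limn_einf (f ^~ x)).
    rewrite (_ : (fun x => _) = (fun x => - limn_esup (fun l => - f l x))%E); last first.
      by apply/funext => x; rewrite -limn_einfN; congr limn_einf; apply/funext => l; exact/esym/oppeK.
    by apply: measurableT_comp => //; apply: measurable_fun_limn_esup => l; exact: measurableT_comp.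
  have -> : (\int[mu]_(x in D) ((u k x - v x) ^+ 2)%:E =
             \int[mu]_(x in D) limn_einf (f ^~ x))%E.
    apply: ae_eq_integral => //.
      by apply/measurable_EFinP/measurable_funX/measurable_funB => //; have [] := su k.
    apply: filterS uv => x uvx Dx; apply/esym.
    suff : f ^~ x @ \oo --> ((u k x - v x) ^+ 2)%:E.
      by move=> /cvg_limn_einf_sup[].
    apply: cvg_EFin; first exact: nearW.
    rewrite -sqrrN opprB.
    have h : (fun l => u l x - u k x) @ \oo --> v x - u k x.
      by apply: cvgB; [exact: uvx | exact: cvg_cst].
    by apply: cvgM.
  apply: le_trans (fatou mu mD mf f0) _.
  apply: (@le_trans _ _ (limn_einf (fun=> (C * 4^-1 ^+ k)%:E))).
    rewrite !limn_einf_lim; apply: lee_lim.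
    - exact: is_cvg_einfs.
    - exact: is_cvg_einfs.
    - exists k => // m /= km; apply: le_ereal_inf_tmp => _ [l /= ml <-].
      apply: (@le_trans _ _ (\int[mu]_(x in D) f l x)%E).
        by apply: ereal_inf_lbound; exists l.
      rewrite -(fineK (_ : (\int[mu]_(x in D) f l x)%E \is a fin_num)); last first.
        by apply: integrable_fin_num => //; have [] := sf l.
      by rewrite lee_fin; apply: cu; exact: leq_trans ml.
  by rewrite (cvg_limn_einf_sup (cvg_cst _)).1.
have sd k : square_integrable (fun x => u k x - v x).
  split; first by apply: measurable_funB => //; have [] := su k.
  apply/integrableP; split.
    by apply/measurable_EFinP/measurable_funX/measurable_funB => //; have [] := su k.
  under eq_integral do rewrite gee0_abs ?lee_fin ?sqr_ge0//.
  exact: le_lt_trans (bound k) (ltry _).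
exists v.
  have := square_integrableB (su 0%N) (sd 0%N).
  by under eq_fun do rewrite subKr.
move=> k; rewrite /sqnorm /Rintegral -lee_fin fineK; first exact: bound.
by apply: integrable_fin_num => //; have [] := sd k.
Qed.

End square_integrable.

(** * The Euclidean norm and the Huber function *)

Section huber_theory.
Context {R : realType} {m n : nat}.
Implicit Types A B : 'M[R]_(m, n).

Lemma l2norm_sqr A : l2norm A ^+ 2 = \sum_i \sum_j A i j ^+ 2.
Proof. by rewrite sqr_sqrtr// sumr_ge0// => i _; rewrite sumr_ge0// => j _; rewrite sqr_ge0. Qed.

Lemma l2norm_ge0 A : 0 <= l2norm A.
Proof. exact: sqrtr_ge0. Qed.

Lemma l2normZ (c : R) A : l2norm (c *: A) = `|c| * l2norm A.
Proof.
rewrite -sqrtr_sqr -sqrtrM ?sqr_ge0//; congr Num.sqrt.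
rewrite mulr_sumr; apply: eq_bigr => i _; rewrite mulr_sumr; apply: eq_bigr => j _.
by rewrite mxE exprMn.
Qed.

Lemma l2normN A : l2norm (- A) = l2norm A.
Proof. by rewrite -scaleN1r l2normZ normrN1 mul1r. Qed.

Lemma l2norm0_eq0 A : l2norm A = 0 -> A = 0.
Proof.
move=> A0; have : \sum_i \sum_j A i j ^+ 2 = 0 by rewrite -l2norm_sqr A0 expr0n.
move=> /eqP; rewrite psumr_eq0 => [/allP h|i _]; last by rewrite sumr_ge0// => j _; rewrite sqr_ge0.
apply/matrixP => i j; rewrite mxE; apply/eqP.
have := h i (mem_index_enum i); rewrite /= psumr_eq0 => [/allP /(_ j (mem_index_enum j))|k _].
  by rewrite /= sqrf_eq0.
exact: sqr_ge0.
Qed.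

Lemma l2normD A B : l2norm (A + B) <= l2norm A + l2norm B.
Proof.
set a := l2norm A; set b := l2norm B.
have a0 : 0 <= a := l2norm_ge0 A; have b0 : 0 <= b := l2norm_ge0 B.
have [az|an] := eqVneq a 0; first by rewrite az (l2norm0_eq0 az) !add0r.
have [bz|bn] := eqVneq b 0; first by rewrite bz (l2norm0_eq0 bz) !addr0.
have ap : 0 < a by rewrite lt_neqAle eq_sym an.
have bp : 0 < b by rewrite lt_neqAle eq_sym bn.
rewrite -(@ler_pXn2r _ 2%N)// ?nnegrE ?l2norm_ge0 ?addr_ge0//.
pose P := \sum_i \sum_j A i j * B i j.
have lin (c d : R) : l2norm (c *: A + d *: B) ^+ 2 = c ^+ 2 * a ^+ 2 + d ^+ 2 * b ^+ 2 + 2 * c * d * P.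
  rewrite !l2norm_sqr !mulr_sumr -!big_split/=; apply: eq_bigr => i _.
  rewrite !mulr_sumr -!big_split/=; apply: eq_bigr => j _.
  by rewrite !mxE; ring.
have := sqr_ge0 (l2norm (b *: A + (- a) *: B)); rewrite lin.
have -> : l2norm (A + B) ^+ 2 = a ^+ 2 + b ^+ 2 + 2 * P.
  by have := lin 1 1; rewrite !scale1r => ->; ring.
rewrite (_ : _ + _ + _ = (2 * a * b) * (a * b - P)); last by ring.
rewrite pmulr_rge0 ?mulr_gt0// subr_ge0 => h.
by rewrite sqrrD; lra.
Qed.

Context (gamma : R) (gamma_gt0 : 0 < gamma).

(** The Huber function is the maximum over t in [0, 1] of the functions
    t s - t^2 / (2 gamma), all nondecreasing, affine and 1-Lipschitz in s;
    the maximum is attained at t = min(1, gamma s). Monotonicity, convexity and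
    the Lipschitz bound all follow. *)
Lemma huber_ge A t : 0 <= t <= 1 ->
  t * l2norm A - t ^+ 2 / (2 * gamma) <= huber gamma A.
Proof.
move=> /andP[t0 t1]; rewrite /huber; set s := l2norm A.
have s0 : 0 <= s := l2norm_ge0 A; case: ifPn => [gs|].
  rewrite -subr_ge0.
  have -> : s - (2 * gamma)^-1 - (t * s - t ^+ 2 / (2 * gamma)) =
      (1 - t) * (s - gamma^-1 + (1 - t) / (2 * gamma)).
    by field; rewrite gt_eqF.
  by rewrite mulr_ge0 ?subr_ge0// addr_ge0 ?subr_ge0// divr_ge0 ?subr_ge0// mulr_ge0// ltW.
move=> _; rewrite -subr_ge0.
have -> : gamma / 2 * s ^+ 2 - (t * s - t ^+ 2 / (2 * gamma)) =
    (gamma * s - t) ^+ 2 / (2 * gamma).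
  by field; rewrite gt_eqF.
by rewrite divr_ge0 ?sqr_ge0// mulr_ge0// ltW.
Qed.

Lemma huber_max A : exists2 t, 0 <= t <= 1 &
  huber gamma A = t * l2norm A - t ^+ 2 / (2 * gamma).
Proof.
rewrite /huber; set s := l2norm A; have s0 : 0 <= s := l2norm_ge0 A.
case: ifPn => [gs|]; first by exists 1; [rewrite ler01 lexx | rewrite mul1r expr1n mul1r].
rewrite -ltNge => sg; exists (gamma * s); last by field; rewrite gt_eqF.
by rewrite mulr_ge0 ?(ltW gamma_gt0)//= -ler_pdivlMl// mulr1 ltW.
Qed.

Lemma huber_ge0 A : 0 <= huber gamma A.
Proof.
have h : 0 <= (0 : R) <= 1 by rewrite lexx ler01.
by have := huber_ge A h; rewrite mul0r expr0n/= mul0r subr0.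
Qed.

Lemma huber_le_sqr A : huber gamma A <= gamma / 2 * l2norm A ^+ 2.
Proof.
have [t _ ->] := huber_max A; rewrite -subr_ge0; set s := l2norm A.
have -> : gamma / 2 * s ^+ 2 - (t * s - t ^+ 2 / (2 * gamma)) =
    (gamma * s - t) ^+ 2 / (2 * gamma).
  by field; rewrite gt_eqF.
by rewrite divr_ge0 ?sqr_ge0// mulr_ge0// ltW.
Qed.

Lemma huber_le_l2norm A : huber gamma A <= l2norm A.
Proof.
have [t /andP[t0 t1] ->] := huber_max A; rewrite lerBlDr.
apply: (@le_trans _ _ (l2norm A)); first by rewrite ler_piMl ?l2norm_ge0.
by rewrite lerDl divr_ge0 ?sqr_ge0// mulr_ge0// ltW.
Qed.

Lemma huber_lipschitz A B : huber gamma A <= huber gamma B + l2norm (A - B).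
Proof.
have [t /andP[t0 t1] ->] := huber_max A.
have t01 : 0 <= t <= 1 by rewrite t0.
have := huber_ge B t01.
have : l2norm A <= l2norm B + l2norm (A - B) by rewrite -[in X in X <= _](subrKC B A) l2normD.
move=> /(ler_wpM2l t0).
have : t * l2norm (A - B) <= l2norm (A - B) by rewrite ler_piMl ?l2norm_ge0.
lra.
Qed.

Lemma huber_midpoint A B :
  huber gamma (2^-1 *: (A + B)) <= (huber gamma A + huber gamma B) / 2.
Proof.
have [t /andP[t0 t1] ->] := huber_max (2^-1 *: (A + B)).
have t01 : 0 <= t <= 1 by rewrite t0.
have := huber_ge A t01; have := huber_ge B t01.
rewrite l2normZ ger0_norm ?invr_ge0//.
have := ler_wpM2l t0 (l2normD A B); lra.
Qed.

Lemma l2norm_measurable d (T : measurableType d) (D : set T) (A : T -> 'M[R]_(m, n)) :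
  (forall i j, measurable_fun D (fun x => A x i j)) ->
  measurable_fun D (fun x => l2norm (A x)).
Proof.
move=> mA.
apply: (@measurableT_comp _ _ _ _ _ _ (Num.sqrt : R -> R) _
  (fun x => \sum_i \sum_j A x i j ^+ 2)).
  by apply: continuous_measurable_fun; exact: sqrt_continuous.
by apply: measurable_sum => i; apply: measurable_sum => j; exact: measurable_funX.
Qed.

Lemma huber_measurable d (T : measurableType d) (D : set T) (A : T -> 'M[R]_(m, n)) :
  measurable D ->
  (forall i j, measurable_fun D (fun x => A x i j)) ->
  measurable_fun D (fun x => huber gamma (A x)).
Proof.
move=> mD mA; have ml := l2norm_measurable mA.
apply: measurable_fun_if => //.
- by apply: measurable_fun_ler.
- by apply: measurable_funB => //; apply: measurable_funS ml => //; exact: subIsetl.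
- apply: measurable_funM => //; apply: measurable_funX.
  by apply: measurable_funS ml => //; exact: subIsetl.
Qed.

End huber_theory.

Lemma l2norm_sym (R : realType) n (A : 'M[R]_n) :
  l2norm (2^-1 *: (A + A^T)) <= l2norm A.
Proof.
rewrite l2normZ ger0_norm ?invr_ge0//.
have := l2normD A A^T; have -> : l2norm A^T = l2norm A; last by lra.
rewrite /l2norm exchange_big/=; congr Num.sqrt.
by apply: eq_bigr => i _; apply: eq_bigr => j _; rewrite mxE.
Qed.

(** * Flat functions and smooth bumps on boxes *)

Section flat_functions.
Context {R : realType}.

Definition flat (m : nat) (t : R) : R :=
  if 0 < t then t^-1 ^+ m * expR (- t^-1) else 0.

Lemma flat_le0 m t : t <= 0 -> flat m t = 0.
Proof. by rewrite leNgt /flat => /negbTE ->. Qed.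

Lemma flat_gt0 m t : 0 < t -> flat m t = t^-1 ^+ m * expR (- t^-1).
Proof. by rewrite /flat => ->. Qed.

Lemma flat_ge0 m t : 0 <= flat m t.
Proof.
by rewrite /flat; case: ltP => // t0; rewrite mulr_ge0 ?expR_ge0// exprn_ge0// invr_ge0 ltW.
Qed.

(** This quadratic bound is what makes the difference quotients vanish at 0; it
    comes from keeping the term of order m + 2 of the exponential series. *)
Lemma flat_le_sqr m t : flat m t <= (m.+2)`!%:R * t ^+ 2.
Proof.
have [t0|t0] := leP t 0; first by rewrite flat_le0// mulr_ge0// sqr_ge0.
rewrite flat_gt0// expRN; set x := t^-1.
have x0 : 0 < x by rewrite invr_gt0.
have -> : t = x^-1 by rewrite invrK.
have f0 : 0 < (m.+2)`!%:R :> R by rewrite ltr0n fact_gt0.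
rewrite ler_pdivrMr ?expR_gt0//.
apply: (@le_trans _ _ ((m.+2)`!%:R * x^-1 ^+ 2 * (x ^+ m.+2 / (m.+2)`!%:R))).
  rewrite le_eqVlt; apply/orP; left; apply/eqP.
  rewrite !exprS expr0 mulr1; field.
  by rewrite !gt_eqF.
rewrite ler_wpM2l//; first by rewrite mulr_ge0 ?(ltW f0)// sqr_ge0.
by apply: le_trans (expR_ge1Dxn m.+1 (ltW x0)); rewrite lerDr.
Qed.

(** The family is closed under differentiation up to linear combinations, so all
    its members are smooth. *)
Global Instance is_derive_flat (m : nat) (t : R) :
  is_derive t (1 : R) (flat m) (flat m.+2 t - m%:R * flat m.+1 t).
Proof.
have [t0|t0|->] := ltrgt0P t.
- apply: (@near_eq_is_derive _ R R (fun s : R => s^-1 ^+ m * expR (- s^-1))).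
    near=> s; rewrite flat_gt0//; near: s; exact: lt_nbhsr.
  have nt : t != 0 by rewrite gt_eqF.
  have dV : is_derive t 1 (fun s : R => s^-1) (- t ^- 2).
    apply: DeriveDef; first exact: derivableV.
    by rewrite deriveV// derive_id scaler1.
  have dE : is_derive t 1 (fun s : R => expR (- s^-1)) (expR (- t^-1) * - - t ^- 2).
    exact: (@is_derive1_comp _ expR (fun s => - s^-1)).
  have := is_deriveM (is_deriveX m dV) dE.
  rewrite (_ : (_ ^+ m * _) = (fun s : R => s^-1 ^+ m * expR (- s^-1))); last first.
    by apply/funext => s; rewrite /= fctE exprfctE.
  move=> h; apply: (is_derive_eq h) => {h}.
  rewrite !flat_gt0// exprfctE opprK -!exprVn /GRing.scale/= !mulrA.
  case: m => [|m]; rewrite /= ?exprS; ring.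
- rewrite !flat_le0 ?ltW// mulr0 subr0.
  apply: (@near_eq_is_derive _ R R (cst 0)).
    by near=> s; rewrite flat_le0//; apply/ltW; near: s; exact: lt_nbhsl.
- rewrite !flat_le0// mulr0 subr0.
  have h : (fun h : R => h^-1 *: ((flat m \o shift 0) (h *: 1) - flat m 0)) @ 0^' --> (0 : R).
    apply: norm_cvg0; apply: (@squeeze_cvgr _ _ _ _ (cst 0) (fun h => (m.+2)`!%:R * `|h|)).
    + near=> h; rewrite normr_ge0/= (flat_le0 m (lexx 0)) subr0 addr0 /GRing.scale/= mulr1.
      have h0 : h != 0 by near: h; exact: nbhs_dnbhs_neq.
      rewrite normrM normfV ler_pdivrMl ?normr_gt0// mulrCA -expr2 real_normK ?num_real//.
      by rewrite ger0_norm ?flat_ge0// flat_le_sqr.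
    + exact: cvg_cst.
    + suff : (fun h : R => (m.+2)`!%:R * `|h|) @ (0 : R)^' --> (m.+2)`!%:R * `|0 : R|.
        by rewrite normr0 mulr0.
      apply: cvgM; first exact: cvg_cst.
      by apply: cvg_norm; exact: nbhs_dnbhs.
  apply: DeriveDef; first by apply/cvg_ex; exists 0.
  exact: cvg_lim.
Unshelve. all: by end_near. Qed.

Lemma flat_continuous m : continuous (flat m).
Proof.
by move=> t; apply/differentiable_continuous/derivable1_diffP; exact: ex_derive.
Qed.

End flat_functions.

Section flat_algebra.
Context {R : realType} {n : nat}.
Implicit Types f g : 'rV[R]_n -> R.

(** The algebra generated by flat functions of the coordinates: large enough to
    contain the bumps, and its closure under partial derivatives is proved
    generator by generator. *)
Inductive flat_algebra : ('rV[R]_n -> R) -> Prop :=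
| flat_atom m (i : 'I_n) (a b : R) :
    flat_algebra (fun x => flat m (a * x ord0 i + b))
| flat_cst (c : R) : flat_algebra (cst c)
| flat_add f g : flat_algebra f -> flat_algebra g -> flat_algebra (f + g)
| flat_mul f g : flat_algebra f -> flat_algebra g -> flat_algebra (f * g).

Lemma flat_algebra_prod I (s : seq I) (F : I -> 'rV[R]_n -> R) :
  (forall i, flat_algebra (F i)) -> flat_algebra (fun x => \prod_(i <- s) F i x).
Proof.
move=> hF; elim: s => [|i s IH].
  by rewrite (_ : (fun x => _) = cst 1); [exact: flat_cst | apply/funext => x; rewrite big_nil].
rewrite (_ : (fun x => _) = F i * (fun x => \prod_(j <- s) F j x)); first exact: flat_mul.
by apply/funext => x; rewrite big_cons.
Qed.

Lemma flat_algebra_continuous f : flat_algebra f -> continuous f.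
Proof.
elim=> [m i a b|c|{}f g _ cf _ cg|{}f g _ cf _ cg] x.
- apply: (@continuous_comp _ _ _ (fun x : 'rV[R]_n => a * x ord0 i + b) (flat m)).
    have h : (fun y : 'rV[R]_n => a * y ord0 i + b) @ x --> a * x ord0 i + b.
      have FF : Filter (nbhs x) := nbhs_filter x.
      apply: (@cvgD _ _ _ (nbhs x) FF); last exact: cvg_cst.
      apply: (@cvgM _ _ (nbhs x) FF); first exact: cvg_cst.
      exact: coord_continuous.
    exact: h.
  exact: flat_continuous.
- exact: cst_continuous.
- exact: cvgD (cf x) (cg x).
- exact: cvgM (cf x) (cg x).
Qed.

(** Differentiating along [v] at [x] only involves the line through [x]. *)
Lemma is_derive_line f (x v : 'rV[R]_n) (df : R) :
  is_derive (0 : R) (1 : R) (fun h => f (h *: v + x)) df -> is_derive x v f df.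
Proof.
have E : (fun h : R => h^-1 *: (((fun h => f (h *: v + x)) \o shift 0) (h *: 1) -
    f (0 *: v + x))) = (fun h : R => h^-1 *: ((f \o shift x) (h *: v) - f x)).
  by apply/funext => h; rewrite /= addr0 scale0r add0r [h *: 1]mulr1.
case=> d1 d2; apply: DeriveDef.
  by move: d1; rewrite /derivable E.
by rewrite -d2 /derive E.
Qed.

Lemma flat_algebra_derive f (i : 'I_n) : flat_algebra f ->
  exists2 g, flat_algebra g & forall x, is_derive x (delta_mx ord0 i) f (g x).
Proof.
elim=> [m j a b|c|{}f g hf [f' hf' df] hg [g' hg' dg]|{}f g hf [f' hf' df] hg [g' hg' dg]].
- exists (cst (a * (i == j)%:R) *
   ((fun x => flat m.+2 (a * x ord0 j + b)) +
    cst (- m%:R) * (fun x => flat m.+1 (a * x ord0 j + b)))).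
    by do ! [exact: flat_atom | exact: flat_cst | apply: flat_add | apply: flat_mul].
  move=> x; apply: is_derive_line.
  have dl : is_derive (0 : R) (1 : R)
      (fun h : R => a * (h *: delta_mx ord0 i + x) ord0 j + b) (a * (i == j)%:R).
    rewrite (_ : (fun h => _) = cst (a * (i == j)%:R) * id + cst (a * x ord0 j + b)).
      apply: is_derive_eq.
      by rewrite /cst/= !scaler0 !addr0 [X in X = _]mulr1.
    apply/funext => h; rewrite /= !mxE eqxx/= [j == i]eq_sym.
    by rewrite !fctE/=; ring.
  apply: (is_derive_eq (@is_derive1_comp _ (flat m) _ 0 _ _ (is_derive_flat m _) dl)).
  by rewrite scale0r add0r !fctE/=; ring.
- by exists (cst 0); [exact: flat_cst | move=> x; exact: is_derive_cst].
- exists (f' + g'); first exact: flat_add.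
  by move=> x; exact: is_deriveD.
- exists (f * g' + g * f'); first by apply: flat_add; exact: flat_mul.
  by move=> x; exact: is_deriveM.
Qed.

(** An algebra closed under partial derivatives consists of smooth functions. *)
Lemma flat_algebra_smooth f : flat_algebra f -> smooth f.
Proof.
move=> hf; have h (s : seq 'I_n) : flat_algebra (partials s f).
  elim: s => [//|i s IH] /=; have [g hg dg] := flat_algebra_derive i IH.
  by rewrite (_ : partial _ _ = g)//; apply/funext => x; rewrite /partial derive_val.
move=> s; split; first exact: flat_algebra_continuous.
by move=> i x; have [g _ dg] := flat_algebra_derive i (h s); exact: ex_derive.
Qed.

End flat_algebra.

Section boxes.
Context {R : realType} {n : nat}.
Implicit Types a b x : 'rV[R]_n.

Definition obox a b : set 'rV[R]_n :=
  [set x | forall i, a ord0 i < x ord0 i < b ord0 i].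

Definition cbox a b : set 'rV[R]_n :=
  [set x | forall i, a ord0 i <= x ord0 i <= b ord0 i].

Lemma obox_cbox a b : obox a b `<=` cbox a b.
Proof. by move=> x xab i; have /andP[ax xb] := xab i; rewrite !ltW. Qed.

Lemma cbox_compact a b : compact (cbox a b).
Proof.
rewrite (_ : cbox a b = [set x | forall i, `[a ord0 i, b ord0 i]%classic (x ord0 i)]).
  by apply: (@rV_compact R n (fun i => `[a ord0 i, b ord0 i]%classic)) => i; exact: segment_compact.
by apply/seteqP; split => x h i; have := h i; rewrite /= in_itv.
Qed.

(** Open boxes are stable under intersection, and remain well inside a domain. *)
Lemma oboxI a b a' b' : exists a'' b'',
  obox a b `&` obox a' b' = obox a'' b'' /\ cbox a'' b'' `<=` cbox a b.
Proof.
exists (\row_i Num.max (a ord0 i) (a' ord0 i)), (\row_i Num.min (b ord0 i) (b' ord0 i)).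
split; last first.
  by move=> x h i; have := h i; rewrite !mxE ge_max le_min => /andP[/andP[-> _] /andP[-> _]].
apply/seteqP; split => [x [h h'] i|x h].
  rewrite !mxE; have /andP[ax xb] := h i; have /andP[a'x xb'] := h' i.
  by rewrite gt_max lt_min ax xb a'x xb'.
split=> i; have := h i; rewrite !mxE gt_max lt_min => /andP[/andP[ax a'x] /andP[xb xb']].
  by rewrite ax xb.
by rewrite a'x xb'.
Qed.

Definition box_bump (k : R) a b x : R :=
  \prod_i (flat 0 (k * (x ord0 i - a ord0 i)) * flat 0 (k * (b ord0 i - x ord0 i))).

Lemma flat0_le1 (t : R) : flat 0 t <= 1.
Proof.
by rewrite /flat; case: ltP => // t0; rewrite expr0 mul1r expR_le1// oppr_le0 invr_ge0 ltW.
Qed.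

Lemma box_bump_ge0 k a b x : 0 <= box_bump k a b x.
Proof. by apply: prodr_ge0 => i _; rewrite mulr_ge0// flat_ge0. Qed.

Lemma box_bump_le1 k a b x : box_bump k a b x <= 1.
Proof.
apply: prodr_ile1 => i _; rewrite mulr_ge0 ?flat_ge0//=.
by rewrite mulr_ile1 ?flat_ge0 ?flat0_le1.
Qed.

Lemma box_bump_out k a b x : 0 < k -> ~ obox a b x -> box_bump k a b x = 0.
Proof.
move=> k0 /existsNP[i /negP]; rewrite negb_and -!leNgt => xi.
rewrite /box_bump (bigD1 i)//=; case/orP : xi => xi.
  by rewrite (@flat_le0 _ _ (k * (x ord0 i - a ord0 i))) ?mul0r// pmulr_rle0// subr_le0.
by rewrite (@flat_le0 _ _ (k * (b ord0 i - x ord0 i))) ?mulr0 ?mul0r// pmulr_rle0// subr_le0.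
Qed.

(** exp(-1/(kt)) tends to 1 for every t > 0, so the bumps tend pointwise to the
    indicator of the open box. *)
Lemma box_bump_cvg a b x : (fun k : nat => box_bump k.+1%:R a b x) @ \oo --> (\1_(obox a b) x : R).
Proof.
rewrite indicE; have [xab|xab] := pselect (obox a b x); last first.
  rewrite memNset//; under eq_fun do rewrite box_bump_out//; exact: cvg_cst.
rewrite mem_set//= -[X in _ --> X](_ : \prod_(i < n) (1 * 1) = 1); last first.
  by under eq_bigr do rewrite mulr1; rewrite big1_eq.
have flat_cvg (t : R) : 0 < t -> (fun k : nat => flat 0 (k.+1%:R * t)) @ \oo --> (1 : R).
  move=> t0.
  have -> : (fun k : nat => flat 0 (k.+1%:R * t)) = expR \o (fun k : nat => - (k.+1%:R^-1 * t^-1)).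
    by apply/funext => k; rewrite /= flat_gt0 ?mulr_gt0// expr0 mul1r invfM.
  rewrite -[X in _ --> X]expR0; apply: continuous_cvg; first exact: continuous_expR.
  rewrite -oppr0; apply: cvgN; rewrite -[X in _ --> X](mul0r t^-1).
  apply: cvgM; last exact: cvg_cst.
  exact: cvg_harmonic.
suff h (s : seq 'I_n) : (fun k : nat => \prod_(i <- s)
    (flat 0 (k.+1%:R * (x ord0 i - a ord0 i)) *
     flat 0 (k.+1%:R * (b ord0 i - x ord0 i)))) @ \oo -->
    (\prod_(i <- s) (1 * 1) : R) by exact: h.
elim: s => [|i s IH].
  by rewrite big_nil; under eq_fun do rewrite big_nil; exact: cvg_cst.
rewrite big_cons; under eq_fun do rewrite big_cons.
have /andP[ai bi] := xab i.
by apply: cvgM => //; apply: cvgM; apply: flat_cvg; rewrite subr_gt0.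
Qed.

Lemma box_bump_flat_algebra k a b : flat_algebra (box_bump k a b).
Proof.
apply: flat_algebra_prod => i.
rewrite (_ : (fun x => _) = (fun x : 'rV[R]_n => flat 0 (k * x ord0 i + - (k * a ord0 i))) *
   (fun x : 'rV[R]_n => flat 0 (- k * x ord0 i + k * b ord0 i))).
  by apply: flat_mul; exact: flat_atom.
by apply/funext => x; rewrite !fctE/= mulrBr [k * (_ - _)]mulrBr mulNr [- _ + _]addrC.
Qed.

Lemma box_bump_test_function (Omega : set 'rV[R]_n) k a b : 0 < k ->
  cbox a b `<=` Omega -> test_function Omega (box_bump k a b).
Proof.
move=> k0 abO.
have cab : closed (cbox a b).
  by apply: compact_closed; [exact: norm_hausdorff | exact: cbox_compact].
have sup : closure [set x | box_bump k a b x != 0] `<=` cbox a b.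
  move/closure_id : (cab) => ->; apply: closure_subset => x /=.
  by apply: contra_neqP => xab; apply: box_bump_out => // /obox_cbox.
split.
- exact/flat_algebra_smooth/box_bump_flat_algebra.
- exact: (@subclosed_compact _ _ (cbox a b) (@closed_closure _ _) (@cbox_compact a b) sup).
- exact: subset_trans abO.
Qed.

End boxes.

(** * Borel sets and Lebesgue measure on row vectors *)

Section measurable_rV.
Context {R : realType} {n : nat}.
Implicit Types (a b x : 'rV[R]_n) (Omega : set 'rV[R]_n).

Lemma obox_measurable a b : measurable (obox a b).
Proof.
rewrite (_ : obox a b = \bigcap_(i in [set: 'I_n])
    ((fun x => x ord0 i) @^-1` `]a ord0 i, b ord0 i[%classic)).
  apply: fin_bigcap_measurable; first exact: finite_finset.
  move=> i _; rewrite -[X in measurable X]setTI.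
  by apply: measurable_mx_entry => //; exact: measurable_itv.
apply/seteqP; split => [x h i _|x h i]; first by have := h i; rewrite /= in_itv.
by have := h i I; rewrite /= in_itv.
Qed.

(** Boxes compactly contained in the domain carry bump test functions; the empty
    set is added to allow enumerations. *)
Definition box_inside Omega (B : set 'rV[R]_n) :=
  B = set0 \/ exists a b, B = obox a b /\ cbox a b `<=` Omega.

Lemma box_inside_measurable Omega B : box_inside Omega B -> measurable B.
Proof. by case=> [->//|[a [b [-> _]]]]; exact: obox_measurable. Qed.

Lemma box_inside_sub Omega B : box_inside Omega B -> B `<=` Omega.
Proof.
case=> [->|[a [b [-> abO]]]]; first exact: sub0set.
exact: subset_trans (@obox_cbox _ _ a b) abO.
Qed.

Lemma open_box_nbhs Omega x : open Omega -> Omega x ->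
  exists p : 'rV[rat]_n * 'rV[rat]_n,
    obox (map_mx ratr p.1) (map_mx ratr p.2) x /\
    cbox (map_mx ratr p.1) (map_mx ratr p.2) `<=` Omega.
Proof.
move=> oO Ox; have : nbhs x Omega by exact: open_nbhs_nbhs.
move=> /nbhs_ballP[e /= e0 xeO].
have /choice[f fP] (i : 'I_n) : exists q : rat, (ratr q : R) \in `]x ord0 i - e, x ord0 i[.
  by apply: rat_in_itvoo; rewrite ltrBlDr ltrDl.
have /choice[g gP] (i : 'I_n) : exists q : rat, (ratr q : R) \in `]x ord0 i, x ord0 i + e[.
  by apply: rat_in_itvoo; rewrite ltrDl.
exists (\row_i f i, \row_i g i); split => /=.
  move=> i; rewrite !mxE; have := fP i; have := gP i; rewrite !in_itv/=.
  by move=> /andP[-> _] /andP[_ ->].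
move=> y yab; apply: xeO; split => // i j; rewrite ord1.
have := yab j; rewrite !mxE; have := fP j; have := gP j; rewrite !in_itv/=.
move=> /andP[_ h1] /andP[h2 _] /andP[h3 h4].
rewrite /ball/= ltr_distlC (lt_le_trans h2 h3)/=.
exact: le_lt_trans h4 h1.
Qed.

Lemma open_bigcup_boxes Omega : open Omega ->
  exists Q : nat -> set 'rV[R]_n,
    (forall k, box_inside Omega (Q k)) /\ Omega = \bigcup_k Q k.
Proof.
move=> oO.
pose Q (k : nat) : set 'rV[R]_n :=
  if (unpickle k : option ('rV[rat]_n * 'rV[rat]_n)) is Some p then
    if pselect (cbox (map_mx ratr p.1) (map_mx ratr p.2) `<=` Omega)
    then obox (map_mx ratr p.1) (map_mx ratr p.2) else set0
  else set0.
have QO k : box_inside Omega (Q k).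
  rewrite /Q; case: unpickle => [p|]; last by left.
  case: pselect => [pO|npO]; last by left.
  by right; exists (map_mx ratr p.1), (map_mx ratr p.2).
exists Q; split => //; apply/seteqP; split; last first.
  by apply: bigcup_sub => k _; exact: box_inside_sub.
move=> x Ox; have [p [xp pO]] := open_box_nbhs oO Ox.
by exists (pickle p) => //; rewrite /Q pickleK; case: pselect.
Qed.

Lemma open_measurable_rV Omega : open Omega -> measurable Omega.
Proof.
move=> /open_bigcup_boxes[Q [QO ->]]; apply: bigcupT_measurable => k.
exact: box_inside_measurable (QO k).
Qed.

Lemma compact_measurable_rV (K : set 'rV[R]_n) : compact K -> measurable K.
Proof.
move=> cK; have clK : closed K.
  by apply: compact_closed => //; exact: norm_hausdorff.
rewrite -[K]setCK; apply: measurableC; apply: open_measurable_rV.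
exact: closed_openC.
Qed.

Lemma continuous_measurable_rV (f : 'rV[R]_n -> R) : continuous f ->
  measurable_fun setT f.
Proof.
move=> /continuousP cf; apply: (measurability _ (RGenOpens.measurableE R)).
move=> _ [_ [a [b ->] <-]]; rewrite setTI; apply: open_measurable_rV.
exact/cf/interval_open.
Qed.

(** Half-spaces are countable unions of boxes that grow in the other
    coordinates. *)
Lemma measurable_rVE : @measurable _ 'rV[R]_n = <<s [set B | exists a b, B = obox a b] >>.
Proof.
apply/seteqP; split; last first.
  apply: smallest_sub; first exact: sigma_algebra_measurable.
  by move=> _ [a [b ->]]; exact: obox_measurable.
apply: smallest_sub; first exact: smallest_sigma_algebra.
move=> _ [i [j [A mA ->]]].
pose T := g_sigma_algebraType [set B : set 'rV[R]_n | exists a b, B = obox a b].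
have h : measurable_fun [set: T] (fun x : 'rV[R]_n => x ord0 j).
  apply: (measurability _ (RGenOpens.measurableE R)).
  move=> _ [_ [c [d ->] <-]]; rewrite setTI.
  rewrite (_ : _ @^-1` _ = \bigcup_k obox
     (\row_l if l == j then c else - k%:R) (\row_l if l == j then d else k%:R)).
    apply: bigcupT_measurable => k; apply: sub_sigma_algebra.
    by exists (\row_l if l == j then c else - k%:R), (\row_l if l == j then d else k%:R).
  apply/seteqP; split => [x /=|x [k _ /(_ j)]]; last first.
    by rewrite /= !mxE eqxx in_itv.
  rewrite in_itv/= => xcd.
  have [k xk] : exists k : nat, forall l, `|x ord0 l| < k%:R.
    exists (Num.bound `|x|) => l; apply: le_lt_trans (archi_boundP (normr_ge0 _)).
    rewrite [leRHS]/Num.norm/= mx_normrE.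
    exact: (le_bigmax _ (fun ij => `|x ij.1 ij.2|) (ord0, l)).
  exists k => // l; rewrite !mxE; case: eqP => [->//|_].
  by rewrite -ltr_norml.
have := h measurableT A mA; rewrite setTI; rewrite [i]ord1; exact.
Qed.

Lemma bounded_set_cube Omega : bounded_set Omega ->
  exists M : R, Omega `<=` [set x | forall i, `|x ord0 i| <= M].
Proof.
move=> [M [_ hM]]; exists (M + 1) => x Ox i.
have := hM (M + 1); rewrite ltrDl => /(_ ltr01 _ Ox) /=.
apply: le_trans; rewrite [leRHS]/Num.norm/= mx_normrE.
exact: (le_bigmax _ (fun ij => `|x ij.1 ij.2|) (ord0, i)).
Qed.

End measurable_rV.

Lemma lebesgue_rV_cube_lty (R : realType) n (M : R) :
  (lebesgue_rV n [set x : 'rV[R]_n | forall i, (`|x ord0 i| <= M)%R] < +oo)%E.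
Proof.
have mcube m : measurable [set x : 'rV[R]_m | forall i, (`|x ord0 i| <= M)%R].
  rewrite (_ : mkset _ = cbox (const_mx (- M)) (const_mx M)).
    by apply: compact_measurable_rV; exact: cbox_compact.
  by apply/seteqP; split => x h i; have := h i; rewrite !mxE ler_norml.
elim: n => [|n IH] /=.
  by rewrite diracE; apply: (@le_lt_trans _ _ 1%:E); [rewrite lee_fin lern1 leq_b1 | exact: ltry].
rewrite /lebesgue_rV_step /pushforward.
rewrite (_ : _ @^-1` _ = `[- M, M]%classic `*`
    [set x : 'rV[R]_n | forall i, (`|x ord0 i| <= M)%R]); last first.
  apply/seteqP; split => -[r v] /= => [h|[]].
    split; first by have := h (lshift n (ord0 : 'I_1)); rewrite rV_consEl in_itv/= ler_norml.
    by move=> i; have := h (rshift 1 i); rewrite rV_consEr.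
  rewrite in_itv/= -ler_norml => h h' i.
  by have [k ->|k ->] := split_ordP (i : 'I_(1 + n)); rewrite ?rV_consEl ?rV_consEr.
rewrite product_measure1E//=; last exact: mcube.
by rewrite lte_mul_pinfty// ?lebesgue_measure_itv/=; case: ifP => // _; rewrite -EFinD ltry.
Qed.

Lemma bounded_lebesgue_lty (R : realType) n (Omega : set 'rV[R]_n) :
  open Omega -> bounded_set Omega -> (lebesgue_rV n Omega < +oo)%E.
Proof.
move=> oO /bounded_set_cube[M OM].
apply: le_lt_trans (lebesgue_rV_cube_lty n M).
apply: le_measure => //; rewrite inE; first exact: open_measurable_rV.
rewrite (_ : mkset _ = cbox (const_mx (- M)) (const_mx M)).
  by apply: compact_measurable_rV; exact: cbox_compact.
by apply/seteqP; split => x h i; have := h i; rewrite !mxE ler_norml.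
Qed.

(** * Test functions determine charges and locally integrable functions *)

Section charge_uniqueness.
Context {R : realType} {n : nat}.
Local Notation leb := (@lebesgue_rV R n).
Implicit Types (a b : 'rV[R]_n) (Omega : set 'rV[R]_n)
  (nu : {charge set 'rV[R]_n -> \bar R}).

Lemma jordanE nu A : measurable A ->
  (nu A = jordan_pos (hahn_posnegP nu) A - jordan_neg (hahn_posnegP nu) A)%E.
Proof. by move=> mA; rewrite [LHS](jordan_decomp (hahn_posnegP nu))// /cadd/= cscaleN1. Qed.

(** The positive and negative parts of the charge agree on the boxes inside the
    given one, a generating family stable under intersection. *)
Lemma charge_box0 nu a b :
  (forall a' b', cbox a' b' `<=` cbox a b -> nu (obox a' b') = 0%E) ->
  forall A, measurable A -> A `<=` obox a b -> nu A = 0%E.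
Proof.
move=> nu0 A mA AB.
set m1 := jordan_pos (hahn_posnegP nu); set m2 := jordan_neg (hahn_posnegP nu).
have mB := obox_measurable a b.
have fin (m : {finite_measure set 'rV[R]_n -> \bar R}) C : measurable C -> m C \is a fin_num.
  by move=> mC; exact: fin_num_measure.
have nuE C : measurable C -> nu C = (m1 C - m2 C)%E by exact: jordanE.
have box a' b' : cbox a' b' `<=` cbox a b -> m1 (obox a' b') = m2 (obox a' b').
  move=> h; have mB' := obox_measurable a' b'.
  have := nu0 _ _ h; rewrite nuE//.
  have f1 : m1 (obox a' b') \is a fin_num by exact: fin.
  have f2 : m2 (obox a' b') \is a fin_num by exact: fin.
  rewrite -(fineK f1) -(fineK f2).
  by rewrite -EFinB => -[] /eqP; rewrite subr_eq0 => /eqP ->.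
suff h : mrestr m1 mB A = mrestr m2 mB A.
  move: h; rewrite /mrestr setIidl// => h.
  by rewrite nuE// h subee// fin.
apply: (@measure_unique _ _ _ [set B | exists a b, B = obox a b]
  (fun k => obox (const_mx (- k%:R)) (const_mx k%:R))) => //.
- exact: measurable_rVE.
- move=> _ _ [a1 [b1 ->]] [a2 [b2 ->]].
  by have [a' [b' [-> _]]] := oboxI a1 b1 a2 b2; exists a', b'.
- by move=> k; exists (const_mx (- k%:R)), (const_mx k%:R).
- rewrite -subTset => x _.
  exists (Num.bound `|x|) => // i; rewrite !mxE -ltr_norml.
  apply: le_lt_trans (archi_boundP (normr_ge0 _)).
  rewrite [leRHS]/Num.norm/= mx_normrE.
  exact: (le_bigmax _ (fun ij => `|x ij.1 ij.2|) (ord0, i)).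
- move=> _ [a' [b' ->]]; rewrite /= /mrestr setIC.
  by have [a'' [b'' [-> h]]] := oboxI a b a' b'; exact: box.
- move=> k; rewrite /= /mrestr; apply: (@le_lt_trans _ _ (m1 (obox a b))).
    by apply: le_measure; rewrite ?inE//; apply: measurableI => //; exact: obox_measurable.
  by rewrite ltey_eq fin.
Qed.

(** An open set is a countable union of boxes, made disjoint by differences. *)
Lemma charge_boxes0 nu Omega : open Omega ->
  (forall a b, cbox a b `<=` Omega -> nu (obox a b) = 0%E) ->
  forall A, measurable A -> A `<=` Omega -> nu A = 0%E.
Proof.
move=> oO nu0 A mA AO; have [Q [QO OE]] := open_bigcup_boxes oO.
pose F := seqDU (fun k => A `&` Q k).
have mAQ k : measurable (A `&` Q k).
  by apply: measurableI => //; exact: box_inside_measurable (QO k).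
have mF k : measurable (F k) by exact: seqDU_measurable.
have AE : A = \bigcup_k F k.
  by rewrite -seqDU_bigcup_eq -setI_bigcupr -OE setIidl.
have F0 k : nu (F k) = 0%E.
  have FQ : F k `<=` Q k by apply: subset_trans (@subset_seqDU _ _ k) _; exact: subIsetr.
  case: (QO k) FQ => [->|[a [b [-> abO]]]].
    by rewrite subset0 => ->; rewrite charge0.
  move=> Fab; apply: (@charge_box0 nu a b) => // a' b' h.
  by apply: nu0; exact: subset_trans abO.
have : (fun m => \sum_(0 <= i < m) nu (F i))%E @ \oo --> nu A.
  rewrite [in X in _ --> X]AE; apply: charge_semi_sigma_additive => //.
    exact: trivIset_seqDU.
  by rewrite -AE.
under eq_fun do rewrite big1//.
by move=> /cvg_lim <-//; rewrite lim_cst.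
Qed.

Lemma box_bump_measurable (k : R) a b : measurable_fun setT (box_bump k a b).
Proof.
apply: continuous_measurable_rV; apply: flat_algebra_continuous.
exact: box_bump_flat_algebra.
Qed.

Lemma integral_box_bump_cvg (m : {finite_measure set 'rV[R]_n -> \bar R}) a b :
  (fun k : nat => \int[m]_x (box_bump k.+1%:R a b x)%:E)%E @ \oo --> m (obox a b).
Proof.
have mB := obox_measurable a b.
rewrite -[X in _ --> X](_ : \int[m]_x (\1_(obox a b) x)%:E = _)%E; last first.
  by rewrite integral_indic// setIT.
have [|||||_ _ //] := @dominated_convergence _ _ _ m setT measurableT
  (fun k x => (box_bump k.+1%:R a b x)%:E) (fun x => (\1_(obox a b) x)%:E) (cst 1%:E).
- by move=> k; apply/measurable_EFinP; exact: box_bump_measurable.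
- exact/measurable_EFinP/measurable_indic.
- apply: nearW => x _; apply: cvg_EFin; first exact: nearW.
  exact: box_bump_cvg.
- exact: finite_measure_integrable_cst.
- apply: nearW => x k _; rewrite lee_fin ger0_norm ?box_bump_ge0//.
  exact: box_bump_le1.
Qed.

Lemma charge_integral_box_bump_cvg nu a b :
  (fun k : nat => charge_integral nu (box_bump k.+1%:R a b)) @ \oo --> nu (obox a b).
Proof.
rewrite jordanE; last exact: obox_measurable.
apply: cvgeB; [|exact: integral_box_bump_cvg..].
by rewrite fin_num_adde_defl// fin_numN fin_num_measure//; exact: obox_measurable.
Qed.

(** Bumps turn equality on test functions into equality on boxes. *)
Lemma charge_test_unique Omega nu nu' : open Omega ->
  (forall phi, test_function Omega phi ->
    charge_integral nu phi = charge_integral nu' phi) ->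
  forall A, measurable A -> A `<=` Omega -> nu A = nu' A.
Proof.
move=> oO nunu' A mA AO.
have box a b : cbox a b `<=` Omega -> nu (obox a b) = nu' (obox a b).
  move=> abO; apply: (@cvg_unique _ _ _ _ _ _ (@charge_integral_box_bump_cvg nu a b)).
    exact: ereal_hausdorff.
  rewrite (_ : (fun k => _) = (fun k : nat => charge_integral nu' (box_bump k.+1%:R a b))).
    exact: charge_integral_box_bump_cvg.
  by apply/funext => k; apply: nunu'; exact: box_bump_test_function.
have dE C : cadd nu (copp nu') C = (nu C - nu' C)%E by [].
have : cadd nu (copp nu') A = 0%E.
  apply: (@charge_boxes0 _ Omega) => // a b abO; rewrite [LHS]dE box//.
  by rewrite subee// fin_num_measure//; exact: obox_measurable.
have f1 : nu A \is a fin_num by exact: fin_num_measure.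
have f2 : nu' A \is a fin_num by exact: fin_num_measure.
rewrite dE -(fineK f1) -(fineK f2).
by rewrite -EFinB => -[] /eqP; rewrite subr_eq0 => /eqP ->.
Qed.

(** The fundamental lemma of the calculus of variations. On each box h is
    integrable, and its integrals over smaller boxes are limits of integrals
    against bumps. *)
Lemma test_integral0_ae Omega (h : 'rV[R]_n -> R) : open Omega -> L1loc Omega h ->
  (forall phi, test_function Omega phi -> \int[leb]_(x in Omega) (h x * phi x)%:E = 0)%E ->
  ae_eq leb Omega h (cst 0).
Proof.
move=> oO [mh ih] h0; have mO := open_measurable_rV oO.
have box a b : cbox a b `<=` Omega -> (\int[leb]_(x in obox a b) (h x)%:E = 0)%E.
  move=> abO; have mB := obox_measurable a b.
  have BO : obox a b `<=` Omega := subset_trans (@obox_cbox _ _ a b) abO.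
  have iB : leb.-integrable (obox a b) (EFin \o h).
    apply: (integrableS _ _ (@obox_cbox _ _ a b)) => //.
      by apply: compact_measurable_rV; exact: cbox_compact.
    by apply: ih => //; exact: cbox_compact.
  have mhB := measurable_funS mO BO mh.
  have cv : (fun k : nat => \int[leb]_(x in obox a b) (h x * box_bump k.+1%:R a b x)%:E)%E @ \oo -->
      (\int[leb]_(x in obox a b) (h x)%:E)%E.
    have [|||||_ _ //] := @dominated_convergence _ _ _ leb (obox a b) mB
      (fun k x => (h x * box_bump k.+1%:R a b x)%:E) (fun x => (h x)%:E) (fun x => `|h x|%:E).
    - move=> k; apply/measurable_EFinP; apply: measurable_funM => //.
      exact: measurable_funTS (box_bump_measurable _ a b).
    - exact/measurable_EFinP.
    - apply: nearW => x Bx; apply: cvg_EFin; first exact: nearW.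
      rewrite -[X in _ --> X]mulr1; apply: cvgM; first exact: cvg_cst.
      by have := @box_bump_cvg _ _ a b x; rewrite indicE mem_set.
    - exact: integrable_norm.
    - apply: nearW => x k _; rewrite lee_fin normrM ler_piMr//.
      by rewrite ger0_norm ?box_bump_ge0// box_bump_le1.
  move: cv; rewrite (_ : (fun k => _) = cst 0%E); last first.
    apply/funext => k; rewrite -(h0 (box_bump k.+1%:R a b)); last exact: box_bump_test_function.
    rewrite integral_mkcond [RHS]integral_mkcond; apply: eq_integral => x _.
    rewrite !patchE; case: ifPn => xB.
      by rewrite mem_set//; apply: BO; exact/set_mem.
    case: ifPn => // xO; rewrite box_bump_out// ?mulr0//.
    by move=> /mem_set; exact/negP.
  by move=> /cvg_lim <-//; rewrite lim_cst.
have aebox a b : cbox a b `<=` Omega -> ae_eq leb (obox a b) h (cst 0).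
  move=> abO; have mB := obox_measurable a b.
  have BO : obox a b `<=` Omega := subset_trans (@obox_cbox _ _ a b) abO.
  have iB : leb.-integrable (obox a b) (EFin \o h).
    apply: (integrableS _ _ (@obox_cbox _ _ a b)) => //.
      by apply: compact_measurable_rV; exact: cbox_compact.
    by apply: ih => //; exact: cbox_compact.
  have ihB : leb.-integrable setT ((EFin \o h) \_ (obox a b)) := (integrable_mkcond (EFin \o h) mB).1 iB.
  pose nu := induced_charge ihB.
  have nuE A : nu A = (\int[leb]_(x in A `&` obox a b) (h x)%:E)%E.
    by rewrite integral_mkcondr.
  suff : ae_eq leb (obox a b) (EFin \o h) (cst 0%E).
    by apply: filterS => x /= hx /hx [].
  apply: integral_ae_eq => // A AB mA; rewrite integral0 -(setIidl AB) -nuE.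
  apply: (@charge_box0 _ a b) => // a' b' sub.
  rewrite [LHS]nuE setIC; have [a'' [b'' [-> sub']]] := oboxI a b a' b'.
  by apply: box; exact: subset_trans abO.
have [Q [QO OE]] := open_bigcup_boxes oO.
have aeQ k : ae_eq leb (Q k) h (cst 0).
  by case: (QO k) => [->|[a [b [-> abO]]]]; [exact: nearW | exact: aebox].
apply: (@negligibleS _ _ _ leb (\bigcup_k ~` [set x | Q k x -> h x = cst 0 x])).
  move=> x /= /not_implyP[Ox hx]; move: Ox; rewrite OE => -[k _ Qx].
  by exists k => // /(_ Qx).
by apply: negligible_bigcup => k; exact: aeQ.
Qed.

End charge_uniqueness.

(** * Weak gradients *)

Section weak_gradients.
Context {R : realType} {n : nat} (Omega : set 'rV[R]_n).
Local Notation leb := (@lebesgue_rV R n).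
Local Notation SI := (square_integrable leb Omega).
Implicit Types (u v h psi phi : 'rV[R]_n -> R) (w : 'rV[R]_n -> 'rV[R]_n).
Hypothesis open_Omega : open Omega.

Let mO : measurable Omega := open_measurable_rV open_Omega.

Lemma Lp2P u : Lp Omega 2%:E u <-> SI u.
Proof.
have sqE : (fun x => ((u \_ Omega) x ^+ 2)%:E) = (EFin \o (fun x => u x ^+ 2)) \_ Omega.
  by apply/funext => x; rewrite !patchE; case: ifPn => // _; rewrite expr0n.
split=> [uL|[mu iu]].
  have isq := Lfun2_integrable_sqr uL.
  move: uL; rewrite /Lp inE => /andP[+ _]; rewrite inE/= => mu; split.
    exact/(measurable_restrictT u mO).
  by apply/integrable_mkcond => //; rewrite -sqE.
rewrite /Lp inE; apply/andP; split; rewrite inE/=.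
  exact/(measurable_restrictT u mO).
rewrite /finite_norm unlock; apply: poweR_lty.
have := (integrable_mkcond _ mO).1 iu; rewrite -sqE => /integrableP[_].
apply: le_lt_trans; rewrite le_eqVlt; apply/orP; left; apply/eqP.
apply: eq_integral => x _ /=.
by rewrite powR_mulrn// -normrX.
Qed.

Lemma Lp1P u : Lp Omega 1%E u <-> leb.-integrable Omega (EFin \o u).
Proof.
rewrite /Lp; split.
  by move=> /Lfun1_integrable; rewrite -restrict_EFin => /(integrable_mkcond _ mO).
by move=> /(integrable_mkcond _ mO); rewrite restrict_EFin => /Lfun1_integrable.
Qed.

Lemma compact_support_integrable h psi (K : set 'rV[R]_n) : L1loc Omega h ->
  continuous psi -> compact K -> K `<=` Omega -> (forall x, ~ K x -> psi x = 0) ->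
  leb.-integrable Omega (EFin \o (fun x => h x * psi x)).
Proof.
move=> [mh ih] cpsi cK KO psi0; have mK := compact_measurable_rV cK.
have iK := ih K cK KO.
have : bounded_set (psi @` K).
  apply: compact_bounded; apply: continuous_compact => //.
  exact: continuous_subspaceT.
move=> [M [_ hM]]; have {}hM x : K x -> `|psi x| <= M + 1.
  by move=> Kx; apply: (hM (M + 1)); [rewrite ltrDl | exists x].
have mKh := measurable_funS mO KO mh.
have mpsi := continuous_measurable_rV cpsi.
have : leb.-integrable K (EFin \o (fun x => h x * psi x)).
  apply: (@integrable_le_norm _ _ _ _ K mK _ (fun x => (M + 1) * `|h x|)).
  - by apply: measurable_funM => //; exact: measurable_funTS.
  - rewrite (_ : _ \o _ = (fun x => (M + 1)%:E * `|h x|%:E)%E)//.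
    by apply: integrableZl => //; exact: integrable_norm.
  - by move=> x Kx; rewrite normrM mulrC ler_wpM2r ?hM.
move=> /(integrable_mkcond _ mK) iKK; apply/integrable_mkcond => //.
rewrite (_ : _ \_ Omega = (EFin \o (fun x => h x * psi x)) \_ K)//.
apply/funext => x; rewrite !patchE; case: ifPn => xO; case: ifPn => xK //.
  by rewrite /= psi0 ?mulr0//; move=> /mem_set; exact/negP.
by move: xO; rewrite mem_set//; apply: KO; exact/set_mem.
Qed.

Lemma test_functionP phi : test_function Omega phi -> exists K : set 'rV[R]_n,
  [/\ compact K, K `<=` Omega,
      continuous phi, (forall x, ~ K x -> phi x = 0) &
      forall i, continuous (partial i phi) /\ forall x, ~ K x -> partial i phi x = 0].
Proof.
move=> [sphi cK KO]; exists (closure [set x | phi x != 0]).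
have phi0 x : ~ closure [set x | phi x != 0] x -> phi x = 0.
  by apply: contra_notP => /eqP xn; exact: subset_closure.
split => //; first by have [] := sphi [::].
move=> i; split; first by have [] := sphi [:: i].
move=> x xK; rewrite /partial.
have -> : 'D_(delta_mx 0 i) phi x = 'D_(delta_mx 0 i) (cst 0 : 'rV[R]_n -> R) x.
  apply: near_eq_derive.
  have : nbhs x (~` closure [set x | phi x != 0]).
    by apply: open_nbhs_nbhs; split => //; exact/closed_openC/closed_closure.
  by apply: filterS => y /phi0.
by rewrite derive_cst.
Qed.

Lemma test_integrable h phi : L1loc Omega h -> test_function Omega phi ->
  leb.-integrable Omega (EFin \o (fun x => h x * phi x)) /\
  forall i, leb.-integrable Omega (EFin \o (fun x => h x * partial i phi x)).
Proof.
move=> hL /test_functionP[K [cK KO cphi phi0 dphi]].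
split; first exact: (@compact_support_integrable _ _ K).
by move=> i; have [cd d0] := dphi i; exact: (@compact_support_integrable _ _ K).
Qed.

(** All integrals involved are finite, so that the equations can be used in [R]. *)
Lemma weak_gradP u w : is_weak_grad Omega u w <->
  [/\ L1loc Omega u, forall i, L1loc Omega (fun x => w x ord0 i) &
  forall i phi, test_function Omega phi ->
    \int[leb]_(x in Omega) (u x * partial i phi x) =
    - \int[leb]_(x in Omega) (w x ord0 i * phi x)].
Proof.
split=> -[uL wL e]; split => // i phi ht;
  have [_ /(_ i) iu] := test_integrable uL ht; have [iw _] := test_integrable (wL i) ht.
  by rewrite /Rintegral e// fineN.
have := e i _ ht; rewrite /Rintegral => {}e.
by rewrite -[LHS]fineK ?integrable_fin_num// e EFinN fineK// integrable_fin_num.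
Qed.

Lemma L1loc_lincomb (a b : R) u v : L1loc Omega u -> L1loc Omega v ->
  L1loc Omega (fun x => a * u x + b * v x).
Proof.
move=> [mu iu] [mv iv]; split.
  by apply: measurable_funD; apply: measurable_funM => //; exact: measurable_cst.
move=> K cK KO; have mK := compact_measurable_rV cK.
by apply: integrable_lincomb => //; [exact: iu | exact: iv].
Qed.

Lemma weak_grad_lincomb (a b : R) u v w w' :
  is_weak_grad Omega u w -> is_weak_grad Omega v w' ->
  is_weak_grad Omega (fun x => a * u x + b * v x) (fun x => a *: w x + b *: w' x).
Proof.
move=> /weak_gradP[uL wL e] /weak_gradP[vL w'L e']; apply/weak_gradP.
have wwE i : (fun x => (a *: w x + b *: w' x) ord0 i) =
    (fun x => a * w x ord0 i + b * w' x ord0 i).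
  by apply/funext => x; rewrite !mxE.
split; first exact: L1loc_lincomb.
  by move=> i; rewrite wwE; exact: L1loc_lincomb.
move=> i phi ht.
have [_ /(_ i) iu] := test_integrable uL ht; have [iw _] := test_integrable (wL i) ht.
have [_ /(_ i) iv] := test_integrable vL ht; have [iw' _] := test_integrable (w'L i) ht.
under eq_Rintegral do rewrite mulrDl -!mulrA.
rewrite Rintegral_lincomb// e// e'//.
under [in RHS]eq_Rintegral do rewrite !mxE mulrDl -!mulrA.
by rewrite Rintegral_lincomb// !mulrN opprD.
Qed.

Lemma weak_grad_uniq u w w' : is_weak_grad Omega u w -> is_weak_grad Omega u w' ->
  forall i, ae_eq leb Omega (fun x => w x ord0 i) (fun x => w' x ord0 i).
Proof.
move=> /weak_gradP[uL wL e] /weak_gradP[_ w'L e'] i.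
have := @test_integral0_ae _ _ Omega (fun x => 1 * w x ord0 i + (-1) * w' x ord0 i) open_Omega.
have hL := L1loc_lincomb 1 (-1) (wL i) (w'L i).
move=> /(_ hL) h.
suff /h : forall phi, test_function Omega phi -> (\int[leb]_(x in Omega)
    ((1 * w x ord0 i + (-1) * w' x ord0 i) * phi x)%:E = 0)%E.
  apply: filterS => x /= hx /hx /eqP.
  by rewrite mul1r mulN1r subr_eq0 => /eqP.
move=> phi ht; have [ih _] := test_integrable hL ht.
rewrite -[LHS]fineK ?integrable_fin_num//; congr EFin.
rewrite -[LHS]/(\int[leb]_(x in Omega) ((1 * w x ord0 i + (-1) * w' x ord0 i) * phi x)).
have [iw _] := test_integrable (wL i) ht; have [iw' _] := test_integrable (w'L i) ht.
under eq_Rintegral do rewrite mulrDl -!mulrA.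
rewrite Rintegral_lincomb//; have := e i _ ht; rewrite e'// => /oppr_inj ->.
by rewrite mul1r mulN1r subrr.
Qed.

Hypothesis finO : (leb Omega < +oo)%E.

Lemma square_integrable_L1loc u : SI u -> L1loc Omega u.
Proof.
move=> su; split; first exact: su.1.
move=> K cK KO; apply: (integrableS mO) => //; first exact: compact_measurable_rV.
exact: square_integrable1.
Qed.

Lemma Rintegral_mul_close u v psi (M t : R) : 0 < t -> SI u -> SI v ->
  continuous psi -> (forall x, `|psi x| <= M) ->
  leb.-integrable Omega (EFin \o (fun x => u x * psi x)) ->
  leb.-integrable Omega (EFin \o (fun x => v x * psi x)) ->
  `| \int[leb]_(x in Omega) (u x * psi x) - \int[leb]_(x in Omega) (v x * psi x) | <=
  M * (t * fine (leb Omega) + sqnorm leb Omega (fun x => u x - v x) / t).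
Proof.
move=> t0 su sv cpsi hM iu iv; have suv := square_integrableB mO su sv.
rewrite -RintegralB//.
have id : leb.-integrable Omega (EFin \o (fun x => u x * psi x - v x * psi x)).
  by have := integrable_lincomb mO 1 (-1) iu iv; under eq_fun do rewrite mul1r mulN1r.
have ia : leb.-integrable Omega (EFin \o (fun x => `|u x - v x|)).
  by apply: integrable_norm; exact: square_integrable1.
apply: le_trans (le_normr_Rintegral mO id) _.
have M0 : 0 <= M := le_trans (normr_ge0 _) (hM 0).
apply: (@le_trans _ _ (\int[leb]_(x in Omega) (M * `|u x - v x|))).
  apply: le_Rintegral => //.
  - exact: integrable_norm.
  - rewrite (_ : _ \o _ = (fun x => M%:E * `|u x - v x|%:E)%E)//.
    exact: integrableZl.
  - by move=> x _; rewrite -mulrBl normrM mulrC ler_wpM2r.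
by rewrite RintegralZl// ler_wpM2l// Rintegral_norm_le.
Qed.

(** Against a fixed test function, which is bounded together with its partial
    derivatives, convergence in mean square is enough. *)
Lemma weak_grad_lim (u_ : nat -> 'rV[R]_n -> R) (w_ : nat -> 'rV[R]_n -> 'rV[R]_n)
    u w (C : R) :
  (forall k, SI (u_ k)) -> (forall k i, SI (fun x => w_ k x ord0 i)) ->
  SI u -> (forall i, SI (fun x => w x ord0 i)) ->
  (forall k, is_weak_grad Omega (u_ k) (w_ k)) ->
  (forall k, sqnorm leb Omega (fun x => u_ k x - u x) <= C * 4^-1 ^+ k) ->
  (forall k i, sqnorm leb Omega (fun x => w_ k x ord0 i - w x ord0 i) <= C * 4^-1 ^+ k) ->
  is_weak_grad Omega u w.
Proof.
move=> su_ sw_ su sw uw_ cu cw; apply/weak_gradP.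
have uL := square_integrable_L1loc su.
have wL i := square_integrable_L1loc (sw i).
split => // i phi ht.
have [K [cK KO cphi phi0 /(_ i)[cd d0]]] := test_functionP ht.
have bnd psi : continuous psi -> (forall x, ~ K x -> psi x = 0) ->
    exists M : R, forall x, `|psi x| <= M.
  move=> cpsi psi0; have : bounded_set (psi @` K).
    by apply: compact_bounded; apply: continuous_compact => //; exact: continuous_subspaceT.
  move=> [M [_ hM]]; exists (Num.max 0 (M + 1)) => x; rewrite le_max.
  have [Kx|Kx] := pselect (K x); last by rewrite psi0// normr0 lexx.
  by apply/orP; right; apply: (hM (M + 1)); [rewrite ltrDl | exists x].
have [M1 hM1] := bnd _ cphi phi0; have [M2 hM2] := bnd _ cd d0.
have [_ /(_ i) iu] := test_integrable uL ht; have [iw _] := test_integrable (wL i) ht.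
set a := \int[leb]_(x in Omega) (u x * _).
set b := \int[leb]_(x in Omega) (w x _ _ * _).
suff : `|a + b| <= 0 by rewrite normr_le0 addr_eq0 => /eqP.
apply: (@le_fast_null _ _ _ ((M1 + M2) * (fine (leb Omega) + C))) => k; rewrite add0r.
have t0 : 0 < 2^-1 ^+ k :> R by rewrite exprn_gt0// invr_gt0.
have [u_L w_L /(_ i _ ht) e] := (weak_gradP _ _).1 (uw_ k).
have [_ /(_ i) iu_] := test_integrable u_L ht; have [iw_ _] := test_integrable (w_L i) ht.
have h1 := Rintegral_mul_close t0 (su_ k) su cd hM2 iu_ iu.
have h2 := Rintegral_mul_close t0 (sw_ k i) (sw i) cphi hM1 iw_ iw.
have tri M s : 0 <= M -> s <= C * 4^-1 ^+ k ->
    M * (2^-1 ^+ k * fine (leb Omega) + s / 2^-1 ^+ k) <=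
    M * (fine (leb Omega) + C) * 2^-1 ^+ k.
  move=> M0 sC; rewrite -mulrA ler_wpM2l// mulrDl [2^-1 ^+ k * _]mulrC lerD2l.
  rewrite ler_pdivrMr//; apply: le_trans sC _.
  by rewrite -mulrA -exprMn (_ : 2^-1 * 2^-1 = 4^-1)//; lra.
have M10 : 0 <= M1 := le_trans (normr_ge0 _) (hM1 0).
have M20 : 0 <= M2 := le_trans (normr_ge0 _) (hM2 0).
have {}h1 := le_trans h1 (tri _ _ M20 (cu k)).
have {}h2 := le_trans h2 (tri _ _ M10 (cw k i)).
move: h1 h2; rewrite e -/a -/b; set c := \int[leb]_(x in Omega) _ => h1 h2.
have -> : a + b = - (- c - a) - (c - b) by ring.
apply: le_trans (ler_normB _ _) _; rewrite normrN; lra.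
Qed.

End weak_gradients.

(** * The Hilbert space of functions with a weak gradient *)

Section sobolev_pairs.
Context {R : realType} {n : nat} (Omega : set 'rV[R]_n).
Local Notation leb := (@lebesgue_rV R n).
Local Notation SI := (square_integrable leb Omega).
Local Notation sq := (sqnorm leb Omega).
Hypothesis open_Omega : open Omega.
Hypothesis finO : (leb Omega < +oo)%E.

Let mO : measurable Omega := open_measurable_rV open_Omega.

Definition scalar_pair : lmodType R :=
  (('rV[R]_n -> R^o) * ('rV[R]_n -> 'rV[R]_n))%type.

Definition vector_pair : lmodType R :=
  (('rV[R]_n -> 'rV[R]_n) * ('rV[R]_n -> 'M[R]_n))%type.

Implicit Types (x y : scalar_pair) (v w : vector_pair).

Definition row_pair (i : 'I_n) v : scalar_pair :=
  (fun t => v.1 t ord0 i, fun t => row i (v.2 t)).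

(** Pairs of a function and one of its weak gradients, rather than functions
    alone: weak gradients are not functions of u, and pairs add up exactly and not
    just almost everywhere. *)
Definition sobolev_pair (x : scalar_pair) : Prop :=
  [/\ SI x.1, forall i, SI (fun t => x.2 t ord0 i) & is_weak_grad Omega x.1 x.2].

Definition sobolev_vpair (v : vector_pair) : Prop :=
  forall i, sobolev_pair (row_pair i v).

Definition pair_sqnorm x : R := sq x.1 + \sum_i sq (fun t => x.2 t ord0 i).

Definition vpair_sqnorm v : R := \sum_i pair_sqnorm (row_pair i v).

Lemma pair_sqnorm_ge0 x : 0 <= pair_sqnorm x.
Proof. by rewrite addr_ge0 ?sumr_ge0// => [|i _]; exact: sqnorm_ge0. Qed.

Lemma vpair_sqnorm_ge0 v : 0 <= vpair_sqnorm v.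
Proof. by rewrite sumr_ge0// => i _; exact: pair_sqnorm_ge0. Qed.

Lemma sobolev_pair_midpoint x y : sobolev_pair x -> sobolev_pair y ->
  sobolev_pair (2^-1 *: (x + y)).
Proof.
move=> [sx1 sx2 wx] [sy1 sy2 wy]; split.
- have := square_integrable_lincomb mO 2^-1 2^-1 sx1 sy1.
  by under eq_fun do rewrite -mulrDr.
- move=> i; have := square_integrable_lincomb mO 2^-1 2^-1 (sx2 i) (sy2 i).
  rewrite (_ : (fun t => _) = (fun t => (2^-1 *: (x + y)).2 t ord0 i))//.
  by apply/funext => t; rewrite -mulrDr !mxE.
- have := weak_grad_lincomb open_Omega 2^-1 2^-1 wx wy.
  rewrite (_ : (fun t => _) = (2^-1 *: (x + y)).1); last first.
    by apply/funext => t; rewrite -mulrDr.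
  rewrite (_ : (fun t => _ *: _ + _) = (2^-1 *: (x + y)).2)//.
  by apply/funext => t; rewrite -scalerDr.
Qed.

Lemma row_pair_midpoint i v w :
  row_pair i (2^-1 *: (v + w)) = 2^-1 *: (row_pair i v + row_pair i w).
Proof.
rewrite /row_pair; congr pair; apply/funext => t; first by rewrite !mxE.
by apply/rowP => j; rewrite !mxE.
Qed.

Lemma sobolev_vpair_midpoint v w : sobolev_vpair v -> sobolev_vpair w ->
  sobolev_vpair (2^-1 *: (v + w)).
Proof.
move=> sv sw i; rewrite row_pair_midpoint; exact: sobolev_pair_midpoint.
Qed.

Lemma pair_sqnorm_midpoint x y : sobolev_pair x -> sobolev_pair y ->
  pair_sqnorm (2^-1 *: (x + y)) + 4^-1 * pair_sqnorm (x - y) =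
  (pair_sqnorm x + pair_sqnorm y) / 2.
Proof.
move=> [sx1 sx2 _] [sy1 sy2 _]; rewrite /pair_sqnorm.
have h1 := sqnorm_midpoint mO sx1 sy1.
have h2 : \sum_i sq (fun t => (2^-1 *: (x + y)).2 t ord0 i) +
    4^-1 * \sum_i sq (fun t => (x - y).2 t ord0 i) =
    (\sum_i sq (fun t => x.2 t ord0 i) + \sum_i sq (fun t => y.2 t ord0 i)) / 2.
  rewrite mulr_sumr -!big_split/= mulr_suml; apply: eq_bigr => i _.
  rewrite -(sqnorm_midpoint mO (sx2 i) (sy2 i)); congr (sq _ + _ * sq _).
    by apply/funext => t; rewrite !mxE.
  by apply/funext => t; rewrite !mxE.
rewrite mulrDr addrACA h2; set S := (_ + _) / 2 in h2 *.
have -> : sq (2^-1 *: (x + y)).1 + 4^-1 * sq (x - y).1 = (sq x.1 + sq y.1) / 2 by exact: h1.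
by rewrite /S; field.
Qed.

Lemma vpair_sqnorm_midpoint v w : sobolev_vpair v -> sobolev_vpair w ->
  vpair_sqnorm (2^-1 *: (v + w)) <= (vpair_sqnorm v + vpair_sqnorm w) / 2.
Proof.
move=> sv sw; rewrite /vpair_sqnorm -big_split/= mulr_suml; apply: ler_sum => i _.
rewrite row_pair_midpoint -(pair_sqnorm_midpoint (sv i) (sw i)) lerDl.
by rewrite mulr_ge0 ?invr_ge0// pair_sqnorm_ge0.
Qed.

Lemma pair_sqnorm_lsc x y (t : R) : 0 < t -> sobolev_pair x -> sobolev_pair y ->
  pair_sqnorm x <= pair_sqnorm y + t * pair_sqnorm x + pair_sqnorm (y - x) / t.
Proof.
move=> t0 [sx1 sx2 _] [sy1 sy2 _]; rewrite /pair_sqnorm.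
have h1 : sq x.1 <= sq y.1 + t * sq x.1 + sq (y - x).1 / t by exact: sqnorm_lsc.
have h2 : \sum_i sq (fun s => x.2 s ord0 i) <= \sum_i sq (fun s => y.2 s ord0 i) +
    t * (\sum_i sq (fun s => x.2 s ord0 i)) + (\sum_i sq (fun s => (y - x).2 s ord0 i)) / t.
  rewrite mulr_sumr mulr_suml -!big_split/=; apply: ler_sum => i _.
  have := sqnorm_lsc mO t0 (sx2 i) (sy2 i); congr (_ <= _ + sq _ / _).
  by apply/funext => s; rewrite !mxE.
rewrite mulrDr mulrDl; lra.
Qed.

(** Completeness of each coordinate suffices. *)
Lemma sobolev_pair_complete (x : nat -> scalar_pair) (C : R) :
  (forall k, sobolev_pair (x k)) ->
  (forall k l, (k <= l)%N -> pair_sqnorm (x l - x k) <= C * 4^-1 ^+ k) ->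
  exists2 y, sobolev_pair y &
    exists C' : R, forall k, pair_sqnorm (x k - y) <= C' * 4^-1 ^+ k.
Proof.
move=> sx cx.
have S0 (z : scalar_pair) : 0 <= \sum_i sq (fun t => z.2 t ord0 i).
  by apply: sumr_ge0 => i _; exact: sqnorm_ge0.
have [u su cu] : exists2 u, SI u & forall k, sq (fun t => (x k).1 t - u t) <= C * 4^-1 ^+ k.
  apply: (square_integrable_complete mO finO).
    by move=> k; have [] := sx k.
  by move=> k l kl; apply: le_trans (cx _ _ kl); rewrite lerDl.
have /choice[g gP] i : exists g, SI g /\
    forall k, sq (fun t => (x k).2 t ord0 i - g t) <= C * 4^-1 ^+ k.
  have [||g sg cg] := @square_integrable_complete _ _ _ leb Omega mO finO
    (fun k t => (x k).2 t ord0 i) C.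
  - by move=> k; have [_ /(_ i)] := sx k.
  - move=> k l kl; apply: le_trans (cx _ _ kl).
    rewrite /pair_sqnorm (bigD1 i)//= addrCA.
    rewrite (_ : (fun t => (x l - x k).2 t ord0 i) = (fun t => (x l).2 t ord0 i - (x k).2 t ord0 i)).
      rewrite lerDl addr_ge0 ?sqnorm_ge0// sumr_ge0// => j _; exact: sqnorm_ge0.
    by apply/funext => t; rewrite !mxE.
  - by exists g.
pose w t : 'rV[R]_n := \row_i g i t.
have wE i : (fun t => w t ord0 i) = g i by apply/funext => t; rewrite mxE.
exists ((u, w) : scalar_pair); first split => //=.
- by move=> i; rewrite wE; have [] := gP i.
- apply: (@weak_grad_lim _ _ Omega open_Omega finO (fun k => (x k).1) (fun k => (x k).2) u w C) => //.
  + by move=> k; have [] := sx k.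
  + by move=> k i; have [_ /(_ i)] := sx k.
  + by move=> i; rewrite wE; have [] := gP i.
  + by move=> k; have [] := sx k.
  + move=> k i; have := (gP i).2 k; congr (sq _ <= _).
    by apply/funext => t; rewrite mxE.
- exists (C + \sum_(i < n) C) => k; rewrite mulrDl; apply: lerD; first exact: cu.
  rewrite mulr_suml; apply: ler_sum => i _; have := (gP i).2 k; congr (sq _ <= _).
  by apply/funext => t; rewrite !mxE.
Qed.

End sobolev_pairs.

(** * The denoising energy on pairs *)

(** The bookkeeping of the two energy estimates below, on plain numbers. *)
Lemma midpoint_arith (R : realFieldType)
    (p1 p2 mu F F1 F2 A A1 A2 B B1 B2 Q Q1 Q2 V V1 V2 d : R) :
  F <= (F1 + F2) / 2 -> p1 * A <= p1 * ((A1 + A2) / 2) ->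
  p2 * B <= p2 * ((B1 + B2) / 2) -> mu * V <= mu * ((V1 + V2) / 2) ->
  Q + 4^-1 * d = (Q1 + Q2) / 2 ->
  2^-1 * F + (p1 * A + p2 * B + mu / 2 * (Q + V)) + mu / 8 * d <=
  (2^-1 * F1 + (p1 * A1 + p2 * B1 + mu / 2 * (Q1 + V1)) +
   (2^-1 * F2 + (p1 * A2 + p2 * B2 + mu / 2 * (Q2 + V2)))) / 2.
Proof.
move=> hF hA hB hV hQ; have {}hQ : mu * Q = mu * ((Q1 + Q2) / 2) - mu * d / 4.
  by rewrite -hQ; field.
lra.
Qed.

Lemma lsc_arith (R : realFieldType)
    (t mu p S V Q F A A1 B Q1 Z r1 r2 : R) : 0 <= t -> 0 <= S -> 0 <= V ->
  0 <= Q -> 0 <= p -> 0 <= mu -> 0 <= r1 -> 0 <= r2 ->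
  S <= F + t * S + r1 -> A <= A1 + (t * V + r2) -> Q <= Q1 + t * Q + (r1 + r2) ->
  2^-1 * S + (p * A + B + mu / 2 * (Q + Z)) <=
  2^-1 * F + (p * A1 + B + mu / 2 * (Q1 + Z)) +
  (2^-1 * S + p * V + mu / 2 * Q + (2^-1 + p + mu / 2)) * (t + (r1 + r2)).
Proof.
move=> t0 S0 V0 Q0 p0 mu0 r10 r20 hS /(ler_wpM2l p0) hA /(ler_wpM2l mu0) hQ.
have c1 : 0 <= 2^-1 * S + p * V + mu / 2 * Q.
  by rewrite !addr_ge0// mulr_ge0 ?invr_ge0// divr_ge0.
have c2 : 0 <= 2^-1 + p + mu / 2 by rewrite !addr_ge0 ?invr_ge0// divr_ge0.
have := mulr_ge0 c1 (addr_ge0 r10 r20); have := mulr_ge0 c2 t0.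
by have := mulr_ge0 p0 r10; lra.
Qed.

Section energy.
Context {R : realType} {n : nat} (Omega : set 'rV[R]_n).
Local Notation leb := (@lebesgue_rV R n).
Local Notation SI := (square_integrable leb Omega).
Local Notation sq := (sqnorm leb Omega).
Hypothesis open_Omega : open Omega.
Hypothesis finO : (leb Omega < +oo)%E.

Let mO : measurable Omega := open_measurable_rV open_Omega.

Implicit Types (x y : scalar_pair (R := R) (n := n)) (v w : vector_pair (R := R) (n := n)).

Lemma integrable_sum_real I (s : seq I) (F : I -> 'rV[R]_n -> R) :
  (forall i, leb.-integrable Omega (EFin \o F i)) ->
  leb.-integrable Omega (EFin \o (fun t => \sum_(i <- s) F i t)).
Proof.
move=> iF; rewrite (_ : _ \o _ = (fun t => \sum_(i <- s) (F i t)%:E)%E).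
  by apply: integrable_sum => // i _; exact: iF.
by apply/funext => t; rewrite /= sumEFin.
Qed.

Lemma Rintegral_sum I (s : seq I) (F : I -> 'rV[R]_n -> R) :
  (forall i, leb.-integrable Omega (EFin \o F i)) ->
  \int[leb]_(t in Omega) (\sum_(i <- s) F i t) =
  \sum_(i <- s) \int[leb]_(t in Omega) F i t.
Proof.
move=> iF; elim: s => [|i s IH].
  rewrite big_nil; under eq_Rintegral do rewrite big_nil.
  by rewrite Rintegral_cst// mul0r.
rewrite big_cons -IH; under eq_Rintegral do rewrite big_cons.
by rewrite RintegralD//; exact: integrable_sum_real.
Qed.

Lemma l2norm_square_integrable m k (A : 'rV[R]_n -> 'M[R]_(m, k)) :
  (forall i j, SI (fun t => A t i j)) -> SI (fun t => l2norm (A t)).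
Proof.
move=> sA; split; first by apply: l2norm_measurable => i j; have [] := sA i j.
under eq_fun do rewrite l2norm_sqr.
apply: integrable_sum_real => i; apply: integrable_sum_real => j.
by have [] := sA i j.
Qed.

Lemma sqnorm_l2norm m k (A : 'rV[R]_n -> 'M[R]_(m, k)) :
  (forall i j, SI (fun t => A t i j)) ->
  sq (fun t => l2norm (A t)) = \sum_i \sum_j sq (fun t => A t i j).
Proof.
move=> sA; rewrite /sqnorm; under eq_Rintegral do rewrite l2norm_sqr.
rewrite Rintegral_sum => [|i]; last by apply: integrable_sum_real => j; have [] := sA i j.
by apply: eq_bigr => i _; rewrite Rintegral_sum// => j; have [] := sA i j.
Qed.

Lemma pair_sqnormE x : sobolev_pair Omega x ->
  pair_sqnorm Omega x = sq x.1 + sq (fun t => l2norm (x.2 t)).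
Proof.
move=> [_ sx _]; rewrite sqnorm_l2norm ?big_ord1// => i j.
by rewrite (ord1 i).
Qed.

Lemma vpair_sqnormE v : sobolev_vpair Omega v ->
  vpair_sqnorm Omega v = sq (fun t => l2norm (v.1 t)) + sq (fun t => l2norm (v.2 t)).
Proof.
move=> sv; rewrite !sqnorm_l2norm ?big_ord1.
- rewrite /vpair_sqnorm /pair_sqnorm big_split/=; congr (_ + _).
  apply: eq_bigr => i _; apply: eq_bigr => j _; congr sq.
  by apply/funext => t; rewrite mxE.
- move=> i j; have [_ /(_ j) + _] := sv i; congr SI.
  by apply/funext => t; rewrite mxE.
- by move=> i j; rewrite (ord1 i); have [] := sv j.
Qed.

Context (gamma mu : R) (gamma_gt0 : 0 < gamma) (mu_gt0 : 0 < mu).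

Definition huber_integral m k (A : 'rV[R]_n -> 'M[R]_(m, k)) : R :=
  \int[leb]_(t in Omega) huber gamma (A t).

Section matrix_fields.
Context {m k : nat}.
Implicit Types A B C : 'rV[R]_n -> 'M[R]_(m, k).

Lemma huber_integrable A : (forall i j, SI (fun t => A t i j)) ->
  leb.-integrable Omega (EFin \o (fun t => huber gamma (A t))).
Proof.
move=> sA; have sl := l2norm_square_integrable sA.
apply: (@integrable_le_norm _ _ _ _ Omega mO _ (fun t => l2norm (A t))).
- by apply: huber_measurable => // i j; have [] := sA i j.
- exact: square_integrable1.
- by move=> t _; rewrite ger0_norm ?huber_ge0// huber_le_l2norm.
Qed.

Lemma huber_integral_ge0 A : 0 <= huber_integral A.
Proof. by apply: Rintegral_ge0 => t _; exact: huber_ge0. Qed.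

Lemma huber_integral_le A : (forall i j, SI (fun t => A t i j)) ->
  huber_integral A <= gamma / 2 * sq (fun t => l2norm (A t)).
Proof.
move=> sA; have [_ il] := l2norm_square_integrable sA.
rewrite -RintegralZl//; apply: le_Rintegral => //; first exact: huber_integrable.
  rewrite (_ : _ \o _ = (fun t => (gamma / 2)%:E * (l2norm (A t) ^+ 2)%:E)%E)//.
  exact: integrableZl.
by move=> t _; exact: huber_le_sqr.
Qed.

Lemma huber_integral_midpoint A B C : (forall i j, SI (fun t => A t i j)) ->
  (forall i j, SI (fun t => B t i j)) -> (forall i j, SI (fun t => C t i j)) ->
  (forall t, C t = 2^-1 *: (A t + B t)) ->
  huber_integral C <= (huber_integral A + huber_integral B) / 2.
Proof.
move=> sA sB sC CE; have iA := huber_integrable sA; have iB := huber_integrable sB.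
have -> : (huber_integral A + huber_integral B) / 2 =
    \int[leb]_(t in Omega) (2^-1 * huber gamma (A t) + 2^-1 * huber gamma (B t)).
  by rewrite Rintegral_lincomb// -mulrDr mulrC.
apply: le_Rintegral => //.
- exact: huber_integrable.
- exact: integrable_lincomb.
- by move=> t _; rewrite CE -mulrDr mulrC huber_midpoint.
Qed.

(** The Huber function is 1-Lipschitz, so the difference is at most the L^1 norm
    of B - A, whatever the common part of A and B. *)
Lemma huber_integral_lsc A B (t : R) : 0 < t ->
  (forall i j, SI (fun t => A t i j)) -> (forall i j, SI (fun t => B t i j)) ->
  (forall i j, SI (fun t => (B t - A t) i j)) ->
  huber_integral A <= huber_integral B +
    (t * fine (leb Omega) + sq (fun s => l2norm (B s - A s)) / t).
Proof.
move=> t0 sA sB sD; have iA := huber_integrable sA; have iB := huber_integrable sB.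
have sl := l2norm_square_integrable sD; have il := square_integrable1 mO finO sl.
have h := Rintegral_norm_le mO finO t0 sl.
apply: le_trans (_ : huber_integral B + \int[leb]_(s in Omega) l2norm (B s - A s) <= _); last first.
  rewrite lerD2l; apply: le_trans h; rewrite le_eqVlt; apply/orP; left; apply/eqP.
  by apply: eq_Rintegral => s _; rewrite ger0_norm ?l2norm_ge0.
rewrite /huber_integral -RintegralD//; apply: le_Rintegral => //.
  rewrite (_ : _ \o _ = (EFin \o (fun s => huber gamma (B s))) \+
    (EFin \o (fun s => l2norm (B s - A s))))%E//.
  exact: integrableD.
by move=> s _; rewrite -l2normN opprB huber_lipschitz.
Qed.

End matrix_fields.

(* L acts on the Jacobian of the auxiliary field: it is the identity for ICTV and
   the symmetrisation for TGV. *)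
Context (L : 'M[R]_n -> 'M[R]_n).
Hypothesis L_midpoint : forall A B, L (2^-1 *: (A + B)) = 2^-1 *: (L A + L B).
Hypothesis L_contract : forall A, l2norm (L A) <= l2norm A.
Hypothesis L_square_integrable : forall A : 'rV[R]_n -> 'M[R]_n,
  (forall i j, SI (fun t => A t i j)) -> forall i j, SI (fun t => L (A t) i j).
Context (f : 'rV[R]_n -> R) (f_SI : SI f).

Definition regulariser_energy (p : R * R) x v : R :=
  p.1 * huber_integral (fun t => x.2 t - v.1 t) +
  p.2 * huber_integral (fun t => L (v.2 t)) +
  mu / 2 * (pair_sqnorm Omega x + vpair_sqnorm Omega v).

Definition total_energy (p : R * R) x v : R :=
  2^-1 * sq (fun t => x.1 t - f t) + regulariser_energy p x v.

Lemma first_order_SI x v : sobolev_pair Omega x -> sobolev_vpair Omega v ->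
  forall i j, SI (fun t => (x.2 t - v.1 t) i j).
Proof.
move=> [_ sx _] sv i j; rewrite (ord1 i); have [sv1 _ _] := sv j.
have := square_integrableB mO (sx j) sv1; congr SI.
by apply/funext => t; rewrite !mxE.
Qed.

Lemma second_order_SI v : sobolev_vpair Omega v -> forall i j, SI (fun t => v.2 t i j).
Proof.
move=> sv i j; have [_ /(_ j) + _] := sv i; congr SI.
by apply/funext => t; rewrite mxE.
Qed.

Lemma total_energy_ge0 p x v : 0 <= p.1 -> 0 <= p.2 -> 0 <= total_energy p x v.
Proof.
move=> p1 p2; rewrite /total_energy /regulariser_energy.
have := sqnorm_ge0 leb Omega (fun t => x.1 t - f t).
have := pair_sqnorm_ge0 Omega x; have := vpair_sqnorm_ge0 Omega v.
have := mulr_ge0 p1 (huber_integral_ge0 (fun t => x.2 t - v.1 t)).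
have := mulr_ge0 p2 (huber_integral_ge0 (fun t => L (v.2 t))).
move=> hB hA hv hq hf.
by have := mulr_ge0 (ltW mu_gt0) (addr_ge0 hq hv); lra.
Qed.

(** Only the quadratic term in x contributes to strong convexity. *)
Lemma total_energy_convex p x y v w : 0 <= p.1 -> 0 <= p.2 ->
  sobolev_pair Omega x -> sobolev_pair Omega y ->
  sobolev_vpair Omega v -> sobolev_vpair Omega w ->
  total_energy p (2^-1 *: (x + y)) (2^-1 *: (v + w)) +
    mu / 8 * pair_sqnorm Omega (x - y) <=
  (total_energy p x v + total_energy p y w) / 2.
Proof.
move=> p1 p2 sx sy sv sw; rewrite /total_energy /regulariser_energy.
have smx := sobolev_pair_midpoint open_Omega sx sy.
have smv := sobolev_vpair_midpoint open_Omega sv sw.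
have hq := pair_sqnorm_midpoint open_Omega sx sy.
have hv := vpair_sqnorm_midpoint open_Omega sv sw.
have hA : huber_integral (fun t => (2^-1 *: (x + y)).2 t - (2^-1 *: (v + w)).1 t) <=
    (huber_integral (fun t => x.2 t - v.1 t) + huber_integral (fun t => y.2 t - w.1 t)) / 2.
  apply: huber_integral_midpoint; try exact: first_order_SI.
  by move=> t; rewrite /= -scalerBr; congr (_ *: _); rewrite opprD addrACA.
have hB : huber_integral (fun t => L ((2^-1 *: (v + w)).2 t)) <=
    (huber_integral (fun t => L (v.2 t)) + huber_integral (fun t => L (w.2 t))) / 2.
  apply: huber_integral_midpoint; try exact/L_square_integrable/second_order_SI.
  by move=> t; rewrite -L_midpoint.
have hf : sq (fun t => (2^-1 *: (x + y)).1 t - f t) <=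
    (sq (fun t => x.1 t - f t) + sq (fun t => y.1 t - f t)) / 2.
  have [sx1 _ _] := sx; have [sy1 _ _] := sy.
  rewrite -(sqnorm_midpoint mO (square_integrableB mO sx1 f_SI) (square_integrableB mO sy1 f_SI)).
  rewrite (_ : (fun t => _) = (fun t => 2^-1 * (x.1 t - f t + (y.1 t - f t)))).
    by rewrite lerDl mulr_ge0 ?invr_ge0// sqnorm_ge0.
  apply/funext => t; rewrite (_ : (2^-1 *: (x + y)).1 t = 2^-1 * (x.1 t + y.1 t))//.
  by field.
have {}hA := ler_wpM2l p1 hA; have {}hB := ler_wpM2l p2 hB.
have {}hv := ler_wpM2l (ltW mu_gt0) hv.
by apply: midpoint_arith.
Qed.

(** The constant does not depend on v, because v cancels in the Lipschitz bound
    for the first order term. *)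
Lemma total_energy_lsc p x : 0 <= p.1 -> 0 <= p.2 -> sobolev_pair Omega x ->
  exists2 C : R, 0 <= C & forall (t : R) y v, 0 < t <= 1 ->
    sobolev_pair Omega y -> sobolev_vpair Omega v ->
    total_energy p x v <= total_energy p y v + C * (t + pair_sqnorm Omega (y - x) / t).
Proof.
move=> p1 p2 sx.
have Q0 := pair_sqnorm_ge0 Omega x; have V0 : 0 <= fine (leb Omega) by exact: fine_ge0.
have F0 := sqnorm_ge0 leb Omega (fun t => x.1 t - f t).
set Q := pair_sqnorm Omega x in Q0; set V := fine (leb Omega) in V0.
set S := sq (fun t => x.1 t - f t) in F0.
exists (2^-1 * S + p.1 * V + mu / 2 * Q + (2^-1 + p.1 + mu / 2)).
  by rewrite !addr_ge0 ?mulr_ge0// ?invr_ge0// ltW.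
move=> t y v /andP[t0 _] sy sv; rewrite /total_energy /regulariser_energy.
have [sx1 sx2 _] := sx; have [sy1 sy2 _] := sy.
have sd : forall i j, SI (fun s => (y.2 s - x.2 s) i j).
  move=> i j; rewrite (ord1 i); have := square_integrableB mO (sy2 j) (sx2 j).
  by congr SI; apply/funext => s; rewrite !mxE.
have dE : pair_sqnorm Omega (y - x) = sq (fun s => y.1 s - x.1 s) + sq (fun s => l2norm (y.2 s - x.2 s)).
  rewrite (sqnorm_l2norm sd) big_ord1 /pair_sqnorm; congr (_ + _).
have D1 := sqnorm_ge0 leb Omega (fun s => y.1 s - x.1 s).
have D2 := sqnorm_ge0 leb Omega (fun s => l2norm (y.2 s - x.2 s)).
set d1 := sq _ in dE D1; set d2 := sq _ in dE D2.
have h1 := sqnorm_lsc mO t0 (square_integrableB mO sx1 f_SI) (square_integrableB mO sy1 f_SI).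
have e1 : sq (fun s => y.1 s - f s - (x.1 s - f s)) = d1.
  by apply: eq_Rintegral => s _; ring.
rewrite -/S e1 in h1.
have cancel_v s : y.2 s - v.1 s - (x.2 s - v.1 s) = y.2 s - x.2 s.
  by rewrite opprB addrA subrK.
have sd' i j : SI (fun s => (y.2 s - v.1 s - (x.2 s - v.1 s)) i j).
  by under eq_fun do rewrite cancel_v; exact: sd.
have h2 := huber_integral_lsc t0 (first_order_SI sx sv) (first_order_SI sy sv) sd'.
have e2 : sq (fun s => l2norm (y.2 s - v.1 s - (x.2 s - v.1 s))) = d2.
  by congr sqnorm; apply/funext => s; rewrite cancel_v.
rewrite -/V e2 in h2.
have h3 := pair_sqnorm_lsc open_Omega t0 sx sy; rewrite -/Q in h3.
rewrite dE in h3 *.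
have r1 := divr_ge0 D1 (ltW t0); have r2 := divr_ge0 D2 (ltW t0).
rewrite [(d1 + d2) / t]mulrDl in h3 *.
exact: (lsc_arith _ _ (ltW t0) F0 V0 Q0 p1 (ltW mu_gt0) r1 r2 h1 h2 h3).
Qed.

(** The two Huber terms are bounded by gamma times the squared norms, which are at
    most 2 / mu times the energy. *)
Lemma total_energy_param p p' x v : 0 <= p.1 -> 0 <= p.2 ->
  sobolev_pair Omega x -> sobolev_vpair Omega v ->
  total_energy p' x v <= (1 + 4 * gamma / mu * `|p' - p|) * total_energy p x v.
Proof.
move=> p1 p2 sx sv.
set A := huber_integral (fun t => x.2 t - v.1 t).
set B := huber_integral (fun t => L (v.2 t)).
have A0 : 0 <= A := huber_integral_ge0 _; have B0 : 0 <= B := huber_integral_ge0 _.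
set Q := pair_sqnorm Omega x + vpair_sqnorm Omega v.
have d1 : p'.1 - p.1 <= `|p' - p|.
  by apply: le_trans (ler_norm _) _; rewrite [leRHS]/Num.norm/= le_max lexx.
have d2 : p'.2 - p.2 <= `|p' - p|.
  by apply: le_trans (ler_norm _) _; rewrite [leRHS]/Num.norm/= le_max lexx orbT.
set d := `|p' - p| in d1 d2 *; have d0 : 0 <= d := normr_ge0 _.
have sF := first_order_SI sx sv.
have hA : A <= gamma * Q.
  apply: le_trans (huber_integral_le sF) _.
  have [sx1 sx2 _] := sx.
  suff : sq (fun t => l2norm (x.2 t - v.1 t)) <= 2 * Q.
    by move=> /(ler_wpM2l (ltW gamma_gt0)); lra.
  rewrite /Q (pair_sqnormE sx) (vpair_sqnormE sv).
  have sl1 : SI (fun t => l2norm (x.2 t)).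
    by apply: l2norm_square_integrable => i j; rewrite (ord1 i).
  have sl2 : SI (fun t => l2norm (v.1 t)).
    by apply: l2norm_square_integrable => i j; rewrite (ord1 i); have [] := sv j.
  have [_ i1] := sl1; have [_ i2] := sl2; have [_ i3] := l2norm_square_integrable sF.
  apply: (@le_trans _ _ (2 * sq (fun t => l2norm (x.2 t)) + 2 * sq (fun t => l2norm (v.1 t)))).
    rewrite -Rintegral_lincomb//; apply: le_Rintegral => //; first exact: integrable_lincomb.
    move=> t _; have := l2normD (x.2 t) (- v.1 t); rewrite l2normN => h.
    have := l2norm_ge0 (x.2 t - v.1 t); have := l2norm_ge0 (x.2 t); have := l2norm_ge0 (v.1 t).
    move: h; set a := l2norm (_ - _); set b := l2norm (x.2 t); set c := l2norm (v.1 t).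
    by move=> *; have := sqr_ge0 (b - c); nra.
  have := sqnorm_ge0 leb Omega x.1; have := sqnorm_ge0 leb Omega (fun t => l2norm (v.2 t)).
  lra.
have hB : B <= gamma * Q.
  have sG := second_order_SI sv; have sLG := L_square_integrable sG.
  apply: le_trans (huber_integral_le sLG) _.
  suff : sq (fun t => l2norm (L (v.2 t))) <= Q.
    move=> /(ler_wpM2l (ltW gamma_gt0)).
    have : 0 <= gamma * sq (fun t => l2norm (L (v.2 t))).
      by rewrite mulr_ge0 ?sqnorm_ge0// ltW.
    lra.
  apply: (@le_trans _ _ (sq (fun t => l2norm (v.2 t)))).
    have [_ i1] := l2norm_square_integrable sG; have [_ i2] := l2norm_square_integrable sLG.
    apply: le_Rintegral => // t _; rewrite lerXn2r ?nnegrE ?l2norm_ge0//.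
  rewrite /Q (vpair_sqnormE sv) addrA lerDr addr_ge0 ?pair_sqnorm_ge0 ?sqnorm_ge0//.
have Q0 : 0 <= Q by rewrite addr_ge0 ?pair_sqnorm_ge0 ?vpair_sqnorm_ge0.
have hQ : mu / 2 * Q <= total_energy p x v.
  rewrite /total_energy /regulariser_energy -/A -/B -/Q.
  have := sqnorm_ge0 leb Omega (fun t => x.1 t - f t).
  have := mulr_ge0 p1 A0; have := mulr_ge0 p2 B0; lra.
have -> : total_energy p' x v = total_energy p x v + (p'.1 - p.1) * A + (p'.2 - p.2) * B.
  by rewrite /total_energy /regulariser_energy -/A -/B -/Q; ring.
rewrite [leRHS]mulrDl mul1r -addrA lerD2l.
apply: (@le_trans _ _ (4 * gamma / mu * d * (mu / 2 * Q))); last first.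
  by rewrite ler_wpM2l// mulr_ge0// divr_ge0// ?mulr_ge0// ltW.
have -> : 4 * gamma / mu * d * (mu / 2 * Q) = d * (gamma * Q) + d * (gamma * Q).
  by field; rewrite gt_eqF.
apply: lerD.
  exact: le_trans (ler_wpM2r A0 d1) (ler_wpM2l d0 hA).
exact: le_trans (ler_wpM2r B0 d2) (ler_wpM2l d0 hB).
Qed.

End energy.

(** * Integrals against charges with a density *)

Section charge_integrals.
Context d (T : measurableType d) {R : realType}.
Implicit Types (nu : {charge set T -> \bar R}) (phi : T -> R).

(** The integral against a charge can be computed from any decomposition as a
    difference of finite measures, not just the Jordan one. *)
Lemma charge_integralE nu (m1 m2 : {measure set T -> \bar R}) phi :
  (m1 setT < +oo)%E -> (m2 setT < +oo)%E ->
  (forall A, measurable A -> nu A = (m1 A - m2 A)%E) ->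
  measurable_fun setT phi -> [bounded phi x | x in setT] ->
  charge_integral nu phi = (\int[m1]_x (phi x)%:E - \int[m2]_x (phi x)%:E)%E.
Proof.
move=> f1 f2 nuE mphi bphi; rewrite /charge_integral.
set p := jordan_pos _; set n := jordan_neg _.
have ip : p.-integrable setT (EFin \o phi).
  by apply: measurable_bounded_integrable => //; rewrite ltey_eq fin_num_measure.
have in_ : n.-integrable setT (EFin \o phi).
  by apply: measurable_bounded_integrable => //; rewrite ltey_eq fin_num_measure.
have i1 : m1.-integrable setT (EFin \o phi) by exact: measurable_bounded_integrable.
have i2 : m2.-integrable setT (EFin \o phi) by exact: measurable_bounded_integrable.
have mphi' : measurable_fun setT (EFin \o phi) by exact/measurable_EFinP.
have : (\int[measure_add p m2]_x (phi x)%:E = \int[measure_add m1 n]_x (phi x)%:E)%E.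
  apply: eq_measure_integral => A mA _.
  suff : (p A + m2 A = m1 A + n A)%E.
    by move=> h; rewrite [LHS]measure_addE [RHS]measure_addE.
  have pnE : nu A = (p A - n A)%E.
    by rewrite [LHS](jordan_decomp (hahn_posnegP nu))// /cadd/= cscaleN1.
  have fin (m : {measure set T -> \bar R}) : (m setT < +oo)%E -> m A \is a fin_num.
    by move=> mT; rewrite ge0_fin_numE//; apply: le_lt_trans mT; apply: le_measure; rewrite ?inE.
  have pf : p A \is a fin_num by exact: fin_num_measure.
  have nf : n A \is a fin_num by exact: fin_num_measure.
  have := nuE A mA; rewrite pnE.
  rewrite -(fineK pf) -(fineK nf) -(fineK (fin _ f1)) -(fineK (fin _ f2)) -!EFinB -!EFinD.
  by move=> [] h; congr EFin; lra.
rewrite !integral_measure_add//.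
have := integrable_fin_num measurableT ip; have := integrable_fin_num measurableT in_.
have := integrable_fin_num measurableT i1; have := integrable_fin_num measurableT i2.
move=> /fineK <- /fineK <- /fineK <- /fineK <-; rewrite -!EFinB -!EFinD.
by move=> [] h; congr EFin; lra.
Qed.

Lemma charge_integralB nu nu' phi :
  measurable_fun setT phi -> [bounded phi x | x in setT] ->
  charge_integral (cadd nu (copp nu')) phi =
  (charge_integral nu phi - charge_integral nu' phi)%E.
Proof.
move=> mphi bphi; rewrite [in RHS]/charge_integral.
set p := jordan_pos (hahn_posnegP nu); set n := jordan_neg (hahn_posnegP nu).
set p' := jordan_pos (hahn_posnegP nu'); set n' := jordan_neg (hahn_posnegP nu').
have jE nu0 A : measurable A -> nu0 A = (jordan_pos (hahn_posnegP nu0) A - jordan_neg (hahn_posnegP nu0) A)%E.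
  by move=> mA; rewrite [LHS](jordan_decomp (hahn_posnegP nu0))// /cadd/= cscaleN1.
have fin (m : {finite_measure set T -> \bar R}) : (m setT < +oo)%E.
  by rewrite ltey_eq fin_num_measure.
have iphi (m : {finite_measure set T -> \bar R}) : m.-integrable setT (EFin \o phi).
  by apply: measurable_bounded_integrable => //; rewrite ltey_eq fin_num_measure.
have mphi' : measurable_fun setT (EFin \o phi) by exact/measurable_EFinP.
rewrite (@charge_integralE _ (measure_add p n') (measure_add n p'))//.
- have e1 : (\int[measure_add p n']_x (phi x)%:E =
      \int[p]_x (phi x)%:E + \int[n']_x (phi x)%:E)%E.
    by apply: integral_measure_add => //; exact: iphi.
  have e2 : (\int[measure_add n p']_x (phi x)%:E =
      \int[n]_x (phi x)%:E + \int[p']_x (phi x)%:E)%E.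
    by apply: integral_measure_add => //; exact: iphi.
  have fi (m : {finite_measure set T -> \bar R}) : (\int[m]_x (phi x)%:E)%E \is a fin_num.
    exact: integrable_fin_num (iphi m).
  have fp : (\int[p]_x (phi x)%:E)%E \is a fin_num by exact: fi.
  have fn : (\int[n]_x (phi x)%:E)%E \is a fin_num by exact: fi.
  have fp' : (\int[p']_x (phi x)%:E)%E \is a fin_num by exact: fi.
  have fn' : (\int[n']_x (phi x)%:E)%E \is a fin_num by exact: fi.
  rewrite [X in (X - _)%E = _]e1 [X in (_ - X)%E = _]e2.
  rewrite -(fineK fp) -(fineK fn) -(fineK fp') -(fineK fn') -?EFinN -?EFinD -?EFinN -?EFinD.
  by congr EFin; ring.
- by rewrite [ltLHS]measure_addE lte_add_pinfty// fin.
- by rewrite [ltLHS]measure_addE lte_add_pinfty// fin.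
- move=> A mA; suff : (cadd nu (copp nu') A = (p A + n' A) - (n A + p' A))%E.
    by move=> h; rewrite [X in (X - _)%E]measure_addE [X in (_ - X)%E]measure_addE.
  have jA : nu A = (p A - n A)%E by exact: jE.
  have jA' : nu' A = (p' A - n' A)%E by exact: jE.
  rewrite (_ : cadd nu (copp nu') A = nu A - nu' A)%E// jA jA'.
  have pf : p A \is a fin_num by exact: fin_num_measure.
  have nf : n A \is a fin_num by exact: fin_num_measure.
  have pf' : p' A \is a fin_num by exact: fin_num_measure.
  have nf' : n' A \is a fin_num by exact: fin_num_measure.
  rewrite -(fineK pf) -(fineK nf) -(fineK pf') -(fineK nf') -?EFinN -?EFinD -?EFinN -?EFinD.
  by congr EFin; ring.
Qed.

(** Change of variables for a charge with a density, by the Radon-Nikodym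
    derivatives of its positive and negative parts. *)
Lemma charge_integral_induced (mu : {sigma_finite_measure set T -> \bar R})
    (g phi : T -> R) (ig : mu.-integrable setT (EFin \o g)) :
  measurable_fun setT phi -> [bounded phi x | x in setT] ->
  charge_integral (induced_charge ig) phi = (\int[mu]_x (g x * phi x)%:E)%E.
Proof.
move=> mphi bphi; rewrite /charge_integral.
set nu := induced_charge ig.
have numu : nu `<< mu.
  apply/null_content_dominatesP => A mA muA0; rewrite /nu /induced_charge.
  apply: null_set_integral => //.
  by apply: measurable_funTS; exact: (measurable_int mu).
set p := jordan_pos _; set n := jordan_neg _.
have pmu : p `<< mu by exact: jordan_pos_dominates.
have nmu : n `<< mu by exact: jordan_neg_dominates.
have iphi (m : {finite_measure set T -> \bar R}) : m.-integrable setT (EFin \o phi).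
  by apply: measurable_bounded_integrable => //; rewrite ltey_eq fin_num_measure.
have mphi' : measurable_fun setT (EFin \o phi) by exact/measurable_EFinP.
rewrite -(Radon_Nikodym_change_of_variables pmu measurableT (iphi p)).
rewrite -(Radon_Nikodym_change_of_variables nmu measurableT (iphi n)).
set hp := Radon_Nikodym _ _; set hn := Radon_Nikodym (charge_of_finite_measure n) _.
have ihp : mu.-integrable setT hp by exact: Radon_Nikodym_integrable.
have ihn : mu.-integrable setT hn by exact: Radon_Nikodym_integrable.
rewrite -integralB//; [|exact: integrableMr..].
have hg : ae_eq mu setT (hp \- hn)%E (EFin \o g).
  apply: integral_ae_eq => //.
  - exact: integrableB.
  - exact: (measurable_int mu).
  move=> A _ mA; rewrite integralB//; [|exact: (integrableS measurableT)..].
  rewrite -!Radon_Nikodym_integral//.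
  rewrite (_ : (\int[mu]_(x in A) (EFin \o g) x)%E = nu A)//.
  by rewrite [RHS](jordan_decomp (hahn_posnegP nu))// /cadd/= cscaleN1.
apply: ae_eq_integral => //.
- by apply: emeasurable_funB; apply: emeasurable_funM => //; exact: (measurable_int mu).
- apply/measurable_EFinP/measurable_funM => //.
  by apply/measurable_EFinP; exact: (measurable_int mu).
apply: filterS hg => x /= hx _; have {}hx := hx I.
have hpf : hp x \is a fin_num by exact: Radon_Nikodym_fin_num.
have hnf : hn x \is a fin_num by exact: Radon_Nikodym_fin_num.
by rewrite -muleBr ?fin_num_adde_defl ?fin_numN// hx -EFinM mulrC.
Qed.

End charge_integrals.

(** * Derivatives of functions of bounded variation *)

Section bounded_variation_theory.
Context {R : realType} {n : nat} (Omega : set 'rV[R]_n).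
Local Notation leb := (@lebesgue_rV R n).
Local Notation SI := (square_integrable leb Omega).
Local Notation sq := (sqnorm leb Omega).
Hypothesis open_Omega : open Omega.
Hypothesis finO : (leb Omega < +oo)%E.

Let mO : measurable Omega := open_measurable_rV open_Omega.

Implicit Types (u v f phi : 'rV[R]_n -> R) (w : 'rV[R]_n -> 'rV[R]_n)
  (D : 'I_n -> {charge set 'rV[R]_n -> \bar R}).

Lemma test_function_measurable phi : test_function Omega phi ->
  measurable_fun setT phi /\ [bounded phi x | x in setT].
Proof.
move=> /test_functionP[K [cK _ cphi phi0 _]]; split.
  exact: continuous_measurable_rV.
have : bounded_set (phi @` K).
  by apply: compact_bounded; apply: continuous_compact => //; exact: continuous_subspaceT.
move=> [M [Mr hM]]; exists (Num.max 0 M); split; first exact: num_real.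
move=> M'; rewrite gt_max => /andP[M'0 MM'] x _ /=.
have [Kx|Kx] := pselect (K x); last by rewrite phi0// normr0 ltW.
by apply: (hM _ MM'); exists x.
Qed.

Lemma bv_deriv_uniq f D D' : is_bv_deriv Omega f D -> is_bv_deriv Omega f D' ->
  forall i A, measurable A -> D i A = D' i A.
Proof.
move=> [cD eD] [cD' eD'] i A mA; rewrite cD// cD'//.
apply: (@charge_test_unique _ _ Omega) => //; last exact: measurableI.
by move=> phi ht; have := eD i _ ht; rewrite eD'// => /oppe_inj.
Qed.

Lemma bv_derivP f : BV Omega f -> is_bv_deriv Omega f (bv_deriv Omega f).
Proof.
move=> [_ ex]; rewrite /bv_deriv; case: pselect => // fD.
exact: (svalP (cid fD)).
Qed.

Lemma restrict_integrable u : SI u -> leb.-integrable setT (EFin \o (u \_ Omega)).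
Proof.
move=> su; rewrite -restrict_EFin; apply/(integrable_mkcond _ mO).
exact: square_integrable1.
Qed.

Lemma L1_L1loc u : leb.-integrable Omega (EFin \o u) -> L1loc Omega u.
Proof.
move=> iu; split; first by apply/measurable_EFinP; exact: (measurable_int leb).
move=> K cK KO; apply: (integrableS mO) => //; exact: compact_measurable_rV.
Qed.

Definition grad_charge w (sw : forall i, SI (fun t => w t ord0 i)) (i : 'I_n) :
    {charge set 'rV[R]_n -> \bar R} :=
  induced_charge (restrict_integrable (sw i)).

Lemma grad_chargeE w (sw : forall i, SI (fun t => w t ord0 i)) i A :
  grad_charge sw i A = (\int[leb]_(t in A `&` Omega) (w t ord0 i)%:E)%E.
Proof.
rewrite /grad_charge /= /induced_charge integral_mkcondr.
by apply: eq_integral => t _; rewrite restrict_EFin.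
Qed.

Lemma weak_grad_bv_deriv u w (sw : forall i, SI (fun t => w t ord0 i)) :
  is_weak_grad Omega u w -> is_bv_deriv Omega u (grad_charge sw).
Proof.
move=> [uL wL e]; split=> [i A mA|i phi ht]; first by rewrite !grad_chargeE -setIA setIid.
have [mphi bphi] := test_function_measurable ht.
rewrite e// charge_integral_induced//; congr (- _)%E.
rewrite [LHS]integral_mkcond; apply: eq_integral => t _.
by rewrite !patchE; case: ifPn => // _; rewrite mul0r.
Qed.

Lemma is_bv_derivB f u D D' : L1loc Omega f -> L1loc Omega u ->
  is_bv_deriv Omega f D -> is_bv_deriv Omega u D' ->
  is_bv_deriv Omega (fun t => f t - u t) (fun i => cadd (D i) (copp (D' i))).
Proof.
move=> fL uL [cD eD] [cD' eD']; split=> [i A mA|i phi ht].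
  have cE B : cadd (D i) (copp (D' i)) B = (D i B - D' i B)%E by [].
  by rewrite [LHS]cE [RHS]cE cD// cD'//.
have [mphi bphi] := test_function_measurable ht.
rewrite charge_integralB//.
have [_ /(_ i) i1] := test_integrable open_Omega fL ht.
have [_ /(_ i) i2] := test_integrable open_Omega uL ht.
under eq_integral do rewrite mulrBl.
have fa : charge_integral (D i) phi \is a fin_num.
  by rewrite -[charge_integral _ _]oppeK -eD// fin_numN; exact: integrable_fin_num.
have fb : charge_integral (D' i) phi \is a fin_num.
  by rewrite -[charge_integral _ _]oppeK -eD'// fin_numN; exact: integrable_fin_num.
rewrite integralB_EFin// eD// eD'// -(fineK fa) -(fineK fb).
by rewrite -?EFinN -?EFinD -?EFinN -?EFinD; congr EFin; ring.
Qed.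

Lemma sobolev_BV u w : SI u -> (forall i, SI (fun t => w t ord0 i)) ->
  is_weak_grad Omega u w -> BV Omega u.
Proof.
move=> su sw uw; split; first by apply/(Lp1P open_Omega); exact: square_integrable1.
by exists (grad_charge sw); exact: weak_grad_bv_deriv.
Qed.

(** A weak gradient in L^2 is also a derivative in the sense of measures, and
    such derivatives are unique. *)
Lemma bv_deriv_sub f u w (sw : forall i, SI (fun t => w t ord0 i)) :
  BV Omega f -> is_weak_grad Omega u w ->
  forall i A, measurable A ->
  bv_deriv Omega (fun t => f t - u t) i A =
  (bv_deriv Omega f i A - \int[leb]_(t in A `&` Omega) (w t ord0 i)%:E)%E.
Proof.
move=> fBV uw i A mA; have fD := bv_derivP fBV.
have fL : L1loc Omega f by apply: L1_L1loc; apply/(Lp1P open_Omega); have [] := fBV.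
have [uL _ _] := uw.
have fuD := is_bv_derivB fL uL fD (weak_grad_bv_deriv sw uw).
have h : is_bv_deriv Omega (fun t => f t - u t) (bv_deriv Omega (fun t => f t - u t)).
  by rewrite /bv_deriv; case: pselect => [ex|[]]; [exact: (svalP (cid ex)) | eexists; exact: fuD].
by rewrite (bv_deriv_uniq h fuD)// -grad_chargeE.
Qed.

Lemma ac_density_uniq (nu : {charge set 'rV[R]_n -> \bar R}) (g h : 'rV[R]_n -> R) :
  is_ac_density leb nu g -> is_ac_density leb nu h -> ae_eq leb setT g h.
Proof.
move=> [ig [N [mN N0] gE]] [ih [N' [mN' N'0] hE]].
have mNN : measurable (N `|` N') by exact: measurableU.
have NN0 : leb (N `|` N') = 0%E by rewrite null_set_setU//.
have : ae_eq leb (~` (N `|` N')) (EFin \o g) (EFin \o h).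
  apply: integral_ae_eq.
  - exact: measurableC.
  - by apply: (integrableS measurableT) => //; exact: measurableC.
  - by apply: measurable_funTS; exact: (measurable_int leb).
  move=> A AN mA; rewrite -gE// -?hE//.
    by apply/seteqP; split => // x [/AN + ?]; apply; right.
  by apply/seteqP; split => // x [/AN + ?]; apply; left.
have : leb.-negligible (N `|` N') by exists (N `|` N'); split.
move=> /negligibleU /[apply]; apply: negligibleS => x /= h1.
have [Nx|Nx] := pselect ((N `|` N') x); [by left | right => h2].
by apply: h1 => _; have [] := h2 Nx.
Qed.

Lemma is_ac_densityB (nu nu' : {charge set 'rV[R]_n -> \bar R}) (g h : 'rV[R]_n -> R) :
  leb.-integrable setT (EFin \o h) ->
  (forall A, measurable A -> nu' A = (nu A - \int[leb]_(t in A) (h t)%:E)%E) ->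
  is_ac_density leb nu g -> is_ac_density leb nu' (fun t => g t - h t).
Proof.
move=> ih nuE [ig [N mN gE]]; split.
  have := integrable_lincomb measurableT 1 (-1) ig ih.
  by under eq_fun do rewrite mul1r mulN1r.
exists N => // A mA AN; rewrite nuE// gE// integralB_EFin//; exact: (integrableS measurableT).
Qed.

Lemma ac_density_integrable (nu : {charge set 'rV[R]_n -> \bar R}) :
  leb.-integrable setT (EFin \o ac_density leb nu).
Proof.
rewrite /ac_density; case: xgetP => [g -> []//|_].
by rewrite (_ : _ \o _ = cst 0%E)//; exact: integrable0.
Qed.

(** If the charge has no Lebesgue decomposition then neither has its translate by a
    density, and both [ac_density] take the default value. *)
Lemma ac_density_sub (nu nu' : {charge set 'rV[R]_n -> \bar R}) (h : 'rV[R]_n -> R) :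
  leb.-integrable setT (EFin \o h) ->
  (forall A, measurable A -> nu' A = (nu A - \int[leb]_(t in A) (h t)%:E)%E) ->
  {ae leb, forall t, `|ac_density leb nu' t - ac_density leb nu t| <= `|h t|}.
Proof.
move=> ih nuE; rewrite /ac_density.
case: xgetP => [g' g'E hg'|ng']; case: xgetP => [g gE hg|ng].
- have := ac_density_uniq hg' (is_ac_densityB ih nuE hg); apply: filterS => t /= /(_ I) ->.
  by rewrite addrAC subrr sub0r normrN.
- exfalso; apply: (ng (fun t => g' t - - h t)).
  apply: (is_ac_densityB (nu := nu') (h := fun t => - h t)) => //.
    have := integrable_lincomb measurableT 0 (-1) ih ih.
    by under eq_fun do rewrite mul0r add0r mulN1r.
  move=> A mA; rewrite nuE//.
  have iA : leb.-integrable A (EFin \o h) by exact: (integrableS measurableT).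
  have f2 := integrable_fin_num mA iA.
  have -> : (\int[leb]_(t in A) (- h t)%:E = - \int[leb]_(t in A) (h t)%:E)%E.
    under eq_integral do rewrite -mulN1r EFinM.
    by rewrite integralZl// EFinN mulN1e.
  by rewrite oppeK subeK.
- by exfalso; apply: (ng' (fun t => g t - h t)); exact: is_ac_densityB hg.
- by apply: nearW => t; rewrite subrr normr0.
Qed.

End bounded_variation_theory.

(** * The gradient cost *)

Section almost_everywhere.
Context d (T : measurableType d) {R : realType}.
Variables (mu : {measure set T -> \bar R}) (D : set T).
Hypothesis mD : measurable D.
Implicit Types f g : T -> R.

Lemma Rintegral_ae f g : measurable_fun D f -> measurable_fun D g ->
  ae_eq mu D f g -> \int[mu]_(t in D) f t = \int[mu]_(t in D) g t.
Proof.
move=> mf mg fg; congr fine; apply: ae_eq_integral => //.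
- exact/measurable_EFinP.
- exact/measurable_EFinP.
- by apply: filterS fg => t /= h Dt; rewrite h.
Qed.

Lemma ae_eq_integrable f g : measurable_fun D g -> ae_eq mu D f g ->
  mu.-integrable D (EFin \o f) -> mu.-integrable D (EFin \o g).
Proof.
move=> mg fg /integrableP[/measurable_EFinP mf fi]; apply/integrableP; split.
  exact/measurable_EFinP.
rewrite (_ : (\int[mu]_(t in D) _)%E = (\int[mu]_(t in D) `|(f t)%:E|)%E)//.
apply: ae_eq_integral => //.
- by apply/measurable_EFinP; exact: measurableT_comp.
- by apply/measurable_EFinP; exact: measurableT_comp.
- by apply: filterS fg => t /= h Dt; rewrite h.
Qed.

Lemma square_integrable_ae f g : measurable_fun D g -> ae_eq mu D f g ->
  square_integrable mu D f -> square_integrable mu D g.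
Proof.
move=> mg fg [mf fi]; split => //; apply: ae_eq_integrable fi; first exact: measurable_funX.
by apply: filterS fg => t /= h Dt; rewrite h.
Qed.

Lemma sqnorm_ae f g : measurable_fun D f -> measurable_fun D g ->
  ae_eq mu D f g -> sqnorm mu D f = sqnorm mu D g.
Proof.
move=> mf mg fg; apply: Rintegral_ae; [exact: measurable_funX..|].
by apply: filterS fg => t /= h Dt; rewrite h.
Qed.

End almost_everywhere.

Section fidelity.
Context {R : realType} {n : nat} (Omega : set 'rV[R]_n).
Local Notation leb := (@lebesgue_rV R n).
Local Notation SI := (square_integrable leb Omega).
Local Notation sq := (sqnorm leb Omega).
Hypothesis open_Omega : open Omega.
Hypothesis finO : (leb Omega < +oo)%E.

Let mO : measurable Omega := open_measurable_rV open_Omega.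

Implicit Types (x y : scalar_pair (R := R) (n := n)) (u : 'rV[R]_n -> R).

Lemma sqr_sum_le I (s : seq I) (a : I -> R) :
  \sum_(i <- s) a i ^+ 2 <= (\sum_(i <- s) `|a i|) ^+ 2.
Proof.
elim: s => [|i s IH]; first by rewrite !big_nil expr0n.
rewrite !big_cons sqrrD real_normK ?num_real// -addrA lerD2l.
apply: le_trans IH _; rewrite lerDr mulrn_wge0// mulr_ge0// sumr_ge0//.
Qed.

Lemma l2norm_row_le (a : 'rV[R]_n) : l2norm a <= \sum_i `|a ord0 i|.
Proof.
rewrite -(@ler_pXn2r _ 2%N)// ?nnegrE ?l2norm_ge0 ?sumr_ge0//.
by rewrite l2norm_sqr big_ord1; exact: sqr_sum_le.
Qed.

Lemma l2norm_row_mono (a b : 'rV[R]_n) : (forall i, `|a ord0 i| <= `|b ord0 i|) ->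
  l2norm a <= l2norm b.
Proof.
move=> ab; rewrite -(@ler_pXn2r _ 2%N)// ?nnegrE ?l2norm_ge0//.
rewrite !l2norm_sqr !big_ord1; apply: ler_sum => i _.
by rewrite -(real_normK (num_real (a _ _))) -(real_normK (num_real (b _ _))) lerXn2r ?nnegrE.
Qed.

Context (gamma : R) (gamma_gt0 : 0 < gamma) (f0 : 'rV[R]_n -> R).

Definition grad_cost x : R :=
  \int[leb]_(t in Omega) huber gamma (ac_grad Omega (fun s => f0 s - x.1 s) t).

Lemma ac_grad_measurable u i j :
  measurable_fun Omega (fun t => ac_grad Omega u t i j).
Proof.
under eq_fun do rewrite mxE.
apply: (@measurable_funTS _ _ _ _ Omega (ac_density leb (bv_deriv Omega u j))).
by apply/measurable_EFinP; exact: (measurable_int leb (ac_density_integrable _)).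
Qed.

Lemma huber_ac_grad_integrable u :
  leb.-integrable Omega (EFin \o (fun t => huber gamma (ac_grad Omega u t))).
Proof.
apply: (@integrable_le_norm _ _ _ _ Omega mO _
    (fun t => \sum_i `|ac_density leb (bv_deriv Omega u i) t|)).
- by apply: huber_measurable => // i j; exact: ac_grad_measurable.
- apply: integrable_sum_real => // i; apply: integrable_norm => //.
  by apply: (integrableS measurableT) => //; exact: ac_density_integrable.
- move=> t _; rewrite ger0_norm ?huber_ge0//.
  apply: le_trans (huber_le_l2norm gamma_gt0 _) _.
  by apply: le_trans (l2norm_row_le _) _; apply: ler_sum => i _; rewrite mxE.
Qed.

Hypothesis f0_BV : BV Omega f0.

(** By [bv_deriv_sub] the two derivatives differ by the charge with density
    [x.2 - y.2] on the domain, and [ac_density_sub] applies to each component. *)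
Lemma ac_grad_sub_ae x y : sobolev_pair Omega x -> sobolev_pair Omega y ->
  {ae leb, forall t, Omega t ->
    l2norm (ac_grad Omega (fun s => f0 s - x.1 s) t - ac_grad Omega (fun s => f0 s - y.1 s) t)
    <= l2norm (y.2 t - x.2 t)}.
Proof.
move=> [_ sx wx] [_ sy wy].
have h i : {ae leb, forall t,
    `|ac_density leb (bv_deriv Omega (fun s => f0 s - x.1 s) i) t -
      ac_density leb (bv_deriv Omega (fun s => f0 s - y.1 s) i) t| <=
    `|((fun t => x.2 t ord0 i - y.2 t ord0 i) \_ Omega) t| }.
  have sd := square_integrableB mO (sx i) (sy i).
  apply: ac_density_sub; first exact: restrict_integrable.
  move=> A mA; rewrite (bv_deriv_sub open_Omega finO sx)// (bv_deriv_sub open_Omega finO sy)//.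
  have mAO : measurable (A `&` Omega) by exact: measurableI.
  have -> : (\int[leb]_(t in A) (((fun s => x.2 s ord0 i - y.2 s ord0 i) \_ Omega) t)%:E =
      \int[leb]_(t in A `&` Omega) (x.2 t ord0 i - y.2 t ord0 i)%:E)%E.
    rewrite [RHS]integral_mkcondr; apply: eq_integral => t _.
    by rewrite restrict_EFin.
  have ix : leb.-integrable (A `&` Omega) (EFin \o (fun t => x.2 t ord0 i)).
    by apply: (integrableS mO) => //; exact: square_integrable1.
  have iy : leb.-integrable (A `&` Omega) (EFin \o (fun t => y.2 t ord0 i)).
    by apply: (integrableS mO) => //; exact: square_integrable1.
  rewrite integralB_EFin//.
  have fb : bv_deriv Omega f0 i A \is a fin_num by exact: fin_num_measure.
  have fx := integrable_fin_num mAO ix; have fy := integrable_fin_num mAO iy.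
  rewrite -(fineK fb) -(fineK fx) -(fineK fy) -?EFinN -?EFinD -?EFinN -?EFinD.
  by congr EFin; ring.
have : {ae leb, forall t i, `|ac_density leb (bv_deriv Omega (fun s => f0 s - x.1 s) i) t -
      ac_density leb (bv_deriv Omega (fun s => f0 s - y.1 s) i) t| <=
    `|((fun t => x.2 t ord0 i - y.2 t ord0 i) \_ Omega) t| }.
  exact: filter_forall.
apply: filterS => t /= ht Ot; apply: l2norm_row_mono => i; rewrite !mxE.
by apply: le_trans (ht i) _; rewrite patchE mem_set// distrC.
Qed.

Lemma grad_cost_lsc x y (t : R) : 0 < t -> sobolev_pair Omega x -> sobolev_pair Omega y ->
  grad_cost x <= grad_cost y +
    (t * fine (leb Omega) + sq (fun s => l2norm (y.2 s - x.2 s)) / t).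
Proof.
move=> t0 sx sy.
have ix := huber_ac_grad_integrable (fun s => f0 s - x.1 s).
have iy := huber_ac_grad_integrable (fun s => f0 s - y.1 s).
have [_ sx2 _] := sx; have [_ sy2 _] := sy.
have sd : forall i j, SI (fun s => (y.2 s - x.2 s) i j).
  move=> i j; rewrite (ord1 i); have := square_integrableB mO (sy2 j) (sx2 j).
  by congr SI; apply/funext => s; rewrite !mxE.
have sl := l2norm_square_integrable open_Omega sd.
have il := square_integrable1 mO finO sl.
have h := Rintegral_norm_le mO finO t0 sl.
apply: le_trans (_ : grad_cost y + \int[leb]_(s in Omega) l2norm (y.2 s - x.2 s) <= _); last first.
  rewrite lerD2l; apply: le_trans h; rewrite le_eqVlt; apply/orP; left; apply/eqP.
  by apply: eq_Rintegral => s _; rewrite ger0_norm ?l2norm_ge0.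
rewrite /grad_cost -RintegralD//.
have isum : leb.-integrable Omega (EFin \o (fun s =>
    huber gamma (ac_grad Omega (fun s => f0 s - y.1 s) s) + l2norm (y.2 s - x.2 s))).
  by have := integrable_lincomb mO 1 1 iy il; under eq_fun do rewrite !mul1r.
rewrite /Rintegral.
apply: fine_le; [exact: (integrable_fin_num mO ix)|exact: (integrable_fin_num mO isum)|].
apply: ae_ge0_le_integral => //.
- by move=> s _; rewrite lee_fin huber_ge0.
- exact: (measurable_int leb ix).
- by move=> s _; rewrite lee_fin addr_ge0 ?huber_ge0 ?l2norm_ge0.
- exact: (measurable_int leb isum).
- have := ac_grad_sub_ae sx sy; apply: filterS => s hs Os; rewrite /= lee_fin.
  apply: le_trans (huber_lipschitz gamma_gt0 _ (ac_grad Omega (fun r => f0 r - y.1 r) s)) _.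
  by rewrite lerD2l; exact: hs.
Qed.

End fidelity.

(** * Independence of the energy from the chosen weak gradients *)

Section conversions.
Context {R : realType} {n : nat} (Omega : set 'rV[R]_n).
Local Notation leb := (@lebesgue_rV R n).
Local Notation SI := (square_integrable leb Omega).
Local Notation sq := (sqnorm leb Omega).
Hypothesis open_Omega : open Omega.
Hypothesis finO : (leb Omega < +oo)%E.

Let mO : measurable Omega := open_measurable_rV open_Omega.

Implicit Types (x y : scalar_pair (R := R) (n := n)) (v w : vector_pair (R := R) (n := n))
  (u : 'rV[R]_n -> R).

Lemma gradP u g : is_weak_grad Omega u g -> is_weak_grad Omega u (grad Omega u).
Proof. by move=> ug; apply: xgetPex; exists g. Qed.

Lemma weak_grad_SI u g g' : is_weak_grad Omega u g -> is_weak_grad Omega u g' ->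
  (forall i, SI (fun t => g t ord0 i)) -> forall i, SI (fun t => g' t ord0 i).
Proof.
move=> ug ug' sg i; apply: (square_integrable_ae mO _ _ (sg i)).
  by have [_ /(_ i)[]] := ug'.
exact: (weak_grad_uniq open_Omega ug ug').
Qed.

Lemma weak_grad_ae u u' g : is_weak_grad Omega u g -> L1loc Omega u' ->
  ae_eq leb Omega u u' -> is_weak_grad Omega u' g.
Proof.
move=> /(weak_gradP open_Omega)[uL gL e] u'L uu'; apply/(weak_gradP open_Omega); split => // i phi ht.
rewrite -e//; apply: Rintegral_ae => //.
- have [_ /(_ i)] := test_integrable open_Omega u'L ht.
  by move=> /(measurable_int leb) /measurable_EFinP.
- have [_ /(_ i)] := test_integrable open_Omega uL ht.
  by move=> /(measurable_int leb) /measurable_EFinP.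
- by apply: filterS uu' => t /= h Ot; rewrite h.
Qed.

Lemma H1_pair u : H1 Omega u -> sobolev_pair Omega (u, grad Omega u).
Proof.
move=> [/(Lp2P open_Omega) su [g ug sg]]; split => //=; last exact: gradP ug.
apply: (weak_grad_SI ug (gradP ug)) => i; exact/(Lp2P open_Omega)/sg.
Qed.

Lemma pair_H1 x : sobolev_pair Omega x -> H1 Omega x.1.
Proof.
move=> [sx1 sx2 wx]; split; first exact/(Lp2P open_Omega).
by exists x.2 => // i; exact/(Lp2P open_Omega).
Qed.

Lemma row_pair_jac (w : 'rV[R]_n -> 'rV[R]_n) i :
  row_pair i ((w, jac Omega w) : vector_pair) =
  ((fun t => w t ord0 i), grad Omega (fun t => w t ord0 i)).
Proof.
rewrite /row_pair /=; congr pair; apply/funext => t.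
by apply/rowP => j; rewrite !mxE.
Qed.

Lemma vH1_vpair (w : 'rV[R]_n -> 'rV[R]_n) : vH1 Omega w -> sobolev_vpair Omega (w, jac Omega w).
Proof. by move=> wH i; rewrite row_pair_jac; exact: H1_pair. Qed.

Lemma vpair_vH1 v : sobolev_vpair Omega v -> vH1 Omega v.1.
Proof. by move=> sv i; exact: pair_H1 (sv i). Qed.

Lemma H1_sqnormE u : H1 Omega u -> H1_sqnorm Omega u = (pair_sqnorm Omega (u, grad Omega u))%:E.
Proof.
move=> uH; have sp := H1_pair uH; rewrite (pair_sqnormE open_Omega sp) EFinD.
have [[_ i1] sg _] := sp.
have [_ i2] : SI (fun t => l2norm (grad Omega u t)).
  by apply: (l2norm_square_integrable open_Omega) => i j; rewrite (ord1 i).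
by rewrite /H1_sqnorm /L2_sqnorm /sqnorm /Rintegral !fineK//; exact: integrable_fin_num.
Qed.

Lemma vH1_sqnormE (w : 'rV[R]_n -> 'rV[R]_n) : vH1 Omega w ->
  vH1_sqnorm Omega w = (vpair_sqnorm Omega (w, jac Omega w))%:E.
Proof.
move=> wH; rewrite /vH1_sqnorm /vpair_sqnorm -sumEFin; apply: eq_bigr => i _.
by rewrite row_pair_jac H1_sqnormE.
Qed.

Context (gamma mu : R) (gamma_gt0 : 0 < gamma).

Lemma huber_integralE m k (A : 'rV[R]_n -> 'M[R]_(m, k)) (a : R) :
  (forall i j, SI (fun t => A t i j)) ->
  (\int[leb]_(t in Omega) (a * huber gamma (A t))%:E)%E =
  (a * huber_integral Omega gamma A)%:E.
Proof.
move=> sA; have ih := huber_integrable open_Omega finO gamma_gt0 sA.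
under eq_integral do rewrite EFinM.
rewrite integralZl// EFinM /huber_integral /Rintegral fineK//.
exact: integrable_fin_num.
Qed.

Lemma huber_integral_ae m k (A B : 'rV[R]_n -> 'M[R]_(m, k)) :
  (forall i j, SI (fun t => A t i j)) -> (forall i j, SI (fun t => B t i j)) ->
  ae_eq leb Omega A B -> huber_integral Omega gamma A = huber_integral Omega gamma B.
Proof.
move=> sA sB AB; apply: Rintegral_ae => //.
- by apply: huber_measurable => // i j; have [] := sA i j.
- by apply: huber_measurable => // i j; have [] := sB i j.
- by apply: filterS AB => t /= h Ot; rewrite h.
Qed.

Lemma pair_sqnorm_ae x y : sobolev_pair Omega x -> sobolev_pair Omega y ->
  ae_eq leb Omega x.1 y.1 -> ae_eq leb Omega x.2 y.2 ->
  pair_sqnorm Omega x = pair_sqnorm Omega y.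
Proof.
move=> [sx1 sx2 _] [sy1 sy2 _] e1 e2; rewrite /pair_sqnorm; congr (_ + _).
  by apply: sqnorm_ae => //; [exact: sx1.1 | exact: sy1.1].
apply: eq_bigr => i _; apply: sqnorm_ae => //; [exact: (sx2 i).1 | exact: (sy2 i).1 |].
by apply: filterS e2 => t /= h Ot; rewrite h.
Qed.

Lemma sobolev_pair_ae2 x y : sobolev_pair Omega x -> sobolev_pair Omega y ->
  ae_eq leb Omega x.1 y.1 -> ae_eq leb Omega x.2 y.2.
Proof.
move=> [_ _ wx] [sy1 _ wy] e1.
have wx' : is_weak_grad Omega y.1 x.2.
  by apply: weak_grad_ae wx _ e1; exact: square_integrable_L1loc.
have : {ae leb, forall t i, Omega t -> x.2 t ord0 i = y.2 t ord0 i}.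
  by apply: filter_forall => i; exact: (weak_grad_uniq open_Omega wx' wy).
by apply: filterS => t /= h Ot; apply/rowP => i; exact: h.
Qed.

Lemma sobolev_vpair_ae2 v w : sobolev_vpair Omega v -> sobolev_vpair Omega w ->
  ae_eq leb Omega v.1 w.1 -> ae_eq leb Omega v.2 w.2.
Proof.
move=> sv sw e1.
have : {ae leb, forall t i, Omega t -> row i (v.2 t) = row i (w.2 t)}.
  apply: filter_forall => i; apply: (sobolev_pair_ae2 (sv i) (sw i)).
  by apply: filterS e1 => t /= h Ot; rewrite h.
by apply: filterS => t /= h Ot; apply/row_matrixP => i; exact: h.
Qed.

Context (L : 'M[R]_n -> 'M[R]_n).
Hypothesis L_square_integrable : forall A : 'rV[R]_n -> 'M[R]_n,
  (forall i j, SI (fun t => A t i j)) -> forall i j, SI (fun t => L (A t) i j).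

(** The weak derivatives are determined up to null sets by the functions, so the
    energy depends on the functions only. *)
Lemma regulariser_energy_ae p x y v w :
  sobolev_pair Omega x -> sobolev_pair Omega y ->
  sobolev_vpair Omega v -> sobolev_vpair Omega w ->
  ae_eq leb Omega x.1 y.1 -> ae_eq leb Omega v.1 w.1 ->
  regulariser_energy Omega gamma mu L p x v = regulariser_energy Omega gamma mu L p y w.
Proof.
move=> sx sy sv sw xy vw; have xy2 := sobolev_pair_ae2 sx sy xy.
have vw2 := sobolev_vpair_ae2 sv sw vw.
have e1 : huber_integral Omega gamma (fun t => x.2 t - v.1 t) =
    huber_integral Omega gamma (fun t => y.2 t - w.1 t).
  apply: huber_integral_ae; [exact: (first_order_SI open_Omega sx sv)
                            |exact: (first_order_SI open_Omega sy sw)|].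
  by apply: filterS2 xy2 vw => t /= h1 h2 Ot; rewrite h1// h2.
have e2 : huber_integral Omega gamma (fun t => L (v.2 t)) =
    huber_integral Omega gamma (fun t => L (w.2 t)).
  apply: huber_integral_ae; [exact: (L_square_integrable (second_order_SI sv))
                            |exact: (L_square_integrable (second_order_SI sw))|].
  by apply: filterS vw2 => t /= h Ot; rewrite h.
have e3 : vpair_sqnorm Omega v = vpair_sqnorm Omega w.
  apply: eq_bigr => i _; apply: (pair_sqnorm_ae (sv i) (sw i)).
    by apply: filterS vw => t /= h Ot; rewrite h.
  by apply: filterS vw2 => t /= h Ot; rewrite h.
by rewrite /regulariser_energy e1 e2 e3 (pair_sqnorm_ae sx sy xy xy2).
Qed.

Lemma regulariser_energyE (a b : R) u (w : 'rV[R]_n -> 'rV[R]_n) : H1 Omega u -> vH1 Omega w ->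
  (\int[leb]_(t in Omega) (a * huber gamma (grad Omega u t - w t))%:E +
   \int[leb]_(t in Omega) (b * huber gamma (L (jac Omega w t)))%:E +
   (mu / 2)%:E * (H1_sqnorm Omega u + vH1_sqnorm Omega w))%E =
  (regulariser_energy Omega gamma mu L (a, b) (u, grad Omega u) (w, jac Omega w))%:E.
Proof.
move=> uH wH; have sx := H1_pair uH; have sv := vH1_vpair wH.
rewrite H1_sqnormE// vH1_sqnormE// huber_integralE; last exact: (first_order_SI open_Omega sx sv).
rewrite huber_integralE; last exact/L_square_integrable/(second_order_SI sv).
by rewrite -!EFinD.
Qed.

End conversions.

(** * The learning problem for an abstract regulariser *)

Section learning_problem.
Context {R : realType} {n : nat} (Omega : set 'rV[R]_n).
Local Notation leb := (@lebesgue_rV R n).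
Local Notation SI := (square_integrable leb Omega).
Local Notation sq := (sqnorm leb Omega).
Hypothesis open_Omega : open Omega.
Hypothesis finO : (leb Omega < +oo)%E.

Let mO : measurable Omega := open_measurable_rV open_Omega.

Context (gamma mu : R) (gamma_gt0 : 0 < gamma) (mu_gt0 : 0 < mu).
Context (L : 'M[R]_n -> 'M[R]_n) (W : set (vector_pair (R := R) (n := n))).
Hypothesis L_midpoint : forall A B, L (2^-1 *: (A + B)) = 2^-1 *: (L A + L B).
Hypothesis L_contract : forall A, l2norm (L A) <= l2norm A.
Hypothesis L_square_integrable : forall A : 'rV[R]_n -> 'M[R]_n,
  (forall i j, SI (fun t => A t i j)) -> forall i j, SI (fun t => L (A t) i j).
Hypothesis W_sub : W `<=` sobolev_vpair Omega.
Hypothesis W_midpoint : forall v w, W v -> W w -> W (2^-1 *: (v + w)).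
Hypothesis W_nonempty : W !=set0.
Context (f : 'rV[R]_n -> R) (f_SI : SI f).

Local Notation energy := (total_energy Omega gamma mu L f).
Local Notation J := (reduced W energy).

Lemma zero_pair : sobolev_pair Omega 0.
Proof.
have s0 : SI (cst 0) by exact: square_integrable_cst.
split => [//|i|].
  by rewrite (_ : (fun t => _) = cst 0)//; apply/funext => t; rewrite mxE.
apply/(weak_gradP open_Omega); split => [|i|i phi ht].
- exact: square_integrable_L1loc.
- rewrite (_ : (fun t => _) = cst 0); first exact: square_integrable_L1loc.
  by apply/funext => t; rewrite mxE.
- under eq_Rintegral do rewrite mul0r.
  under [in RHS]eq_Rintegral do rewrite mxE mul0r.
  by rewrite Rintegral_cst// mul0r oppr0.
Qed.

Lemma energy_has_lbound p x : 0 <= p.1 -> 0 <= p.2 ->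
  has_inf [set regulariser_energy Omega gamma mu L p x v | v in W].
Proof.
move=> p1 p2; split.
  by have [v Wv] := W_nonempty; exists (regulariser_energy Omega gamma mu L p x v), v.
exists (- (2^-1 * sq (fun t => x.1 t - f t))) => _ [v Wv <-].
rewrite lerNl -subr_ge0 opprK.
exact: (total_energy_ge0 Omega gamma_gt0 mu_gt0 L f x v p1 p2).
Qed.

Lemma denoising_energyE (Reg : ('rV[R]_n -> R) -> \bar R) p u :
  0 <= p.1 -> 0 <= p.2 -> H1 Omega u ->
  Reg u = ereal_inf
    [set (regulariser_energy Omega gamma mu L p (u, grad Omega u) v)%:E | v in W] ->
  denoising_energy Omega Reg f u = (J p (u, grad Omega u))%:E.
Proof.
move=> p1 p2 uH RE; have [ne lb] := energy_has_lbound (u, grad Omega u) p1 p2.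
rewrite /denoising_energy RE.
rewrite -(image_comp (regulariser_energy Omega gamma mu L p (u, grad Omega u)) EFin).
rewrite ereal_inf_EFin//.
have [su1 _ _] := H1_pair open_Omega uH.
have [_ i1] := square_integrableB mO su1 f_SI.
have -> : L2_sqnorm Omega (fun t => u t - f t) = (sq (fun t => u t - f t))%:E.
  by rewrite /L2_sqnorm /sqnorm /Rintegral fineK//; exact: integrable_fin_num.
rewrite -EFinM -EFinD; congr EFin; rewrite /reduced.
set c := 2^-1 * _; set S := (X in inf X); apply/eqP; rewrite eq_le; apply/andP; split.
  apply: lb_le_inf => [|_ [v Wv <-]].
    by have [v Wv] := W_nonempty; exists (energy p (u, grad Omega u) v), v.
  by rewrite lerD2l; apply: ge_inf => //; exists v.
rewrite -lerBlDl; apply: lb_le_inf => // _ [v Wv <-]; rewrite lerBlDl.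
apply: ge_inf; last by exists v.
by exists 0 => _ [v' _ <-]; exact: (total_energy_ge0 Omega gamma_gt0 mu_gt0 L f _ v' p1 p2).
Qed.

Lemma reduced_ext p x y : sobolev_pair Omega x -> sobolev_pair Omega y -> x.1 = y.1 ->
  J p x = J p y.
Proof.
move=> sx sy xy; rewrite /reduced; congr inf; apply: eq_imagel => v Wv.
rewrite /total_energy xy; congr (_ + _).
have sv := W_sub Wv.
apply: (regulariser_energy_ae open_Omega finO _ _ L_square_integrable) => //.
- by rewrite xy; exact: nearW.
- exact: nearW.
Qed.

Context (abar bbar : R) (abar_ge0 : 0 <= abar) (bbar_ge0 : 0 <= bbar).
Context (Reg : R -> R -> ('rV[R]_n -> R) -> \bar R).
Hypothesis RegE : forall p u, 0 <= p.1 -> 0 <= p.2 -> H1 Omega u -> Reg p.1 p.2 u = ereal_inf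
    [set (regulariser_energy Omega gamma mu L p (u, grad Omega u) v)%:E | v in W].
Context (F : ('rV[R]_n -> R) -> \bar R) (G : scalar_pair (R := R) (n := n) -> R) (c : \bar R).
Hypothesis FE : forall x, sobolev_pair Omega x -> F x.1 = ((G x)%:E + c)%E.
Hypothesis G_ge0 : forall x, sobolev_pair Omega x -> 0 <= G x.
Hypothesis G_lsc : forall x, sobolev_pair Omega x -> exists2 C : R, 0 <= C &
  forall (t : R) y, 0 < t <= 1 -> sobolev_pair Omega y ->
    G x <= G y + C * (t + pair_sqnorm Omega (y - x) / t).

Theorem learning_optimal_exists :
  exists alpha beta, learning_optimal Omega Reg F f abar bbar alpha beta.
Proof.
pose K : set (R * R) := `[0, abar]%classic `*` `[0, bbar]%classic.
have KE p : K p -> [/\ 0 <= p.1, 0 <= p.2, p.1 <= abar & p.2 <= bbar].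
  by case=> /=; rewrite !in_itv/= => /andP[? ?] /andP[? ?].
have EK (a b : R) : 0 <= a <= abar -> 0 <= b <= bbar -> K (a, b).
  by move=> ha hb; split; rewrite /= in_itv.
have [w0 Ww0] := W_nonempty.
have energyE p x : K p -> sobolev_pair Omega x ->
    denoising_energy Omega (Reg p.1 p.2) f x.1 = (J p x)%:E.
  move=> Kp sx; have [p1 p2 _ _] := KE _ Kp; have xH := pair_H1 open_Omega sx.
  rewrite (denoising_energyE p1 p2 xH (RegE p1 p2 xH)); congr EFin.
  by apply: reduced_ext => //; exact: H1_pair.
have argminE p x : K p -> sobolev_pair Omega x ->
    denoising_argmin Omega (Reg p.1 p.2) f x.1 <-> reduced_min (sobolev_pair Omega) W energy p x.
  move=> Kp sx; split=> [[xH xmin]|[_ xmin]]; split => //.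
  - move=> y sy; rewrite -lee_fin -!energyE//; apply: xmin.
    exact: (pair_H1 open_Omega).
  - exact: (pair_H1 open_Omega).
  - move=> v vH; have sv := H1_pair open_Omega vH.
    by rewrite (energyE _ _ Kp sx) (energyE _ (v, grad Omega v) Kp sv) lee_fin; exact: xmin.
have [||||||||||||||p Kp [x xmin xopt]] := @bilevel_min_exists R
    (scalar_pair (R := R) (n := n)) (vector_pair (R := R) (n := n))
    (sobolev_pair Omega) W (pair_sqnorm Omega) energy
  K G (mu / 8) (4 * gamma / mu) (2^-1 * sq (fun t => (0 : scalar_pair).1 t - f t) +
    (abar * huber_integral Omega gamma (fun t => (0 : scalar_pair).2 t - w0.1 t) +
     bbar * huber_integral Omega gamma (fun t => L (w0.2 t)) +
     mu / 2 * (pair_sqnorm Omega (0 : scalar_pair) + vpair_sqnorm Omega w0))) 0 w0 _ _ zero_pair Ww0.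
- by rewrite divr_gt0.
- by rewrite divr_ge0 ?(ltW mu_gt0)// mulr_ge0// ltW.
- by move=> x y; exact: sobolev_pair_midpoint.
- exact: W_midpoint.
- by move=> p x w /KE[p1 p2 _ _] _ _; exact: total_energy_ge0.
- move=> p x y v w /KE[p1 p2 _ _] sx sy /W_sub sv /W_sub sw.
  exact: (total_energy_convex open_Omega finO gamma_gt0 mu_gt0 L_midpoint L_square_integrable f_SI p1 p2 sx sy sv sw).
- move=> p x /KE[p1 p2 _ _] sx.
  have [C C0 h] := total_energy_lsc open_Omega finO gamma_gt0 mu_gt0 L f_SI p1 p2 sx.
  by exists C => // t y w t01 sy /W_sub sw; exact: h.
- move=> p /KE[p1 p2 pa pb]; rewrite /total_energy /regulariser_energy.
  by rewrite lerD2l lerD2r lerD// ler_wpM2r// huber_integral_ge0.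
- move=> p p' x w /KE[p1 p2 _ _] _ sx /W_sub sw.
  exact: (total_energy_param open_Omega finO gamma_gt0 mu_gt0 L_contract L_square_integrable).
- by move=> x C; exact: sobolev_pair_complete.
- by apply: compact_setX; exact: segment_compact.
- by exists (0, 0); apply: EK; rewrite lexx.
- exact: G_ge0.
- exact: G_lsc.
have [p1 p2 pa pb] := KE _ Kp; have [sx _] := xmin.
exists p.1, p.2; exists x.1.
  by split; [rewrite p1 | rewrite p2 | exact/argminE].
move=> a b u [ha hb [uH umin]].
have su := H1_pair open_Omega uH.
rewrite FE// (FE su) leeD2r// lee_fin.
by apply: (xopt (a, b)); [exact: EK | exact/(argminE (a, b) (u, grad Omega u) (EK _ _ ha hb) su)].
Qed.

End learning_problem.

(** * The two regularisers and the two costs *)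

Section regularisers_and_costs.
Context {R : realType} {n : nat} (Omega : set 'rV[R]_n).
Local Notation leb := (@lebesgue_rV R n).
Local Notation SI := (square_integrable leb Omega).
Local Notation sq := (sqnorm leb Omega).
Hypothesis open_Omega : open Omega.
Hypothesis finO : (leb Omega < +oo)%E.

Let mO : measurable Omega := open_measurable_rV open_Omega.

Implicit Types (x y : scalar_pair (R := R) (n := n)) (v w : vector_pair (R := R) (n := n)).

Definition sym_part (A : 'M[R]_n) : 'M[R]_n := 2^-1 *: (A + A^T).

Lemma sym_part_midpoint A B :
  sym_part (2^-1 *: (A + B)) = 2^-1 *: (sym_part A + sym_part B).
Proof. by apply/matrixP => i j; rewrite !mxE; ring. Qed.

Lemma sym_part_SI (A : 'rV[R]_n -> 'M[R]_n) : (forall i j, SI (fun t => A t i j)) ->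
  forall i j, SI (fun t => sym_part (A t) i j).
Proof.
move=> sA i j; have := square_integrable_lincomb mO 2^-1 2^-1 (sA i j) (sA j i).
by congr SI; apply/funext => t; rewrite !mxE mulrDr.
Qed.

Lemma weak_grad_nearW (v w : 'rV[R]_n -> 'rV[R]_n) :
  (forall i, ae_eq leb Omega (fun t => v t ord0 i) (fun t => w t ord0 i)) ->
  ae_eq leb Omega v w.
Proof.
move=> h; have : {ae leb, forall t i, Omega t -> v t ord0 i = w t ord0 i}.
  exact: filter_forall.
by apply: filterS => t /= ht Ot; apply/rowP => i; exact: ht.
Qed.

(** Only the gradient of a competitor enters the ICTV energy, so competitors are
    recorded by their gradient together with its weak Jacobian. *)
Definition ictv_fields : set (vector_pair (R := R) (n := n)) :=
  [set v | sobolev_vpair Omega v /\ exists2 z, Lp Omega 1%E z & is_weak_grad Omega z v.1].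

Lemma ictv_fields_midpoint v w : ictv_fields v -> ictv_fields w ->
  ictv_fields (2^-1 *: (v + w)).
Proof.
move=> [sv [z1 /(Lp1P open_Omega) iz1 g1]] [sw [z2 /(Lp1P open_Omega) iz2 g2]].
split; first exact: sobolev_vpair_midpoint.
exists (fun t => 2^-1 * z1 t + 2^-1 * z2 t).
  by apply/(Lp1P open_Omega); exact: integrable_lincomb.
have := weak_grad_lincomb open_Omega 2^-1 2^-1 g1 g2.
rewrite (_ : (fun t => 2^-1 *: v.1 t + 2^-1 *: w.1 t) = (2^-1 *: (v + w)).1)//.
by apply/funext => t; rewrite -scalerDr.
Qed.

Lemma zero_vpair : sobolev_vpair Omega 0.
Proof.
move=> i; rewrite (_ : row_pair i 0 = 0); first exact: zero_pair.
rewrite /row_pair; congr pair; apply/funext => t; first by rewrite mxE.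
by apply/rowP => j; rewrite !mxE.
Qed.

Lemma zero_ictv_fields : ictv_fields 0.
Proof.
split; first exact: zero_vpair; have [s0 _ g0] := zero_pair open_Omega finO.
by exists (cst 0) => //; apply/(Lp1P open_Omega); exact: square_integrable1.
Qed.

Context (gamma mu : R) (gamma_gt0 : 0 < gamma).

Lemma TGV_ereal_inf p u : H1 Omega u -> TGV Omega gamma mu p.1 p.2 u = ereal_inf
  [set (regulariser_energy Omega gamma mu sym_part p (u, grad Omega u) v)%:E |
   v in sobolev_vpair Omega].
Proof.
move=> uH; case: p => a b /=; congr ereal_inf; apply/seteqP; split=> [_ [w wH <-]|_ [v sv <-]].
  exists (w, jac Omega w); first exact: vH1_vpair.
  by rewrite -(regulariser_energyE open_Omega finO _ gamma_gt0 sym_part_SI).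
have vH := vpair_vH1 open_Omega sv; exists v.1 => //.
rewrite (regulariser_energyE open_Omega finO _ gamma_gt0 sym_part_SI)//; congr EFin.
have su := H1_pair open_Omega uH.
apply: (regulariser_energy_ae open_Omega finO _ _ sym_part_SI) => //.
- exact: vH1_vpair.
- exact: nearW.
- exact: nearW.
Qed.

(** The gradient of a competitor z may be replaced by any weak gradient v.1 of z;
    its components lie in H^1 of a bounded domain, hence in BV. *)
Lemma ICTV_ereal_inf p u : H1 Omega u -> ICTV Omega gamma mu p.1 p.2 u = ereal_inf
  [set (regulariser_energy Omega gamma mu id p (u, grad Omega u) v)%:E |
   v in ictv_fields].
Proof.
move=> uH; case: p => a b /=; congr ereal_inf; apply/seteqP.
split=> [_ [z [[zL [g gz _]] _ zH] <-]|_ [v [sv [z zL gz]] <-]].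
  exists (grad Omega z, jac Omega (grad Omega z)).
    by split; [exact: vH1_vpair | exists z => //; exact: gradP gz].
  by rewrite -(regulariser_energyE open_Omega finO _ gamma_gt0 (fun A => id)).
have gz' := gradP gz.
have sg : forall i, SI (fun t => grad Omega z t ord0 i).
  apply: (weak_grad_SI open_Omega gz gz') => i; by have [] := sv i.
have gae := weak_grad_uniq open_Omega gz gz'.
have sp i : sobolev_pair Omega ((fun t => grad Omega z t ord0 i), fun t => row i (v.2 t)).
  have [_ sv2 wv] := sv i; split; [exact: sg | exact: sv2 |].
  exact: (weak_grad_ae open_Omega wv (square_integrable_L1loc open_Omega finO (sg i)) (gae i)).
have gH : vH1 Omega (grad Omega z) by move=> i; exact: (pair_H1 open_Omega (sp i)).
exists z.
  split => //.
    split => //; exists v.1 => // i; apply/(Lp1P open_Omega).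
    by apply: (square_integrable1 mO finO); have [] := sv i.
  by move=> i; have [s1 s2 w1] := sp i; exact: (sobolev_BV open_Omega finO s1 s2 w1).
rewrite [LHS](regulariser_energyE (L := id) open_Omega finO mu gamma_gt0 (fun A => id) a b uH gH).
congr EFin; have su := H1_pair open_Omega uH.
apply: (regulariser_energy_ae open_Omega finO _ _ (fun A => id)) => //.
- exact: vH1_vpair.
- exact: nearW.
- by apply: filterS (weak_grad_nearW gae) => t /= h Ot; rewrite h.
Qed.

Context (f0 : 'rV[R]_n -> R) (f0_SI : SI f0).

Definition l2_cost x : R := 2^-1 * sq (fun t => f0 t - x.1 t).

Lemma F_L2E x : sobolev_pair Omega x -> F_L2 Omega f0 x.1 = ((l2_cost x)%:E + 0)%E.
Proof.
move=> [sx1 _ _]; have [_ i1] := square_integrableB mO f0_SI sx1.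
rewrite adde0 /F_L2 /l2_cost EFinM /L2_sqnorm /sqnorm /Rintegral fineK//.
exact: integrable_fin_num.
Qed.

Lemma l2_cost_lsc x : sobolev_pair Omega x -> exists2 C : R, 0 <= C &
  forall (t : R) y, 0 < t <= 1 -> sobolev_pair Omega y ->
    l2_cost x <= l2_cost y + C * (t + pair_sqnorm Omega (y - x) / t).
Proof.
move=> [sx1 _ _]; set S := sq (fun t => f0 t - x.1 t).
have S0 : 0 <= S by exact: sqnorm_ge0.
exists (2^-1 * S + 2^-1); first by rewrite addr_ge0 ?mulr_ge0 ?invr_ge0.
move=> t y /andP[t0 _] [sy1 _ _]; rewrite /l2_cost -/S.
have := sqnorm_lsc mO t0 (square_integrableB mO f0_SI sx1) (square_integrableB mO f0_SI sy1).
have -> : sqnorm leb Omega (fun s => f0 s - y.1 s - (f0 s - x.1 s)) = sq (fun s => y.1 s - x.1 s).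
  by apply: eq_Rintegral => s _; ring.
rewrite -/S => h.
have q0 : sq (fun s => y.1 s - x.1 s) <= pair_sqnorm Omega (y - x).
  by rewrite lerDl sumr_ge0// => i _; exact: sqnorm_ge0.
have d0 := sqnorm_ge0 leb Omega (fun s => y.1 s - x.1 s).
have {}q0 : sq (fun s => y.1 s - x.1 s) / t <= pair_sqnorm Omega (y - x) / t.
  by rewrite ler_pM2r// invr_gt0.
have {}d0 : 0 <= sq (fun s => y.1 s - x.1 s) / t by rewrite divr_ge0// ltW.
set a := _ / t in h q0 d0; set b := _ / t in q0 *.
have := mulr_ge0 S0 (le_trans d0 q0); lra.
Qed.

Hypothesis f0_BV : BV Omega f0.

Lemma F_L1gradE x : F_L1grad Omega gamma f0 x.1 =
  ((grad_cost Omega gamma f0 x)%:E + vtotal_variation (sing_deriv Omega f0) Omega)%E.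
Proof.
rewrite /F_L1grad /grad_cost /Rintegral fineK//.
exact/integrable_fin_num/huber_ac_grad_integrable.
Qed.

Lemma grad_cost_modulus x : sobolev_pair Omega x -> exists2 C : R, 0 <= C &
  forall (t : R) y, 0 < t <= 1 -> sobolev_pair Omega y ->
    grad_cost Omega gamma f0 x <=
    grad_cost Omega gamma f0 y + C * (t + pair_sqnorm Omega (y - x) / t).
Proof.
move=> sx; have V0 : 0 <= fine (leb Omega) by exact: fine_ge0.
exists (fine (leb Omega) + 1); first by rewrite addr_ge0.
move=> t y /andP[t0 _] sy.
have h := grad_cost_lsc open_Omega finO gamma_gt0 f0_BV t0 sx sy.
have [_ sx2 _] := sx; have [_ sy2 _] := sy.
have q0 : sq (fun s => l2norm (y.2 s - x.2 s)) <= pair_sqnorm Omega (y - x).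
  rewrite sqnorm_l2norm//; first by rewrite big_ord1 lerDr sqnorm_ge0.
  move=> i j; rewrite (ord1 i); have := square_integrableB mO (sy2 j) (sx2 j).
  by congr SI; apply/funext => s; rewrite !mxE.
have {}q0 : sq (fun s => l2norm (y.2 s - x.2 s)) / t <= pair_sqnorm Omega (y - x) / t.
  by rewrite ler_pM2r// invr_gt0.
have d0 := pair_sqnorm_ge0 Omega (y - x).
have {}d0 : 0 <= pair_sqnorm Omega (y - x) / t by rewrite divr_ge0// ltW.
set a := sq _ / t in h q0; set b := pair_sqnorm _ _ / t in q0 d0 *.
set V := fine _ in h V0 *; clearbody a b V.
have Vb := mulr_ge0 V0 d0; apply: le_trans h _; rewrite lerD2l; nra.
Qed.

End regularisers_and_costs.

Theorem theorem2p1 (R : realType) (n : nat) (n_gt0 : (0 < n)%N)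
    (Omega : set 'rV[R]_n) (dom_Omega : bounded_lipschitz_domain Omega)
    (alphabar betabar gamma mu : R)
    (alphabar_ge0 : 0 <= alphabar) (betabar_ge0 : 0 <= betabar)
    (gamma_gt0 : 0 < gamma) (mu_gt0 : 0 < mu)
    (f : 'rV[R]_n -> R) (f_L2 : Lp Omega 2%:E f)
    (Reg : R -> R -> ('rV[R]_n -> R) -> \bar R)
    (RegE : Reg = TGV Omega gamma mu \/ Reg = ICTV Omega gamma mu)
    (f0 : 'rV[R]_n -> R) (f0_L2 : Lp Omega 2%:E f0)
    (F : ('rV[R]_n -> R) -> \bar R)
    (FE : F = F_L2 Omega f0 \/ (BV Omega f0 /\ F = F_L1grad Omega gamma f0)) :
  exists alpha beta : R,
    learning_optimal Omega Reg F f alphabar betabar alpha beta.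
Proof.
have [oO _ _ bO _] := dom_Omega; have finO := bounded_lebesgue_lty oO bO.
have f_SI := (Lp2P oO f).1 f_L2; have f0_SI := (Lp2P oO f0).1 f0_L2.
have [G [c [GE G_ge0 G_lsc]]] : exists (G : scalar_pair -> R) (c : \bar R),
    [/\ forall x, sobolev_pair Omega x -> F x.1 = ((G x)%:E + c)%E,
        forall x, sobolev_pair Omega x -> 0 <= G x &
        forall x, sobolev_pair Omega x -> exists2 C : R, 0 <= C &
          forall (t : R) y, 0 < t <= 1 -> sobolev_pair Omega y ->
          G x <= G y + C * (t + pair_sqnorm Omega (y - x) / t)].
  case: FE => [->|[f0_BV ->]].
    exists (l2_cost Omega f0), 0%E; split.
    - by move=> x; exact: F_L2E.
    - by move=> x _; rewrite mulr_ge0 ?invr_ge0// sqnorm_ge0.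
    - by move=> x; exact: l2_cost_lsc.
  exists (grad_cost Omega gamma f0), (vtotal_variation (sing_deriv Omega f0) Omega); split.
  - by move=> x _; exact: F_L1gradE.
  - by move=> x _; apply: Rintegral_ge0 => t _; exact: huber_ge0.
  - by move=> x; exact: grad_cost_modulus.
case: RegE => ->.
- apply: (learning_optimal_exists oO finO gamma_gt0 mu_gt0 (@sym_part_midpoint R n)
    (@l2norm_sym R n) (sym_part_SI oO) (@subset_refl _ (sobolev_vpair Omega)) _ _ f_SI
    alphabar_ge0 betabar_ge0 _ GE G_ge0 G_lsc).
  + by move=> v w; exact: sobolev_vpair_midpoint.
  + by exists 0; exact: zero_vpair.
  + by move=> p u _ _; exact: TGV_ereal_inf.
- apply: (learning_optimal_exists (L := id) (W := ictv_fields Omega) oO finO gamma_gt0 mu_gt0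
    _ _ _ _ _ _ f_SI alphabar_ge0 betabar_ge0 _ GE G_ge0 G_lsc) => //.
  + by move=> v [].
  + by move=> v w; exact: ictv_fields_midpoint.
  + by exists 0; exact: zero_ictv_fields.
  + by move=> p u _ _; exact: ICTV_ereal_inf.
Qed.
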